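(* For the two-parameter family of Bianchi IX gravitational instanton metrics parametrized by $(p,q)$, the operators $\tilde D^2[p,q]$, $\tilde D^2[p,q+p+\frac12]$ and $\tilde D^2[-q,p]$ are isospectral on spin bundles over $M_0$, $M_1$ and $M_2$ respectively. More precisely, under the isospectral transformations $(p,q)\mapsto(p,q+p+\frac12)$ and $(p,q)\mapsto(-q,p)$, an eigenspinor $u_n(\mu)$ corresponding to a particular eigenvalue $\lambda_n^2[p,q]$ of $\tilde D^2$ transforms as $u_n(\mu)\mapsto u_n(\mu-i)$ and $u_n(\mu)\mapsto-\gamma^0u_n(\frac1\mu)$ respectively, where the spatial dependence of $u_n$ is invariant and suppressed. The transformations of the eigenspinors define a bijection between the spaces of eigenspinors of the corresponding operators.
   Context: For $p,q\in\mathbb C$, $\Re(\mu)>0$, put $\vartheta[p,q](i\mu)=\sum_{m\in\mathbb Z}\exp(-\pi(m+p)^2\mu+2\pi i(m+p)q)$, $\vartheta_2=\vartheta[\frac12,0]$, $\vartheta_3=\vartheta[0,0]$, $\vartheta_4=\vartheta[0,\frac12]$, and let $\partial_q\vartheta[a,b]$ denote the derivative in the second characteristic evaluated at $[a,b]$. Set (theta functions at $i\mu$, $\Lambda$ a nonzero constant) $$w_1[p,q]=-\tfrac i2\vartheta_3\vartheta_4\frac{\partial_q\vartheta[p,q+\frac12]}{e^{\pi ip}\vartheta[p,q]},\quad w_2[p,q]=\tfrac i2\vartheta_2\vartheta_4\frac{\partial_q\vartheta[p+\frac12,q+\frac12]}{e^{\pi ip}\vartheta[p,q]},$$ $$w_3[p,q]=-\tfrac12\vartheta_2\vartheta_3\frac{\partial_q\vartheta[p+\frac12,q]}{\vartheta[p,q]},\quad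 F[p,q]=\frac{2}{\pi\Lambda}\left(\frac{\vartheta[p,q]}{\partial_q\vartheta[p,q]}\right)^2.$$ The metric is $d\tilde s^2 = F\left(w_1w_2w_3\,d\mu^2+\frac{w_2w_3}{w_1}\sigma_1^2+\frac{w_3w_1}{w_2}\sigma_2^2+\frac{w_1w_2}{w_3}\sigma_3^2\right)$ with $w_j=w_j[p,q]$, $F=F[p,q]$, where $\sigma_j$ are left-invariant 1-forms on $SU(2)\cong\mathbb S^3$ with $d\sigma_1=\sigma_2\wedge\sigma_3$ and cyclic permutations. In the coordinates $(\mu,\eta,\phi,\psi)$, with $\mathbb S^3$ parametrized by $(\cos(\eta/2)e^{i(\phi+\psi)/2},\sin(\eta/2)e^{i(\phi-\psi)/2})$, its Dirac operator is $\tilde D[p,q]=\frac1{\sqrt F}D+\frac{3F'}{4F^{3/2}\sqrt{w_1w_2w_3}}\gamma^0$, where $$D=\sqrt{\tfrac{w_1}{w_2w_3}}\,\gamma^1\big(-\cot\eta\cos\psi\,\partial_\psi+\csc\eta\cos\psi\,\partial_\phi-\sin\psi\,\partial_\eta\big)+\sqrt{\tfrac{w_2}{w_1w_3}}\,\gamma^2\big(-\cot\eta\sin\psi\,\partial_\psi+\csc\eta\sin\psi\,\partial_\phi+\cos\psi\,\partial_\eta\big)$$ $$+\tfrac{1}{\sqrt{w_1w_2w_3}}\gamma^0\partial_\mu+\sqrt{\tfrac{w_3}{w_1w_2}}\gamma^3\partial_\psi+\tfrac{1}{4\sqrt{w_1w_2w_3}}\Big(\tfrac{w_1'}{w_1}+\tfrac{w_2'}{w_2}+\tfrac{w_3'}{w_3}\Big)\gamma^0-\tfrac{\sqrt{w_1w_2w_3}}{4}\Big(\tfrac1{w_1^2}+\tfrac1{w_2^2}+\tfrac1{w_3^2}\Big)\gamma^1\gamma^2\gamma^3,$$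 and $\gamma^0,\dots,\gamma^3$ are $4\times4$ matrices with $(\gamma^a)^2=-I$, $\gamma^a\gamma^b+\gamma^b\gamma^a=0$ for $a\ne b$. The definitions are extended to complex $p,q$ and complex $\mu$ with $i\mu$ in the upper half-plane, excluding zeros of theta functions and their derivatives that appear in denominators. Base manifolds: $M_0=I_{(a,b)}\times\mathbb S^3$, where $I_{(a,b)}$ is a path of values of $\mu$ from $a$ to $b$ with $i\mu$ in the upper half-plane; $M_1=(a+i,b+i)\times\mathbb S^3$, the shift of $M_0$ by $\mu\mapsto\mu+i$; $M_2=(\frac1b,\frac1a)\times\mathbb S^3$, the image of $M_0$ under $\mu\mapsto1/\mu$. An eigenspinor is a section $u$ of the spin bundle satisfying the eigenvalue equation.
   Formalization: As the maps exchange two of the w_j, literally unchanged spatial dependence fails; the eigenspinor maps u(μ−i) and −γ⁰u(1/μ) are combined with a fixed right translation of SU(2) and a fixed constant matrix in γ¹,γ²,γ³ relabelling the frame σ_j. *)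

(* Defs.v *)
From HB Require Import structures.
From mathcomp Require Import all_boot all_order all_algebra.
From mathcomp Require Import all_classical all_reals all_analysis.
From mathcomp Require Import complex.

Set Implicit Arguments.
Unset Strict Implicit.
Unset Printing Implicit Defensive.

Import Order.TTheory GRing.Theory Num.Theory.
Import numFieldNormedType.Exports.

Local Open Scope classical_set_scope.
Local Open Scope ring_scope.
Local Open Scope complex_scope.

Section ComplexFunctions.
Context {R : realType}.
Implicit Types (z p q mu Lam : R[i]).

Definition cexp z : R[i] :=
  (expR (complex.Re z))%:C * (cos (complex.Im z) +i* sin (complex.Im z)).

(* R[i]^o carries the normed-module structure of R[i] over itself, so this is
   the complex (holomorphic) derivative. *)
Definition cderive1 (f : R[i] -> R[i]) z : R[i] :=
  derive1 (f : R[i]^o -> R[i]^o) z.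

Definition rderive1 (f : R -> R[i]) (t : R) : R[i] :=
  derive1 (fun s => complex.Re (f s)) t +i* derive1 (fun s => complex.Im (f s)) t.

Definition theta_term p q mu (m : int) : R[i] :=
  cexp (- pi%:C * (m%:~R + p) ^+ 2 * mu + 2 * pi%:C * 'i * (m%:~R + p) * q).

(* theta[p,q](i mu): the limit of the sums over -n <= m <= n; the series
   converges absolutely when Re mu > 0. *)
Definition theta p q mu : R[i] :=
  lim ((fun n : nat => \sum_(k < n.*2.+1) theta_term p q mu (k%:Z - n%:Z))
       @ \oo : set_system R[i]^o).

Definition dtheta p q mu : R[i] := cderive1 (fun q' => theta p q' mu) q.

Definition theta2 mu : R[i] := theta (1 / 2) 0 mu.
Definition theta3 mu : R[i] := theta 0 0 mu.
Definition theta4 mu : R[i] := theta 0 (1 / 2) mu.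

Definition w1 p q mu : R[i] :=
  - ('i / 2) * theta3 mu * theta4 mu *
  (dtheta p (q + 1 / 2) mu / (cexp (pi%:C * 'i * p) * theta p q mu)).

Definition w2 p q mu : R[i] :=
  ('i / 2) * theta2 mu * theta4 mu *
  (dtheta (p + 1 / 2) (q + 1 / 2) mu / (cexp (pi%:C * 'i * p) * theta p q mu)).

Definition w3 p q mu : R[i] :=
  - (1 / 2) * theta2 mu * theta3 mu * (dtheta (p + 1 / 2) q mu / theta p q mu).

Definition Fconf Lam p q mu : R[i] :=
  2 / (pi%:C * Lam) * (theta p q mu / dtheta p q mu) ^+ 2.

End ComplexFunctions.

Section Smoothness.
Context {R : realType}.

Fixpoint Ck_on (V : normedModType R) (A : set V) (k : nat) (f : V -> R) : Prop :=
  (forall x, A x -> {for x, continuous f}) /\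
  (if k is k'.+1 then
     forall v, (forall x, A x -> derivable f x v) /\
               Ck_on A k' (fun x => 'D_v f x)
   else True).

Definition smooth_on (V : normedModType R) (A : set V) (f : V -> R) : Prop :=
  forall k, Ck_on A k f.

Definition csmooth_on (V : normedModType R) (A : set V) (f : V -> R[i]) : Prop :=
  smooth_on A (fun x => complex.Re (f x)) /\
  smooth_on A (fun x => complex.Im (f x)).

End Smoothness.

Section BaseManifolds.
Context {R : realType}.

(* I_(a,b) is the set of values of an open regular path g : ]0, 1[ -> {Re mu > 0} with
   a = g(0+) and b = g(1-); the ends, which may also be 0 or infinity, do not
   belong to it.  Self-crossings are not excluded. *)
Definition mu_path (g : R -> R[i]) : Prop :=
  @csmooth_on R R `]0, 1[%classic g /\
  forall t, t \in `]0, 1[ -> 0 < complex.Re (g t) /\ rderive1 g t != 0.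

(* The paths from a + i to b + i and from 1/b to 1/a. *)
Definition shift_path (g : R -> R[i]) (t : R) : R[i] := g t + 'i.
Definition inv_path (g : R -> R[i]) (t : R) : R[i] := (g (1 - t))^-1.

Definition path_values (g : R -> R[i]) : set R[i] := g @` `]0, 1[%classic.

(* S^3 is the unit sphere of C^2; (z1, z2) is the matrix
   [z1, z2; - z2^*, z1^*] of SU(2). *)
Definition sphere3 : set (R[i] * R[i]) :=
  [set x | `|x.1| ^+ 2 + `|x.2| ^+ 2 = 1].

Definition euler (eta phi psi : R) : R[i] * R[i] :=
  ((cos (eta / 2))%:C * cexp ('i * ((phi + psi) / 2)%:C),
   (sin (eta / 2))%:C * cexp ('i * ((phi - psi) / 2)%:C)).

(* The radial projection of R^4 \ {0} onto S^3. *)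
Definition radial (x : 'rV[R]_4) : R[i] * R[i] :=
  let n := Num.sqrt (\sum_j x ord0 j ^+ 2) in
  ((x ord0 0 / n) +i* (x ord0 1 / n), (x ord0 2 / n) +i* (x ord0 3 / n)).

(* The global frame dual to the sigma_j trivializes the spin bundle, so that a
   spinor is a C^4-valued function of mu and of the point of S^3. *)
Definition spinor := R[i] -> R[i] * R[i] -> 'cV[R[i]]_4.

(* A section over (path_values g) x S^3 is extended by 0, which makes two sections
   equal as functions when they agree on the base.  It is smooth on S^3 when
   its homogeneous extension of degree 0 to R^4 \ {0} is. *)
Definition smooth_section (g : R -> R[i]) (u : spinor) : Prop :=
  (forall mu x, ~ (path_values g mu /\ sphere3 x) -> u mu x = 0) /\
  (forall a : 'I_4,
     csmooth_on [set y : R * 'rV[R]_4 | (y.1 \in `]0, 1[) /\ (y.2 != 0)]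
       (fun y => u (g y.1) (radial y.2) a ord0)).

End BaseManifolds.

Arguments spinor R : clear implicits.

Section DiracOperator.
Context {R : realType}.

Definition clifford (gam : 'I_4 -> 'M[R[i]]_4) : Prop :=
  (forall a, gam a *m gam a = - 1%:M) /\
  (forall a b, a != b -> gam a *m gam b + gam b *m gam a = 0).

(* Functions of (t, eta, phi, psi), where mu = g t. *)
Definition coord_spinor := R -> R -> R -> R -> 'cV[R[i]]_4.

Definition in_coord (g : R -> R[i]) (u : spinor R) : coord_spinor :=
  fun t eta phi psi => u (g t) (euler eta phi psi).

Definition vderive1 (f : R -> 'cV[R[i]]_4) (t : R) : 'cV[R[i]]_4 :=
  \col_a rderive1 (fun s => f s a ord0) t.

Definition d_mu (g : R -> R[i]) (u : coord_spinor) : coord_spinor :=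
  fun t eta phi psi =>
    (rderive1 g t)^-1 *: vderive1 (fun s => u s eta phi psi) t.
Definition d_eta (u : coord_spinor) : coord_spinor :=
  fun t eta phi psi => vderive1 (fun s => u t s phi psi) eta.
Definition d_phi (u : coord_spinor) : coord_spinor :=
  fun t eta phi psi => vderive1 (fun s => u t eta s psi) phi.
Definition d_psi (u : coord_spinor) : coord_spinor :=
  fun t eta phi psi => vderive1 (fun s => u t eta phi s) psi.

Definition cotan (x : R) : R := cos x / sin x.
Definition cosec (x : R) : R := (sin x)^-1.

Definition X1 (u : coord_spinor) : coord_spinor := fun t eta phi psi =>
  (- (cotan eta * cos psi))%:C *: d_psi u t eta phi psi
  + (cosec eta * cos psi)%:C *: d_phi u t eta phi psi
  - (sin psi)%:C *: d_eta u t eta phi psi.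

Definition X2 (u : coord_spinor) : coord_spinor := fun t eta phi psi =>
  (- (cotan eta * sin psi))%:C *: d_psi u t eta phi psi
  + (cosec eta * sin psi)%:C *: d_phi u t eta phi psi
  + (cos psi)%:C *: d_eta u t eta phi psi.

(* The excluded zeros: the denominators of w_j, F and of the operator. *)
Definition admissible (p q : R[i]) (g : R -> R[i]) : Prop :=
  forall t, t \in `]0, 1[ ->
    [/\ theta p q (g t) != 0, dtheta p q (g t) != 0, w1 p q (g t) != 0,
        w2 p q (g t) != 0 & w3 p q (g t) != 0].

(* A continuous branch of the square root of f along the path g. *)
Definition sqrt_branch (g : R -> R[i]) (f : R[i] -> R[i]) (r : R -> R[i]) : Prop :=
  forall t, t \in `]0, 1[ ->
    {for t, continuous (r : R -> R[i]^o)} /\ r t ^+ 2 = f (g t).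

(* The quantities under the roots are complex, so the roots are branches along
   the path: rF of sqrt F and rW of sqrt (w1 w2 w3).  The other roots are the
   ones determined by rW: sqrt (w1 / (w2 w3)) = w1 / rW, and cyclically, as
   holds for the positive roots when w1, w2, w3 > 0. *)
Definition dirac (gam : 'I_4 -> 'M[R[i]]_4) (p q : R[i]) (g rW : R -> R[i])
    (u : coord_spinor) : coord_spinor := fun t eta phi psi =>
  let mu := g t in
  let W1 := w1 p q mu in let W2 := w2 p q mu in let W3 := w3 p q mu in
  let r := rW t in
  (W1 / r) *: (gam 1 *m X1 u t eta phi psi)
  + (W2 / r) *: (gam 2 *m X2 u t eta phi psi)
  + r^-1 *: (gam 0 *m d_mu g u t eta phi psi)
  + (W3 / r) *: (gam 3 *m d_psi u t eta phi psi)
  + ((4 * r)^-1 * (cderive1 (w1 p q) mu / W1 + cderive1 (w2 p q) mu / W2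
                   + cderive1 (w3 p q) mu / W3)) *: (gam 0 *m u t eta phi psi)
  - (r / 4 * (1 / W1 ^+ 2 + 1 / W2 ^+ 2 + 1 / W3 ^+ 2)) *:
      (gam 1 *m gam 2 *m gam 3 *m u t eta phi psi).

Definition tdirac (gam : 'I_4 -> 'M[R[i]]_4) (Lam p q : R[i])
    (g rF rW : R -> R[i]) (u : coord_spinor) : coord_spinor :=
  fun t eta phi psi =>
  (rF t)^-1 *: dirac gam p q g rW u t eta phi psi
  + (3 * cderive1 (Fconf Lam p q) (g t) / (4 * rF t ^+ 3 * rW t)) *:
      (gam 0 *m u t eta phi psi).

(* The eigenspace of the square of the operator for the eigenvalue e, zero
   included. *)
Definition eigenspinors (gam : 'I_4 -> 'M[R[i]]_4) (Lam p q : R[i])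
    (g rF rW : R -> R[i]) (e : R[i]) : set (spinor R) :=
  [set u | smooth_section g u /\
     forall t eta phi psi, t \in `]0, 1[ -> eta \in `]0, pi[ ->
       tdirac gam Lam p q g rF rW (tdirac gam Lam p q g rF rW (in_coord g u))
         t eta phi psi
       = e *: in_coord g u t eta phi psi].

Definition spectrum (E : R[i] -> set (spinor R)) : set R[i] :=
  [set e | exists2 u, E e u & exists mu x, u mu x != 0].

(* Same eigenvalues, with the same multiplicities. *)
Definition isospectral (E E' : R[i] -> set (spinor R)) : Prop :=
  spectrum E = spectrum E' /\
  forall e, exists2 T : spinor R -> spinor R,
    (forall c u v, T (fun mu x => c *: u mu x + v mu x)
                   = (fun mu x => c *: T u mu x + T v mu x)) &
    set_bij (E e) (E' e) T.

End DiracOperator.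

Section Transformations.
Context {R : realType}.

(* The maps on (p, q, mu) exchange two of the w_j: for instance
   w2[p,q](mu - i) = w3[p, q+p+1/2](mu), and w1[p,q](1/mu) = mu^2 w3[-q,p](mu)
   while w3[p,q](1/mu) = - mu^2 w1[-q,p](mu).  The spatial part of the spinor is
   therefore the same one only after the invariant frame has been relabelled
   accordingly.  In the fixed coordinates and fixed gamma matrices the
   relabelling is the right translation by h in SU(2), followed by a constant
   matrix lifting it to spinors; it does not depend on mu, p, q.
   - relabel23: h = exp (pi / 4 * [0, i; i, 0]), which maps the frame
     (X1, X2, X3) to (X1, X3, - X2);
   - relabel31: h = exp (pi / 4 * [0, 1; -1, 0]), which maps (X1, X2, X3) to
     (- X3, X2, X1).  As mu |-> 1 / mu reverses the orientation of the mu-axis,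
     the lift is here the one exchanging gamma^1 and gamma^3 up to sign. *)
Definition isqrt2 : R := (Num.sqrt 2)^-1.

Definition relabel23 (gam : 'I_4 -> 'M[R[i]]_4)
    (f : R[i] * R[i] -> 'cV[R[i]]_4) (x : R[i] * R[i]) : 'cV[R[i]]_4 :=
  isqrt2%:C *: ((1%:M - gam 2 *m gam 3) *m
            f (isqrt2%:C * (x.1 + 'i * x.2), isqrt2%:C * ('i * x.1 + x.2))).

Definition relabel31 (gam : 'I_4 -> 'M[R[i]]_4)
    (f : R[i] * R[i] -> 'cV[R[i]]_4) (x : R[i] * R[i]) : 'cV[R[i]]_4 :=
  isqrt2%:C *: ((gam 1 - gam 3) *m
            f (isqrt2%:C * (x.1 - x.2), isqrt2%:C * (x.1 + x.2))).

Definition shift_spinor (gam : 'I_4 -> 'M[R[i]]_4) (u : spinor R) : spinor R :=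
  fun mu => relabel23 gam (u (mu - 'i)).

Definition inv_spinor (gam : 'I_4 -> 'M[R[i]]_4) (u : spinor R) : spinor R :=
  fun mu x => - gam 0 *m relabel31 gam (u (1 / mu)) x.

End Transformations.

(* Main.v *)
(** Poisson summation gives the laws of theta[p,q] under mu |-> mu + i and mu |-> 1/mu, and with them
those of w1, w2, w3 and F: up to powers of mu and signs, each map permutes the w_j.  Both maps exchange
two of the invariant vector fields of the frame of S^3, up to sign.  A right translation h of SU(2)
realises the same exchange on functions, and a constant Clifford matrix M realises it on the gamma
matrices, so that u |-> M u(1/mu or mu - i, x h) intertwines the two Dirac operators up to a sign
depending on the branches of the square roots.  That sign is constant along the path by connectedness and
disappears in the squared operators.  The Euler chart misses two circles of S^3: the eigenvalue equation
is written with the invariant frame, which is defined everywhere, and extended to them by continuity. *)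
Require Import Defs.
From HB Require Import structures.
From mathcomp Require Import all_boot all_order all_algebra.
From mathcomp Require Import all_classical all_reals all_analysis.
From mathcomp Require Import complex ring lra.

Import Order.TTheory GRing.Theory Num.Theory.
Import numFieldNormedType.Exports.

Local Open Scope classical_set_scope.
Local Open Scope ring_scope.
Local Open Scope complex_scope.

Set Implicit Arguments.
Unset Strict Implicit.
Unset Printing Implicit Defensive.

(** No Fourier integral is ever formed. The role of the Gaussian integral is played by Riemann sums
    [rsum N] over the grid of mesh 1/N. On an odd grid Poisson summation is an exact finite
    identity, and the limit needs only that these sums are asymptotically independent of a complex
    translation and that mu times the square of the sum at mu does not depend on mu. The constant 1
    comes from the self-duality of theta at mu = 1. Since only the square of the Gaussian sum is
    controlled, the inversion law holds with an undetermined root L of mu, which cancels or appears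
    as L^2 in the w_j and F.

    On the operator side, every coefficient depends on the roots only through the product [rF * rW],
    which is why a single sign compares two operators. These coefficients are shown to be once
    continuously differentiable: the inner operator then sends smooth sections to C^1 functions, the
    outer one to continuous functions, and continuity is what the extension over the two circles
    requires. *)

Local Notation Re := complex.Re.
Local Notation Im := complex.Im.
Notation nrm := Normc.normc.

(** * Modulus, real and imaginary parts *)

Section ComplexNorm.
Context {R : realType}.
Implicit Types z w : R[i].

(** The norm of [R[i]] takes values in [R[i]]. Estimates use the real-valued [nrm] instead, so that
    linear arithmetic over [R] applies to them. *)
Lemma nrmE z : `|z| = (nrm z)%:C.
Proof. by []. Qed.

Lemma nrm_ge0 z : 0 <= nrm z.
Proof. by case: z => a b; rewrite /= sqrtr_ge0. Qed.

Lemma nrm0 : nrm (0 : R[i]) = 0. Proof. exact: Normc.normc0. Qed.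
Lemma nrm1 : nrm (1 : R[i]) = 1. Proof. exact: Normc.normc1. Qed.
Lemma nrmM z w : nrm (z * w) = nrm z * nrm w. Proof. exact: Normc.normcM. Qed.
Lemma nrmV z : nrm z^-1 = (nrm z)^-1. Proof. exact: Normc.normcV. Qed.
Lemma nrmN z : nrm (- z) = nrm z. Proof. exact: normcN. Qed.
Lemma nrmD z w : nrm (z + w) <= nrm z + nrm w. Proof. exact: le_normcD. Qed.
Lemma nrmB z w : nrm (z - w) <= nrm z + nrm w.
Proof. by rewrite -(nrmN w) nrmD. Qed.
Lemma nrmBC z w : nrm (z - w) = nrm (w - z).
Proof. by rewrite -nrmN opprB. Qed.

Lemma nrmX z n : nrm (z ^+ n) = nrm z ^+ n.
Proof. by elim: n => [|n IH]; rewrite ?expr0 ?nrm1// !exprS nrmM IH. Qed.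

Lemma nrm_eq0 z : (nrm z == 0) = (z == 0).
Proof.
apply/eqP/eqP => [|->]; [exact: Normc.eq0_normc|exact: nrm0].
Qed.

Lemma nrm_gt0 z : (0 < nrm z) = (z != 0).
Proof. by rewrite lt_def nrm_ge0 andbT nrm_eq0. Qed.

Lemma nrm_real (x : R) : nrm x%:C = `|x|.
Proof. by rewrite /= expr0n addr0 sqrtr_sqr. Qed.

Lemma nrm_nat n : nrm (n%:R : R[i]) = n%:R.
Proof. by rewrite -(rmorph_nat (real_complex R)) nrm_real normr_nat. Qed.

Lemma nrm_int (m : int) : nrm (m%:~R : R[i]) = `|m%:~R|.
Proof. by rewrite -(rmorph_int (real_complex R)) nrm_real. Qed.

Lemma nrm_i : nrm ('i : R[i]) = 1.
Proof. by rewrite /= expr0n add0r expr1n sqrtr1. Qed.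

Lemma nrm_sqr z : nrm z ^+ 2 = Re z ^+ 2 + Im z ^+ 2.
Proof. by case: z => a b; rewrite /= sqr_sqrtr// addr_ge0 ?sqr_ge0. Qed.

Lemma normr_Re z : `|Re z| <= nrm z.
Proof.
rewrite -(@ler_pXn2r _ 2) ?nnegrE ?nrm_ge0// nrm_sqr real_normK ?num_real//.
by rewrite lerDl sqr_ge0.
Qed.

Lemma normr_Im z : `|Im z| <= nrm z.
Proof.
rewrite -(@ler_pXn2r _ 2) ?nnegrE ?nrm_ge0// nrm_sqr real_normK ?num_real//.
by rewrite lerDr sqr_ge0.
Qed.

Lemma nrm_le_ReIm z : nrm z <= `|Re z| + `|Im z|.
Proof.
rewrite -(@ler_pXn2r _ 2) ?nnegrE ?nrm_ge0 ?addr_ge0// nrm_sqr sqrrD.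
rewrite !real_normK ?num_real// addrAC lerDl mulrn_wge0// mulr_ge0//.
Qed.

Lemma nrm_sum (I : Type) (r : seq I) (P : pred I) (F : I -> R[i]) :
  nrm (\sum_(i <- r | P i) F i) <= \sum_(i <- r | P i) nrm (F i).
Proof.
elim/big_ind2: _ => [|x1 x2 y1 y2 h1 h2|//]; first by rewrite nrm0.
by apply: (le_trans (nrmD _ _)); rewrite lerD.
Qed.

Lemma ReD z w : Re (z + w) = Re z + Re w. Proof. by case: z; case: w. Qed.
Lemma ImD z w : Im (z + w) = Im z + Im w. Proof. by case: z; case: w. Qed.
Lemma ReN z : Re (- z) = - Re z. Proof. by case: z. Qed.
Lemma ImN z : Im (- z) = - Im z. Proof. by case: z. Qed.
Lemma ReM z w : Re (z * w) = Re z * Re w - Im z * Im w.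
Proof. by case: z; case: w. Qed.
Lemma ImM z w : Im (z * w) = Re z * Im w + Im z * Re w.
Proof. by case: z => a b; case: w => c d /=; rewrite addrC. Qed.
Lemma Re_sum (I : Type) (r : seq I) (P : pred I) (F : I -> R[i]) :
  Re (\sum_(i <- r | P i) F i) = \sum_(i <- r | P i) Re (F i).
Proof. by elim/big_ind2: _ => // x1 x2 y1 y2 <- <-; rewrite ReD. Qed.
Lemma Im_sum (I : Type) (r : seq I) (P : pred I) (F : I -> R[i]) :
  Im (\sum_(i <- r | P i) F i) = \sum_(i <- r | P i) Im (F i).
Proof. by elim/big_ind2: _ => // x1 x2 y1 y2 <- <-; rewrite ImD. Qed.

Lemma complexP z w : Re z = Re w -> Im z = Im w -> z = w.
Proof. by case: z => a b; case: w => c d /= -> ->. Qed.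

Lemma mulii : 'i * 'i = -1 :> R[i].
Proof. by rewrite -expr2 sqr_i. Qed.

Lemma Re_int (m : int) : Re (m%:~R : R[i]) = m%:~R.
Proof. by rewrite -(rmorph_int (real_complex R)). Qed.
Lemma Im_int (m : int) : Im (m%:~R : R[i]) = 0.
Proof. by rewrite -(rmorph_int (real_complex R)). Qed.

Lemma complex_half : (1 / 2 : R[i]) = (1 / 2 : R)%:C.
Proof. by rewrite rmorphM fmorphV rmorph_nat rmorph1. Qed.

End ComplexNorm.

(** * The complex exponential and its Taylor remainder *)

Section ComplexExp.
Context {R : realType}.
Implicit Types z w : R[i].

Lemma cexpD z w : cexp (z + w) = cexp z * cexp w.
Proof.
rewrite /cexp ReD ImD expRD cosD sinD; apply: complexP;
  rewrite !(ReM, ImM) /=; ring.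
Qed.

Lemma cexp0 : cexp 0 = 1 :> R[i].
Proof. by rewrite /cexp /= expR0 cos0 sin0 mul1r. Qed.

Lemma cexp_neq0 z : cexp z != 0.
Proof.
apply/eqP => h; have : cexp (z - z) = 0 by rewrite cexpD h mul0r.
by rewrite subrr cexp0 => /eqP; rewrite oner_eq0.
Qed.

Lemma cexpN z : cexp (- z) = (cexp z)^-1.
Proof.
by apply: (mulfI (cexp_neq0 z)); rewrite -cexpD subrr cexp0 divff// cexp_neq0.
Qed.

Lemma cexpB z w : cexp (z - w) = cexp z / cexp w.
Proof. by rewrite cexpD cexpN. Qed.

Lemma nrm_cexp z : nrm (cexp z) = expR (Re z).
Proof.
rewrite /cexp nrmM nrm_real ger0_norm ?expR_ge0//= cos2Dsin2 sqrtr1 mulr1//.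
Qed.

Lemma cexp_real (x : R) : cexp x%:C = (expR x)%:C.
Proof. by rewrite /cexp /= cos0 sin0 mulr1. Qed.

Lemma cexpMn z n : cexp (z *+ n) = cexp z ^+ n.
Proof.
elim: n => [|n IH]; first by rewrite mulr0n expr0 cexp0.
by rewrite mulrSr exprSr cexpD IH.
Qed.

Lemma cexp_i (x : R) : cexp ('i * x%:C) = cos x +i* sin x.
Proof.
have -> : 'i * x%:C = 0 +i* x by apply: complexP; rewrite !(ReM, ImM) /=; ring.
by rewrite /cexp /= expR0 mul1r.
Qed.

Lemma cexp_piM (x : R) : cexp (pi%:C * 'i * x%:C) = cos (pi * x) +i* sin (pi * x).
Proof. by rewrite -cexp_i; congr cexp; rewrite rmorphM /=; ring. Qed.

Lemma cexp_pii : cexp (pi%:C * 'i) = - 1 :> R[i].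
Proof. by rewrite -[X in cexp X]mulr1 (cexp_piM 1) mulr1 cospi sinpi; apply: complexP; rewrite /= ?oppr0. Qed.

Lemma cexp_2pii : cexp (2 * pi%:C * 'i) = 1 :> R[i].
Proof.
have -> : 2 * pi%:C * 'i = pi%:C * 'i + pi%:C * 'i :> R[i] by ring.
by rewrite cexpD cexp_pii mulrNN mulr1.
Qed.

Lemma cexp_2pii_int (m : int) : cexp (2 * pi%:C * 'i * m%:~R) = 1 :> R[i].
Proof.
case: m => n; first by rewrite -pmulrn mulr_natr cexpMn cexp_2pii expr1n.
by rewrite NegzE mulrNz mulrN cexpN -pmulrn mulr_natr cexpMn cexp_2pii expr1n invr1.
Qed.

Lemma cexp_pii2 : cexp (pi%:C * 'i / 2) = 'i :> R[i].
Proof.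
rewrite -[2^-1]mul1r complex_half cexp_piM mulrA mulr1 cos_pihalf sin_pihalf//.
Qed.

Let MVT_bound (f df : R -> R) (b : R) (C : R) :
  (forall x : R, is_derive x 1 f (df x)) ->
  (forall c, `|c| <= `|b| -> `|df c| <= C) -> `|f b - f 0| <= C * `|b|.
Proof.
move=> fd hC.
have fc : continuous f.
  move=> x; apply: differentiable_continuous; apply/derivable1_diffP.
  by have [] := fd x.
have fcw a c : {within `[a, c], continuous f} by exact: continuous_subspaceT.
case: (leP 0 b) => b0.
  have [c cb ->] := MVT_segment b0 (fun x _ => fd x) (fcw _ _).
  rewrite subr0 normrM ler_wpM2r// hC//.
  by move: cb; rewrite in_itv /= => /andP[c0 cb]; rewrite !ger0_norm.
have [c cb] := MVT_segment (ltW b0) (fun x _ => fd x) (fcw _ _).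
rewrite distrC => ->; rewrite sub0r normrM normrN ler_wpM2r// hC//.
move: cb; rewrite in_itv /= => /andP[cb c0]; by rewrite !ler0_norm ?lerN2// ltW.
Qed.

Lemma sin_le_norm (x : R) : `|sin x| <= `|x|.
Proof.
have := @MVT_bound sin cos x 1 (fun x => is_derive_sin x) (fun c _ => cos_max c).
by rewrite sin0 subr0 mul1r.
Qed.

Lemma cos_sub1_le (x : R) : `|cos x - 1| <= x ^+ 2.
Proof.
have := @MVT_bound cos (fun x => - sin x) x `|x| (fun x => is_derive_cos x).
rewrite cos0 -expr2 real_normK ?num_real//; apply => c cx.
by rewrite normrN; exact: le_trans (sin_le_norm c) cx.
Qed.

Lemma sin_subid_le (x : R) : `|sin x - x| <= x ^+ 2.
Proof.
have := @MVT_bound (fun y => sin y - y) (fun x => cos x - 1) x `|x|.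
rewrite sin0 !subr0 -expr2 real_normK ?num_real//; apply => // c cx.
apply: le_trans cx.
have := @MVT_bound cos (fun x => - sin x) c 1 (fun x => is_derive_cos x).
by rewrite cos0 mul1r; apply => d _; rewrite normrN sin_max.
Qed.

(** Everything follows from 1 + x <= exp x used at x and at -x: multiplying 1 - x <= exp (-x) by exp
    x bounds exp x - 1 from above by x exp x. *)
Lemma expR_taylor1 (x : R) : `|expR x - 1 - x| <= x ^+ 2 * expR `|x|.
Proof.
have h1 := expR_ge1Dx x; have h2 := expR_ge1Dx (- x).
have h3 : expR x - 1 <= x * expR x.
  have : (1 - x) * expR x <= expR (- x) * expR x.
    by rewrite ler_wpM2r ?expR_ge0//.
  by rewrite mulrC (mulrC _ (expR x)) expRxMexpNx_1; lra.
rewrite ger0_norm ?subr_ge0; last lra.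
case: (leP 0 x) => x0.
  rewrite ger0_norm// expr2 -mulrA.
  have : x * (expR x - 1) <= x * (x * expR x) by rewrite ler_wpM2l.
  lra.
rewrite ltr0_norm//.
have e1 : 1 <= expR (- x) by rewrite -expR0 ler_expR; lra.
have : x ^+ 2 * 1 <= x ^+ 2 * expR (- x) by rewrite ler_wpM2l ?sqr_ge0.
have : - x * (1 - expR x) <= - x * (- x) by rewrite ler_wpM2l//; lra.
nra.
Qed.

Lemma cexp_taylor1 w : nrm (cexp w - 1 - w) <= 5 * nrm w ^+ 2 * expR (nrm w).
Proof.
set n := nrm w; pose a := Re w; pose b := Im w.
have n0 : 0 <= n by exact: nrm_ge0.
have an : `|a| <= n by exact: normr_Re.
have bn : `|b| <= n by exact: normr_Im.
have E1 : 1 <= expR n by rewrite -expR0 ler_expR.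
have sq x : `|x| <= n -> x ^+ 2 <= n ^+ 2.
  by move=> h; rewrite -real_normK ?num_real// ler_pXn2r// nnegrE.
pose u : R[i] := cos b +i* sin b.
(* Real remainder times the phase u, plus the remainder of u itself, plus a cross term. Their bounds
   carry the factors 1, 2 and 2, whence the constant 5. *)
have -> : cexp w - 1 - w =
    (expR a - 1 - a)%:C * u + ((cos b - 1) +i* (sin b - b)) + a%:C * (u - 1).
  apply: complexP; rewrite /cexp !(ReD, ReN, ImD, ImN, ReM, ImM) /= -/a -/b; ring.
have u1 : nrm u = 1 by rewrite /u /= cos2Dsin2 sqrtr1.
have t1 : nrm ((expR a - 1 - a)%:C * u) <= n ^+ 2 * expR n.
  rewrite nrmM u1 mulr1 nrm_real; apply: le_trans (expR_taylor1 a) _.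
  by rewrite ler_pM ?sqr_ge0 ?expR_ge0 ?sq// ler_expR.
have t2 : nrm ((cos b - 1) +i* (sin b - b)) <= 2 * n ^+ 2.
  apply: le_trans (nrm_le_ReIm _) _ => /=.
  have := cos_sub1_le b; have := sin_subid_le b; have := sq _ bn; lra.
have t3 : nrm (a%:C * (u - 1)) <= 2 * n ^+ 2.
  rewrite nrmM nrm_real expr2 mulrCA ler_pM ?nrm_ge0//.
  apply: le_trans (nrm_le_ReIm _) _ => /=; rewrite oppr0 addr0.
  have h1 := sin_le_norm b.
  have := @MVT_bound cos (fun x => - sin x) b 1 (fun x => is_derive_cos x).
  rewrite cos0 mul1r => h2.
  have {}h2 : `|cos b - 1| <= `|b| by apply: h2 => d _; rewrite normrN sin_max.
  lra.
apply: le_trans (nrmD _ _) _.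
have := nrmD ((expR a - 1 - a)%:C * u) ((cos b - 1) +i* (sin b - b)).
have : n ^+ 2 * 1 <= n ^+ 2 * expR n by rewrite ler_wpM2l ?sqr_ge0.
lra.
Qed.

End ComplexExp.

(** * Sums over the integers *)

Section BiInfiniteSums.
Context {R : realType}.
Implicit Types (f g : int -> R[i]) (s : R[i]).

Definition psum f (a b : nat) : R[i] := \sum_(k < a + b) f (k%:Z - a%:Z).

(** Both ends go to infinity independently, which is stronger than convergence of the symmetric sums
    in the definition of [theta]. *)
Definition zsums f s := forall e : R, 0 < e -> exists K : nat, forall a b,
  (K <= a)%N -> (K <= b)%N -> nrm (psum f a b - s) <= e.

Definition zsum f : R[i] := xget 0 [set s | zsums f s].

Lemma le_eps_eq0 (x C : R) : 0 <= C -> (forall e, 0 < e -> x <= C * e) -> x <= 0.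
Proof.
move=> C0 h; rewrite leNgt; apply/negP => x0.
have e0 : 0 < x / (C + 1) / 2 by rewrite !divr_gt0// ltr_wpDl.
have := h _ e0; apply/negP; rewrite -ltNge.
rewrite mulrA ltr_pdivrMr// mulrA ltr_pdivrMr ?ltr_wpDl//; nra.
Qed.

Lemma zsums_unique f s t : zsums f s -> zsums f t -> s = t.
Proof.
move=> hs ht; apply/eqP; rewrite -subr_eq0 -nrm_eq0 eq_le nrm_ge0 andbT.
apply: (@le_eps_eq0 _ 2) => // e e0.
have [K hK] := hs e e0; have [L hL] := ht e e0.
have h1 := hK (maxn K L) (maxn K L) (leq_maxl _ _) (leq_maxl _ _).
have h2 := hL (maxn K L) (maxn K L) (leq_maxr _ _) (leq_maxr _ _).
set P := psum _ _ _ in h1 h2.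
have -> : s - t = (P - t) - (P - s) by ring.
apply: le_trans (nrmB _ _) _; lra.
Qed.

Lemma zsum_unique f s : zsums f s -> zsum f = s.
Proof.
move=> h; rewrite /zsum; case: xgetP => [t _ ht|/(_ s)//].
exact: zsums_unique ht h.
Qed.

Lemma eq_zsums f g s : f =1 g -> zsums f s -> zsums g s.
Proof.
move=> fg h e e0; have [K hK] := h e e0; exists K => a b Ka Kb.
by rewrite /psum; under eq_bigr do rewrite -fg; exact: hK.
Qed.

Lemma zsumsD f g s t : zsums f s -> zsums g t ->
  zsums (fun m => f m + g m) (s + t).
Proof.
move=> hs ht e e0; have e20 : 0 < e / 2 by rewrite divr_gt0.
have [K hK] := hs _ e20; have [L hL] := ht _ e20.
exists (maxn K L) => a b; rewrite !geq_max => /andP[Ka La] /andP[Kb Lb].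
have -> : psum (fun m => f m + g m) a b = psum f a b + psum g a b.
  by rewrite /psum big_split.
have := hK _ _ Ka Kb; have := hL _ _ La Lb => h1 h2.
have -> x y : x + y - (s + t) = (x - s) + (y - t) by ring.
apply: le_trans (nrmD _ _) _; lra.
Qed.

Lemma zsumsZ f s c : zsums f s -> zsums (fun m => c * f m) (c * s).
Proof.
move=> hs e e0; have c0 : 0 < nrm c + 1 by rewrite ltr_wpDl// nrm_ge0.
have [K hK] := hs (e / (nrm c + 1)) (divr_gt0 e0 c0).
exists K => a b Ka Kb.
have -> : psum (fun m => c * f m) a b = c * psum f a b by rewrite /psum mulr_sumr.
rewrite -mulrBr nrmM.
have := hK _ _ Ka Kb; rewrite ler_pdivlMr// => h.
apply: le_trans h; rewrite mulrC ler_wpM2l ?nrm_ge0//; lra.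
Qed.

Lemma zsumsB f g s t : zsums f s -> zsums g t ->
  zsums (fun m => f m - g m) (s - t).
Proof.
move=> hs ht; rewrite -[s - t]/(s + - t) -mulN1r.
apply: eq_zsums (zsumsD hs (zsumsZ (-1) ht)) => m.
by rewrite mulN1r.
Qed.

Lemma zsums_sum N (F : 'I_N -> int -> R[i]) (S : 'I_N -> R[i]) :
  (forall j, zsums (F j) (S j)) ->
  zsums (fun m => \sum_j F j m) (\sum_j S j).
Proof.
elim: N F S => [|N IH] F S h.
  move=> e e0; exists 0%N => a b _ _.
  by rewrite /psum big_ord0 big1 ?subr0 ?nrm0 ?ltW// => k _; rewrite big_ord0.
rewrite big_ord_recr; have := zsumsD (IH _ _ (fun j => h (widen_ord (leqnSn N) j))) (h ord_max).
by apply: eq_zsums => m; rewrite big_ord_recr.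
Qed.

Lemma zsums_shift f s : zsums f s <-> zsums (fun m => f (m + 1)) s.
Proof.
have E a b : psum (fun m => f (m + 1)) a.+1 b = psum f a b.+1.
  rewrite /psum addSnnS; apply: eq_bigr => k _; congr f.
  rewrite (_ : a.+1%:Z = a%:Z + 1) ?intS 1?addrC//; ring.
split=> h e e0; have [K hK] := h e e0.
  exists K.+1 => [[//|a]] b Ka Kb; rewrite E; apply: hK => //.
  exact: leqW (ltnW Kb).
exists K.+1 => a [//|b] Ka Kb; rewrite -E; apply: hK => //.
exact: leqW (ltnW Ka).
Qed.

(** The ends -N a and N b are multiples of N, so the range is an exact union of blocks of N
    consecutive indices. *)
Lemma psum_dissect f N a b :
  psum (fun k => \sum_(j < N) f (N%:Z * k + j%:Z)) a b = psum f (N * a)%N (N * b)%N.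
Proof.
rewrite /psum -mulnDr -(big_mkord xpredT (fun k => f (k%:Z - (N * a)%N%:Z))).
rewrite mulnC big_nat_mul big_mkord; apply: eq_bigr => k _.
rewrite -[X in \sum_(X <= _ < _) _]add0n big_addn mulSn addnK big_mkord.
apply: eq_bigr => j _; congr f; rewrite !(PoszD, PoszM); ring.
Qed.

Lemma zsums_dissect f s N : (0 < N)%N -> zsums f s ->
  zsums (fun k => \sum_(j < N) f (N%:Z * k + j%:Z)) s.
Proof.
move=> N0 h e e0; have [K hK] := h e e0; exists K => a b Ka Kb.
rewrite psum_dissect; apply: hK.
  exact: leq_trans Ka (leq_pmull _ N0).
exact: leq_trans Kb (leq_pmull _ N0).
Qed.

Lemma geometric_dominated (g : nat -> R[i]) (C r : R) : 0 < r < 1 ->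
  (forall k, nrm (g k) <= C * r ^+ k) ->
  exists s, forall n, nrm (\sum_(k < n) g k - s) <= C * r ^+ n / (1 - r).
Proof.
move=> /andP[r0 r1] hg.
have C0 : 0 <= C by have := le_trans (nrm_ge0 _) (hg 0%N); rewrite expr0 mulr1.
have dr : 0 < 1 - r by rewrite subr_gt0.
have T (h : nat -> R) : (forall k, `|h k| <= C * r ^+ k) ->
  exists u : R, series h @ \oo --> u.
  move=> hh; exists (lim (series h @ \oo)); apply: normed_cvg.
  apply: (@series_le_cvg _ _ (geometric C r)).
  - by move=> n; rewrite normr_ge0.
  - by move=> n; rewrite /geometric /= mulr_ge0 ?exprn_ge0// ltW.
  - exact: hh.
  - by apply: is_cvg_geometric_series; rewrite ger0_norm// ltW.
have [s1 h1] := T (fun k => Re (g k)) (fun k => le_trans (normr_Re _) (hg k)).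
have [s2 h2] := T (fun k => Im (g k)) (fun k => le_trans (normr_Im _) (hg k)).
exists (s1 +i* s2) => n.
(* The tail bound is first proved between two partial sums, then passed to the limit through a large
   M. *)
have tail d : nrm (\sum_(k < n) g k - \sum_(k < n + d) g k) <= C * r ^+ n / (1 - r).
  rewrite big_split_ord /= opprD addrA subrr sub0r nrmN.
  apply: le_trans (nrm_sum _ _ _) _.
  apply: (@le_trans _ _ (\sum_(i < d) C * r ^+ (n + i))); first exact: ler_sum.
  rewrite ler_pdivlMr//.
  under eq_bigr do rewrite exprD mulrA.
  rewrite -mulr_sumr; set S := \sum_(i < d) _.
  rewrite (_ : _ * _ * (1 - r) = C * (r ^+ n * (S * (1 - r)))); last by ring.
  rewrite ler_wpM2l// ler_piMr ?exprn_ge0 ?(ltW r0)//.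
  have := subrX1 r d; have := exprn_ge0 d (ltW r0); rewrite -/S; lra.
apply/ler_addgt0Pr => e e0.
have e20 : 0 < e / 2 by rewrite divr_gt0.
move/cvgrPdist_le : h1 => /(_ _ e20) c1; move/cvgrPdist_le : h2 => /(_ _ e20) c2.
near \oo => M.
have nM : (n <= M)%N by near: M; exact: nbhs_infty_ge.
have d1 : `|s1 - series (fun k => Re (g k)) M| <= e / 2 by near: M.
have d2 : `|s2 - series (fun k => Im (g k)) M| <= e / 2 by near: M.
have := tail (M - n)%N; rewrite subnKC// => t.
have -> : \sum_(k < n) g k - (s1 +i* s2) =
   (\sum_(k < n) g k - \sum_(k < M) g k) - (s1 +i* s2 - \sum_(k < M) g k) by ring.
apply: le_trans (nrmB _ _) _.
have : nrm (s1 +i* s2 - \sum_(k < M) g k) <= e.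
  apply: le_trans (nrm_le_ReIm _) _.
  rewrite ReD ImD ReN ImN Re_sum Im_sum /=.
  by move: d1 d2; rewrite /series /= !big_mkord; lra.
lra.
Unshelve. all: by end_near. Qed.

(** Two geometric series of ratio exp (-h), each bounded by C / (1 - exp (-h)) <= 2 C / h. The
    explicit dependence on h matters: h will be the mesh 1/N of a grid. *)
Lemma zsums_dominated f (C h : R) : 0 < h <= 1 ->
  (forall m, nrm (f m) <= C * expR (- (h * `|m%:~R|))) ->
  zsums f (zsum f) /\ nrm (zsum f) <= 4 * C / h.
Proof.
move=> /andP[h0 h1] hf.
have C0 : 0 <= C.
  by have := le_trans (nrm_ge0 _) (hf 0); rewrite normr0 mulr0 oppr0 expR0 mulr1.
pose r := expR (- h).
have r01 : 0 < r < 1 by rewrite expR_gt0 expR_lt1 oppr_lt0.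
(* From (1 + h) r <= 1 and h <= 1. *)
have hr : h / 2 <= 1 - r.
  have := expR_ge1Dx h; have := expRxMexpNx_1 h; rewrite -/r; case/andP: r01; nra.
have dr : 0 < 1 - r by lra.
have powr k : expR (- (h * k%:R)) = r ^+ k by rewrite -mulNr expRM_natr.
have [s1 d1] : exists s, forall n,
    nrm (\sum_(k < n) f k%:Z - s) <= C * r ^+ n / (1 - r).
  apply: (@geometric_dominated (fun k => f k%:Z) C r r01) => k; apply: le_trans (hf _) _.
  by rewrite -pmulrn normr_nat powr.
have [s2 d2] : exists s, forall n,
    nrm (\sum_(k < n) f (- k.+1%:Z) - s) <= C * r ^+ n / (1 - r).
  apply: (@geometric_dominated (fun k => f (- k.+1%:Z)) C r r01) => k; apply: le_trans (hf _) _.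
  rewrite mulrNz normrN -pmulrn normr_nat powr ler_wpM2l//.
  by rewrite exprS ler_piMl ?exprn_ge0//; lra.
have psumE a b : psum f a b = \sum_(k < b) f k%:Z + \sum_(k < a) f (- k.+1%:Z).
  rewrite /psum big_split_ord /= addrC; congr (_ + _).
    by apply: eq_bigr => k _; congr f; rewrite PoszD; ring.
  rewrite (reindex_inj rev_ord_inj); apply: eq_bigr => k _; congr f => /=.
  by rewrite -subzn// addrAC subrr add0r.
have B a b : nrm (psum f a b - (s1 + s2)) <= C * (r ^+ a + r ^+ b) / (1 - r).
  rewrite psumE (_ : _ - _ = (\sum_(k < b) f k%:Z - s1) +
    (\sum_(k < a) f (- k.+1%:Z) - s2)); last by ring.
  apply: le_trans (nrmD _ _) _.
  by rewrite addrC mulrDr mulrDl lerD.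
have Z : zsums f (s1 + s2).
  move=> e e0.
  have e'0 : 0 < e * (1 - r) / (2 * (C + 1)).
    by rewrite divr_gt0 ?mulr_gt0// ltr_wpDl.
  have [r0 r1] := andP r01.
  have cr : (fun k => r ^+ k) @ \oo --> 0.
    by apply: cvg_expr; rewrite ger0_norm// ltW.
  move/cvgrPdist_le : cr => /(_ _ e'0)[K _ hK]; exists K => a b Ka Kb.
  apply: le_trans (B a b) _; rewrite ler_pdivrMr//.
  have := hK a Ka; have := hK b Kb; rewrite /= !sub0r !normrN.
  rewrite !ger0_norm ?exprn_ge0 ?(ltW r0)//.
  rewrite !ler_pdivlMr ?mulr_gt0 ?ltr_wpDl//.
  have := exprn_ge0 a (ltW r0); have := exprn_ge0 b (ltW r0).
  set x := r ^+ a; set y := r ^+ b => y0 x0 hx hy.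
  have : C * (x + y) * 2 <= (x + y) * (2 * (C + 1)) by nra.
  lra.
rewrite (zsum_unique Z); split=> //.
have := B 0%N 0%N; rewrite /psum big_ord0 sub0r nrmN !expr0 => /le_trans -> //.
rewrite ler_pdivrMr// mulrAC ler_pdivlMr//.
have : C * (h / 2) <= C * (1 - r) by rewrite ler_wpM2l.
lra.
Qed.

End BiInfiniteSums.

(** * Gaussian domination by a two-sided exponential *)

Section GaussianBounds.
Context {R : realType}.
Implicit Types (x : R) (u w z : R[i]).

(** Completing the square, with one unit of the linear term kept aside to produce the factor exp
    (-|x|). *)
Lemma gauss_le (al be ga x : R) : 0 < al ->
  expR (- al * x ^+ 2 + be * `|x| + ga) <=
  expR (ga + (be + 1) ^+ 2 / (4 * al)) * expR (- `|x|).
Proof.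
move=> al0; rewrite -expRD ler_expR.
rewrite -(real_normK (num_real x)); set y := `|x|.
have : 0 <= al * (y - (be + 1) / (2 * al)) ^+ 2.
  by rewrite mulr_ge0 ?sqr_ge0// ltW.
have -> : al * (y - (be + 1) / (2 * al)) ^+ 2 =
    al * y ^+ 2 - (be + 1) * y + (be + 1) ^+ 2 / (4 * al).
  by field; rewrite gt_eqF.
lra.
Qed.

Lemma id_le_expR x : x <= expR x.
Proof. by have := expR_ge1Dx x; lra. Qed.

Lemma sqr_le_expR x : 0 <= x -> x ^+ 2 <= 2 * expR x.
Proof.
move=> x0; have := @expR_ge1Dxn R x 1 x0.
rewrite (_ : (2`!)%:R = 2 :> R)//; lra.
Qed.

(** Here ka is the size of a perturbation w of a Gaussian exponent. Half of the Gaussian decay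
    absorbs the quadratic part of w, by [ka * a <= al / 2]; the polynomial |w|^2 costs a factor exp
    (2 |x|), and with the unit spent in [gauss_le] this makes the 3 in the constant. *)
Lemma taylor_gauss (al be ga a b c ka x : R) u w :
  0 < al -> 0 <= a -> 0 <= b -> 0 <= c -> 0 <= ka <= 1 -> ka * a <= al / 2 ->
  nrm u <= expR (- al * x ^+ 2 + be * `|x| + ga) ->
  nrm w <= ka * (a * x ^+ 2 + b * `|x| + c) ->
  nrm (u * (cexp w - 1 - w)) <=
  ka ^+ 2 * (5 * (2 * a + b + c) ^+ 2 *
     expR (ga + c + (be + b + 3) ^+ 2 / (2 * al))) * expR (- `|x|).
Proof.
move=> al0 a0 b0 c0 /andP[k0 k1] kaa hu hw.
rewrite nrmM; set y := `|x| in hu hw *; have y0 : 0 <= y by rewrite normr_ge0.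
have x2 : x ^+ 2 = y ^+ 2 by rewrite real_normK ?num_real.
have ey : 1 <= expR y by rewrite -expR0 ler_expR.
have pw : a * x ^+ 2 + b * y + c <= (2 * a + b + c) * expR y.
  rewrite x2; have := sqr_le_expR y0; have := id_le_expR y.
  move=> h1 h2; have h3 : a * y ^+ 2 <= a * (2 * expR y) by rewrite ler_wpM2l.
  have h4 : b * y <= b * expR y by rewrite ler_wpM2l.
  have h5 : c * 1 <= c * expR y by rewrite ler_wpM2l.
  lra.
have w1 : nrm w <= ka * ((2 * a + b + c) * expR y).
  by apply: le_trans hw _; rewrite ler_wpM2l.
have w2 : nrm w <= al / 2 * x ^+ 2 + b * y + c.
  apply: le_trans hw _; rewrite !mulrDr lerD//; last by rewrite ler_piMl.
  rewrite lerD//; last by rewrite ler_piMl// mulr_ge0.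
  by rewrite mulrA ler_wpM2r ?sqr_ge0.
have w3 : nrm w ^+ 2 <= ka ^+ 2 * (2 * a + b + c) ^+ 2 * expR (y + y).
  rewrite expRD -expr2 -!exprMn ler_pXn2r ?nnegrE ?nrm_ge0 ?mulr_ge0 ?expR_ge0//.
    by rewrite -mulrA.
  by rewrite !addr_ge0// mulr_ge0.
have T := cexp_taylor1 w.
have {}T : nrm (cexp w - 1 - w) <= 5 * (ka ^+ 2 * (2 * a + b + c) ^+ 2 * expR (y + y))
    * expR (al / 2 * x ^+ 2 + b * y + c).
  apply: le_trans T _; apply: ler_pM; last by rewrite ler_expR.
  - by rewrite mulr_ge0 ?sqr_ge0.
  - exact: expR_ge0.
  - by rewrite ler_wpM2l.
have {}T := ler_pM (nrm_ge0 _) (nrm_ge0 _) hu T.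
apply: le_trans T _.
rewrite [X in X <= _](_ : _ = ka ^+ 2 * (5 * (2 * a + b + c) ^+ 2) *
   (expR (- al * x ^+ 2 + be * y + ga) * expR (y + y) *
    expR (al / 2 * x ^+ 2 + b * y + c))); last by ring.
rewrite -!expRD.
rewrite (_ : - al * x ^+ 2 + be * y + ga + (y + y) + (al / 2 * x ^+ 2 + b * y + c) =
  - (al / 2) * x ^+ 2 + (be + b + 2) * y + (ga + c)); last by field.
rewrite [X in _ <= X](_ : _ = ka ^+ 2 * (5 * (2 * a + b + c) ^+ 2) *
  (expR (ga + c + (be + b + 3) ^+ 2 / (2 * al)) * expR (- y))); last by ring.
apply: ler_wpM2l.
  by apply: mulr_ge0; [exact: sqr_ge0|apply: mulr_ge0; rewrite ?sqr_ge0].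
have := @gauss_le (al / 2) (be + b + 2) (ga + c) x.
rewrite -/y (_ : 4 * (al / 2) = 2 * al); last by field.
rewrite (_ : be + b + 2 + 1 = be + b + 3); last by ring.
by apply; rewrite divr_gt0.
Qed.

Lemma exp_le_expR x k : 0 <= x -> x ^+ k <= expR (k%:R * x).
Proof.
by move=> x0; rewrite expRM_natl lerXn2r ?nnegrE ?expR_ge0// id_le_expR.
Qed.

End GaussianBounds.

(** * Theta series with polynomial weights *)

Section ThetaSums.
Context {R : realType}.
Implicit Types (p q mu h : R[i]) (m : int).

(** The exponent k counts derivatives: differentiating in q raises it by 1, in mu by 2, up to
    constants. The family is thus closed under both. *)
Definition tterm k p q mu m : R[i] := (m%:~R + p) ^+ k * theta_term p q mu m.
(** The same term at a real argument, to be sampled on grids finer than the integers. *)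
Definition gterm k p q mu (x : R) : R[i] := (x%:C + p) ^+ k *
  cexp (- pi%:C * (x%:C + p) ^+ 2 * mu + 2 * pi%:C * 'i * (x%:C + p) * q).
Definition tsum k p q mu : R[i] := zsum (tterm k p q mu).

Let cpi : R[i] := pi%:C.
Let pi0 : 0 <= pi :> R := pi_ge0 R.

Lemma nrm_pi : nrm (pi%:C : R[i]) = pi.
Proof. by rewrite nrm_real ger0_norm ?pi_ge0. Qed.

Lemma Re_le_nrm (z : R[i]) : Re z <= nrm z.
Proof. exact: le_trans (ler_norm _) (normr_Re z). Qed.

(* The exponent of the terms is bounded uniformly on {|p| <= P, |q| <= Q, |mu| <= M, Re mu >= al}. *)
Lemma gterm_le k p q mu (x : R) (P Q M al : R) :
  nrm p <= P -> nrm q <= Q -> nrm mu <= M -> al <= Re mu ->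
  nrm (gterm k p q mu x) <= expR (- (pi * al) * x ^+ 2 +
    (2 * pi * (P * M + Q) + k%:R) * `|x| + (pi * (P ^+ 2 * M + 2 * P * Q) + k%:R * P)).
Proof.
move=> hp hq hmu hal; set y := `|x|.
have y0 : 0 <= y by exact: normr_ge0.
have P0 : 0 <= P by exact: le_trans (nrm_ge0 _) hp.
have Q0 : 0 <= Q by exact: le_trans (nrm_ge0 _) hq.
have M0 : 0 <= M by exact: le_trans (nrm_ge0 _) hmu.
rewrite /gterm nrmM nrmX.
have h1 : nrm (x%:C + p) ^+ k <= expR (k%:R * (y + P)).
  have n1 : nrm (x%:C + p) <= y + P.
    by apply: le_trans (nrmD _ _) _; rewrite nrm_real lerD.
  apply: le_trans (exp_le_expR k (nrm_ge0 _)) _.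
  by rewrite ler_expR ler_wpM2l.
rewrite (_ : _ + _ + _ = k%:R * (y + P) + (- (pi * al) * x ^+ 2 +
    2 * pi * (P * M + Q) * y + pi * (P ^+ 2 * M + 2 * P * Q))); last by ring.
rewrite expRD; apply: ler_pM; rewrite ?exprn_ge0 ?nrm_ge0//.
rewrite nrm_cexp ler_expR.
have -> : - pi%:C * (x%:C + p) ^+ 2 * mu + 2 * pi%:C * 'i * (x%:C + p) * q =
   - (pi * x ^+ 2)%:C * mu + (x%:C * (2 * pi%:C * ('i * q - p * mu)) +
     pi%:C * (- p ^+ 2 * mu + 2 * ('i * p * q))).
  by rewrite rmorphM rmorphXn; ring.
rewrite ReD; apply: (@le_trans _ _ (- (pi * al) * x ^+ 2 + (2 * pi * (P * M + Q) * y +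
    pi * (P ^+ 2 * M + 2 * P * Q)))); last by rewrite addrA.
rewrite lerD//.
  rewrite (_ : Re _ = - (pi * x ^+ 2) * Re mu); last by rewrite ReM /=; ring.
  have : pi * x ^+ 2 * al <= pi * x ^+ 2 * Re mu.
    by apply: ler_wpM2l => //; apply: mulr_ge0 => //; exact: sqr_ge0.
  lra.
apply: le_trans (Re_le_nrm _) _; apply: le_trans (nrmD _ _) _.
rewrite !nrmM nrm_pi nrm_real (_ : nrm 2 = 2); last exact: (nrm_nat 2).
rewrite lerD//.
  rewrite mulrC ler_wpM2r// ler_wpM2l ?mulr_ge0//.
  apply: le_trans (nrmB _ _) _; rewrite !nrmM nrm_i mul1r addrC lerD//.
  by rewrite ler_pM ?nrm_ge0.
rewrite ler_wpM2l//; apply: le_trans (nrmD _ _) _.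
rewrite !nrmM nrmN nrmX (_ : nrm 2 = 2); last exact: (nrm_nat 2).
rewrite nrm_i mul1r -mulrA lerD//.
  by rewrite ler_pM ?exprn_ge0 ?nrm_ge0// lerXn2r ?nnegrE ?nrm_ge0.
by rewrite ler_wpM2l// ler_pM ?nrm_ge0.
Qed.

Lemma ttermE k p q mu m : tterm k p q mu m = gterm k p q mu m%:~R.
Proof. by rewrite /gterm rmorph_int. Qed.

Lemma tterm_le k p q mu m (P Q M al : R) :
  nrm p <= P -> nrm q <= Q -> nrm mu <= M -> al <= Re mu ->
  nrm (tterm k p q mu m) <= expR (- (pi * al) * m%:~R ^+ 2 +
    (2 * pi * (P * M + Q) + k%:R) * `|m%:~R| + (pi * (P ^+ 2 * M + 2 * P * Q) + k%:R * P)).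
Proof. by rewrite ttermE; exact: gterm_le. Qed.

Lemma tsumP k p q mu : 0 < Re mu -> zsums (tterm k p q mu) (tsum k p q mu).
Proof.
move=> mu0.
have := zsums_dominated (f := tterm k p q mu) (h := 1).
set be := 2 * pi * (nrm p * nrm mu + nrm q) + k%:R.
set ga := pi * (nrm p ^+ 2 * nrm mu + 2 * nrm p * nrm q) + k%:R * nrm p.
move=> /(_ (expR (ga + (be + 1) ^+ 2 / (4 * (pi * Re mu)))))[|m|//].
  by rewrite ltr01 lexx.
apply: le_trans (tterm_le k m (lexx _) (lexx _) (lexx _) (lexx _)) _.
by rewrite mul1r; apply: gauss_le; rewrite mulr_gt0 ?pi_gt0.
Qed.

Lemma psum_theta_cvg (f : int -> R[i]) s : zsums f s ->
  lim ((fun n : nat => \sum_(k < n.*2.+1) f (k%:Z - n%:Z)) @ \oo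
    : set_system R[i]^o) = s.
Proof.
move=> h; apply: cvg_lim => //; apply/cvgrPdist_le => e e0.
(* A positive element of [R[i]] is real, so the tolerance can be replaced by its real part. *)
have e0' : 0 < Re e by rewrite ltcE /= in e0; case/andP: e0.
have [K hK] := h _ e0'; exists K => // n /= Kn.
have := hK n n.+1 Kn (leqW Kn).
rewrite /psum addnS addnn nrmBC => {}h.
have -> : e = (Re e)%:C.
  by move: e0; rewrite ltcE /= => /andP[/eqP i0 _]; apply: complexP.
by rewrite nrmE lecR.
Qed.

Lemma thetaE p q mu : 0 < Re mu -> theta p q mu = tsum 0 p q mu.
Proof.
move=> mu0; apply: psum_theta_cvg; apply: eq_zsums (tsumP 0 p q mu0) => m.
by rewrite /tterm expr0 mul1r.
Qed.

Lemma tterm_addq k p q h mu m :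
  tterm k p (q + h) mu m = tterm k p q mu m * cexp (2 * pi%:C * 'i * (m%:~R + p) * h).
Proof.
rewrite /tterm /theta_term -[RHS]mulrA; congr (_ * _); rewrite -cexpD; congr cexp; ring.
Qed.

Lemma tterm_addmu k p q h mu m :
  tterm k p q (mu + h) m = tterm k p q mu m * cexp (- pi%:C * (m%:~R + p) ^+ 2 * h).
Proof.
rewrite /tterm /theta_term -[RHS]mulrA; congr (_ * _); rewrite -cexpD; congr cexp; ring.
Qed.

Lemma zsums_small (f : int -> R[i]) s (C h : R) : 0 < h <= 1 -> zsums f s ->
  (forall m, nrm (f m) <= C * expR (- (h * `|m%:~R|))) -> nrm s <= 4 * C / h.
Proof.
move=> h01 fs hf; have [_] := zsums_dominated h01 hf.
by rewrite (zsum_unique fs).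
Qed.

(** Each term is multiplied by the exponential of an increment affine in m, and [taylor_gauss] with
    a = 0 bounds the second order remainders by a summable sequence. *)
Lemma tsum_dq k p q mu : 0 < Re mu -> exists K, forall h, nrm h <= 1 ->
  nrm (tsum k p (q + h) mu - tsum k p q mu - 2 * pi%:C * 'i * tsum k.+1 p q mu * h)
  <= K * nrm h ^+ 2.
Proof.
move=> mu0.
set be := 2 * pi * (nrm p * nrm mu + nrm q) + k%:R.
set ga := pi * (nrm p ^+ 2 * nrm mu + 2 * nrm p * nrm q) + k%:R * nrm p.
pose b : R := 2 * pi; pose c := 2 * pi * nrm p.
have b0 : 0 <= b by rewrite mulr_ge0.
have c0 : 0 <= c by rewrite mulr_ge0 ?nrm_ge0.
pose K0 := 5 * (2 * 0 + b + c) ^+ 2 *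
     expR (ga + c + (be + b + 3) ^+ 2 / (2 * (pi * Re mu))).
exists (4 * K0) => h h1.
have Z := zsumsB (zsumsB (tsumP k p (q + h) mu0) (tsumP k p q mu0))
   (zsumsZ (2 * pi%:C * 'i * h) (tsumP k.+1 p q mu0)).
have hh : 0 < (1 : R) <= 1 by rewrite ltr01 lexx.
have := zsums_small hh Z (C := nrm h ^+ 2 * K0).
rewrite (_ : 2 * pi%:C * 'i * h * _ = 2 * pi%:C * 'i * tsum k.+1 p q mu * h); last by ring.
rewrite (_ : 4 * (nrm h ^+ 2 * K0) / 1 = 4 * K0 * nrm h ^+ 2); last by field.
apply => m; rewrite mul1r.
rewrite (_ : _ - _ = tterm k p q mu m * (cexp (2 * pi%:C * 'i * (m%:~R + p) * h) - 1
   - 2 * pi%:C * 'i * (m%:~R + p) * h)); last first.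
  by rewrite tterm_addq /tterm exprS; ring.
apply: (@taylor_gauss _ (pi * Re mu) be ga 0 b c).
- by rewrite mulr_gt0 ?pi_gt0.
- by [].
- by [].
- by [].
- by rewrite nrm_ge0.
- by rewrite mulr0 !mulr_ge0// ltW.
- exact: tterm_le.
rewrite !nrmM nrm_pi nrm_i mulr1 (_ : nrm 2 = 2); last exact: (nrm_nat 2).
rewrite mulrC ler_wpM2l ?nrm_ge0// mul0r add0r /b /c -mulrDr ler_wpM2l//.
by apply: le_trans (nrmD _ _) _; rewrite nrm_int.
Qed.

(** The increment of the exponent is now quadratic in m. The condition [nrm h <= Re mu / 2] is what
    keeps it below half of the Gaussian decay, and it also keeps mu + h in the half-plane. *)
Lemma tsum_dmu k p q mu : 0 < Re mu -> exists K, forall h, nrm h <= 1 ->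
  nrm h <= Re mu / 2 ->
  nrm (tsum k p q (mu + h) - tsum k p q mu - - pi%:C * tsum k.+2 p q mu * h)
  <= K * nrm h ^+ 2.
Proof.
move=> mu0.
set be := 2 * pi * (nrm p * nrm mu + nrm q) + k%:R.
set ga := pi * (nrm p ^+ 2 * nrm mu + 2 * nrm p * nrm q) + k%:R * nrm p.
pose b := 2 * pi * nrm p; pose c := pi * nrm p ^+ 2.
have b0 : 0 <= b by rewrite !mulr_ge0 ?nrm_ge0.
have c0 : 0 <= c by rewrite mulr_ge0 ?exprn_ge0 ?nrm_ge0.
pose K0 := 5 * (2 * pi + b + c) ^+ 2 *
     expR (ga + c + (be + b + 3) ^+ 2 / (2 * (pi * Re mu))).
exists (4 * K0) => h h1 hmu.
have muh : 0 < Re (mu + h).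
  rewrite ReD; have := normr_Re h; rewrite ler_norml => /andP[]; lra.
have Z := zsumsB (zsumsB (tsumP k p q muh) (tsumP k p q mu0))
   (zsumsZ (- pi%:C * h) (tsumP k.+2 p q mu0)).
have hh : 0 < (1 : R) <= 1 by rewrite ltr01 lexx.
have := zsums_small hh Z (C := nrm h ^+ 2 * K0).
rewrite (_ : - pi%:C * h * _ = - pi%:C * tsum k.+2 p q mu * h); last by ring.
rewrite (_ : 4 * (nrm h ^+ 2 * K0) / 1 = 4 * K0 * nrm h ^+ 2); last by field.
apply => m; rewrite mul1r.
rewrite (_ : _ - _ = tterm k p q mu m * (cexp (- pi%:C * (m%:~R + p) ^+ 2 * h) - 1
   - (- pi%:C * (m%:~R + p) ^+ 2 * h))); last first.
  by rewrite tterm_addmu /tterm !exprS; ring.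
apply: (@taylor_gauss _ (pi * Re mu) be ga pi b c) => //.
- by rewrite mulr_gt0 ?pi_gt0.
- by rewrite nrm_ge0.
- by rewrite mulrC -mulrA ler_wpM2l.
- exact: tterm_le.
rewrite !nrmM nrmN nrm_pi mulrC ler_wpM2l ?nrm_ge0//.
rewrite /b /c -expr2.
have : nrm (m%:~R + p) ^+ 2 <= (`|m%:~R| + nrm p) ^+ 2.
  by rewrite lerXn2r ?nnegrE ?addr_ge0 ?nrm_ge0// -nrm_int nrmD.
rewrite sqrrD real_normK ?num_real//.
by move=> /(ler_wpM2l pi0) => H; apply: (le_trans H); lra.
Qed.

End ThetaSums.

(** * Riemann sums over the real line *)

Section RiemannSums.
Context {R : realType}.
Implicit Types (f g : R -> R[i]) (C D : R) (N : nat).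

Definition rsum N f : R[i] := N%:R^-1 * zsum (fun m => f (m%:~R / N%:R)).

Definition decays C f := forall x, nrm (f x) <= C * expR (- `|x|).

Lemma decays_ge0 C f : decays C f -> 0 <= C.
Proof.
move=> /(_ 0); rewrite normr0 oppr0 expR0 mulr1; exact: le_trans (nrm_ge0 _).
Qed.

Lemma decays_le C D f : decays C f -> C <= D -> decays D f.
Proof.
by move=> h CD x; apply: le_trans (h x) _; rewrite ler_wpM2r ?expR_ge0.
Qed.

Lemma decaysD C D f g : decays C f -> decays D g ->
  decays (C + D) (fun x => f x + g x).
Proof.
by move=> h k x; rewrite mulrDl; apply: le_trans (nrmD _ _) _; rewrite lerD.
Qed.

Lemma decaysZ C f (c : R[i]) : decays C f -> decays (nrm c * C) (fun x => c * f x).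
Proof. by move=> h x; rewrite nrmM -mulrA ler_wpM2l ?nrm_ge0. Qed.

Lemma decaysB C D f g : decays C f -> decays D g ->
  decays (C + D) (fun x => f x - g x).
Proof.
by move=> h k x; rewrite mulrDl; apply: le_trans (nrmB _ _) _; rewrite lerD.
Qed.

Lemma decays_shift C f h : decays C f -> `|h| <= 1 ->
  decays (C * expR 1) (fun x => f (x + h)).
Proof.
move=> hf h1 x; apply: le_trans (hf _) _; rewrite -mulrA -expRD.
rewrite ler_wpM2l ?(decays_ge0 hf)// ler_expR.
by have := ler_normB (x + h) h; rewrite addrK; lra.
Qed.

Lemma eq_decays C f g : f =1 g -> decays C f -> decays C g.
Proof. by move=> fg h x; rewrite -fg. Qed.

(** The bound is uniform in N: the sum of exp (-|m| / N) is of order N and the factor 1/N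
    compensates it. *)
Lemma rsumP N f C : (0 < N)%N -> decays C f ->
  zsums (fun m => f (m%:~R / N%:R)) (zsum (fun m => f (m%:~R / N%:R))) /\
  nrm (rsum N f) <= 4 * C.
Proof.
move=> N0 hf; have Np : 0 < N%:R :> R by rewrite ltr0n.
have h01 : 0 < (N%:R^-1 : R) <= 1.
  by rewrite invr_gt0 Np invf_le1// ler1n.
have [|Z B] := zsums_dominated (f := fun m => f (m%:~R / N%:R)) (C := C) h01.
  by move=> m; apply: le_trans (hf _) _; rewrite normrM normfV normr_nat mulrC mulrC [_ * `|_|]mulrC.
split=> //; rewrite /rsum nrmM nrmV nrm_nat mulrC ler_pdivrMr//.
by rewrite invrK in B.
Qed.

Lemma rsumD N f g C D : (0 < N)%N -> decays C f -> decays D g ->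
  rsum N (fun x => f x + g x) = rsum N f + rsum N g.
Proof.
move=> N0 hf hg; rewrite /rsum -mulrDr; congr (_ * _); apply: zsum_unique.
by apply: zsumsD; [case: (rsumP N0 hf)|case: (rsumP N0 hg)].
Qed.

Lemma rsumB N f g C D : (0 < N)%N -> decays C f -> decays D g ->
  rsum N (fun x => f x - g x) = rsum N f - rsum N g.
Proof.
move=> N0 hf hg; rewrite /rsum -mulrBr; congr (_ * _); apply: zsum_unique.
by apply: zsumsB; [case: (rsumP N0 hf)|case: (rsumP N0 hg)].
Qed.

Lemma rsumZ N f C (c : R[i]) : (0 < N)%N -> decays C f ->
  rsum N (fun x => c * f x) = c * rsum N f.
Proof.
move=> N0 hf; rewrite /rsum mulrCA; congr (_ * _); apply: zsum_unique.
by apply: zsumsZ; case: (rsumP N0 hf).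
Qed.

Lemma eq_rsum N f g : f =1 g -> rsum N f = rsum N g.
Proof. by move=> /funext ->. Qed.

(** The grid is invariant under translation by its mesh. This discrete invariance replaces the
    translation invariance of the integral. *)
Lemma rsum_shift N f C : (0 < N)%N -> decays C f ->
  rsum N (fun x => f (x + N%:R^-1)) = rsum N f.
Proof.
move=> N0 hf; congr (_ * _); apply: zsum_unique.
have [/zsums_shift Z _] := rsumP N0 hf.
have E (m : int) : f ((m + 1)%:~R / N%:R) = f (m%:~R / N%:R + N%:R^-1).
  by rewrite intrD mulrDl mul1r.
exact: eq_zsums E Z.
Qed.

End RiemannSums.

(** * Variation of Gaussian Riemann sums with their parameters *)

Section GaussianRiemannSums.
Context {R : realType}.
Variables (P Q M al : R).
Hypotheses (P0 : 0 <= P) (Q0 : 0 <= Q) (M0 : 0 <= M) (al0 : 0 < al).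
Implicit Types (p q mu d : R[i]) (N : nat).

(** One set of constants serves all parameters in the box. The chains of small steps used later stay
    inside a single box, so their errors add up with a fixed constant. *)
Definition inbox p q mu :=
  [/\ nrm p <= P, nrm q <= Q, nrm mu <= M & al <= Re mu].

Let pial0 : 0 < pi * al. Proof. by rewrite mulr_gt0 ?pi_gt0. Qed.
Let pi0 := pi_ge0 R.

Let be k : R := 2 * pi * (P * M + Q) + k%:R.
Let ga k : R := pi * (P ^+ 2 * M + 2 * P * Q) + k%:R * P.

Definition gK (k : nat) : R := expR (ga k + (be k + 1) ^+ 2 / (4 * (pi * al))).

Lemma gK_ge0 k : 0 <= gK k. Proof. exact: expR_ge0. Qed.

Lemma gterm_decays k p q mu : inbox p q mu -> decays (gK k) (gterm k p q mu).
Proof.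
move=> [hp hq hmu hal] x.
apply: le_trans (gterm_le k x hp hq hmu hal) _; exact: gauss_le.
Qed.

Definition tK (k : nat) (a b c : R) := 5 * (2 * a + b + c) ^+ 2 *
     expR (ga k + c + (be k + b + 3) ^+ 2 / (2 * (pi * al))).

Lemma tK_ge0 k a b c : 0 <= tK k a b c.
Proof. by rewrite /tK mulr_ge0 ?expR_ge0// mulr_ge0// sqr_ge0. Qed.

Lemma gterm_taylor k p q mu ka a b c (w : R -> R[i]) : inbox p q mu ->
  0 <= a -> 0 <= b -> 0 <= c -> 0 <= ka <= 1 -> ka * a <= pi * al / 2 ->
  (forall x, nrm (w x) <= ka * (a * x ^+ 2 + b * `|x| + c)) ->
  decays (ka ^+ 2 * tK k a b c)
    (fun x => gterm k p q mu x * (cexp (w x) - 1 - w x)).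
Proof.
move=> [hp hq hmu hal] a0 b0 c0 k01 kaa hw x.
by apply: (@taylor_gauss _ (pi * al) (be k) (ga k) a b c) => //; exact: gterm_le.
Qed.

(** Increment of the exponent when p moves by d. It is affine in x, so its quadratic coefficient in
    [taylor_gauss] is 0 and no bound on the decay rate is consumed. *)
Let sw p q mu d (x : R) : R[i] :=
  - pi%:C * mu * (2 * (x%:C + p) * d + d ^+ 2) + 2 * pi%:C * 'i * d * q.

Let sb : R := 2 * pi * M.
Let sc : R := 2 * pi * M * P + 2 * pi * Q + pi * M.

Let sb0 : 0 <= sb. Proof. by rewrite !mulr_ge0. Qed.
Let sc0 : 0 <= sc. Proof. by rewrite !addr_ge0 ?mulr_ge0. Qed.

Let nrm2 : nrm (2 : R[i]) = 2. Proof. exact: (nrm_nat 2). Qed.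

Let sw_le p q mu d x : inbox p q mu -> nrm d <= 1 ->
  nrm (sw p q mu d x) <= nrm d * (0 * x ^+ 2 + sb * `|x| + sc).
Proof.
move=> [hp hq hmu hal] d1; have n0 := nrm_ge0.
rewrite /sw [X in nrm X <= _](_ : _ = d * (- pi%:C * mu * (2 * (x%:C + p) + d) + 2 * pi%:C * 'i * q));
  last by ring.
rewrite nrmM ler_wpM2l// mul0r add0r.
apply: le_trans (nrmD _ _) _; rewrite !nrmM nrmN nrm_pi nrm2 nrm_i mulr1.
have -> : sb * `|x| + sc = pi * M * (2 * (`|x| + P) + 1) + 2 * pi * Q.
  by rewrite /sb /sc; ring.
rewrite lerD ?ler_wpM2l ?mulr_ge0//.
apply: ler_pM => //; first by rewrite mulr_ge0.
  by rewrite ler_wpM2l.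
apply: le_trans (nrmD _ _) _; rewrite lerD// nrmM nrm2 ler_wpM2l//.
by apply: le_trans (nrmD _ _) _; rewrite nrm_real lerD.
Qed.

Let gterm_sw0 p q mu d x :
  gterm 0 (p + d) q mu x = gterm 0 p q mu x * cexp (sw p q mu d x).
Proof.
rewrite /gterm /sw !expr0 !mul1r -cexpD; congr cexp; ring.
Qed.

Let gterm_sw1 p q mu d x : gterm 1 (p + d) q mu x =
  (gterm 1 p q mu x + d * gterm 0 p q mu x) * cexp (sw p q mu d x).
Proof.
rewrite (_ : gterm 1 p q mu x + _ = (x%:C + p + d) * gterm 0 p q mu x); last first.
  by rewrite /gterm expr0 expr1; ring.
rewrite -mulrA -gterm_sw0 /gterm expr0 expr1; ring.
Qed.

(** Derivative of [gterm 0] in p, which is also its derivative in x. *)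
Let ls p q mu (x : R) : R[i] :=
  - (2 * pi%:C * mu) * gterm 1 p q mu x + 2 * pi%:C * 'i * q * gterm 0 p q mu x.

Let gterm0_sw p q mu d x : gterm 0 p q mu x * sw p q mu d x =
  d * ls p q mu x - pi%:C * mu * d ^+ 2 * gterm 0 p q mu x.
Proof. by rewrite /ls /gterm /sw !expr1 !expr0; ring. Qed.

Let gterm1_sw p q mu d x : gterm 1 p q mu x * sw p q mu d x =
  d * (- (2 * pi%:C * mu) * gterm 2 p q mu x + 2 * pi%:C * 'i * q * gterm 1 p q mu x)
  - pi%:C * mu * d ^+ 2 * gterm 1 p q mu x.
Proof. by rewrite /gterm /sw !expr1; ring. Qed.

Let d01 d : nrm d <= 1 -> 0 <= nrm d <= 1. Proof. by rewrite nrm_ge0. Qed.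

Let K0 := tK 0 0 sb sc. Let K1 := tK 1 0 sb sc.

Let tau0 k p q mu d : inbox p q mu -> nrm d <= 1 ->
  decays (nrm d ^+ 2 * tK k 0 sb sc)
   (fun x => gterm k p q mu x * (cexp (sw p q mu d x) - 1 - sw p q mu d x)).
Proof.
move=> hB d1; apply: gterm_taylor => //; first exact: d01.
  by rewrite mulr0 ltW// divr_gt0.
by move=> x; apply: sw_le.
Qed.

Definition shiftK0 : R := K0 + pi * M * gK 0.

Let nrm_pimud2 p q mu d : inbox p q mu -> nrm (pi%:C * mu * d ^+ 2) <= pi * M * nrm d ^+ 2.
Proof.
move=> [_ _ hmu _]; rewrite !nrmM nrm_pi -expr2.
by rewrite ler_wpM2r ?sqr_ge0// ler_wpM2l.
Qed.

Lemma gterm_shift0 p q mu d : inbox p q mu -> nrm d <= 1 ->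
  decays (shiftK0 * nrm d ^+ 2)
  (fun x => gterm 0 (p + d) q mu x - gterm 0 p q mu x - d *
    (- (2 * pi%:C * mu) * gterm 1 p q mu x + 2 * pi%:C * 'i * q * gterm 0 p q mu x)).
Proof.
move=> hB d1.
have := decaysB (tau0 0 hB d1) (decaysZ (pi%:C * mu * d ^+ 2) (gterm_decays 0 hB)).
move=> /eq_decays H; apply: decays_le; first apply: H => x.
  by rewrite gterm_sw0 -/(ls p q mu x) !mulrBr mulr1 gterm0_sw; ring.
have := ler_wpM2r (gK_ge0 0) (nrm_pimud2 d hB); rewrite /shiftK0 /K0; lra.
Qed.

Definition lK : R := 2 * pi * M * gK 1 + 2 * pi * Q * gK 0.

Let ls_decays p q mu : inbox p q mu -> decays lK (ls p q mu).
Proof.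
move=> hB; have [_ hq hmu _] := hB.
apply: decays_le; first exact: decaysD (decaysZ _ (gterm_decays 1 hB)) (decaysZ _ (gterm_decays 0 hB)).
rewrite nrmN !nrmM nrm_pi nrm2 nrm_i mulr1 lerD// ler_wpM2r ?gK_ge0//.
  by rewrite ler_wpM2l ?mulr_ge0.
by rewrite ler_wpM2l ?mulr_ge0.
Qed.

Definition shiftK1 : R := K1 + K0 + pi * M * gK 1 + lK + pi * M * gK 0.

Lemma gterm_shift1 p q mu d : inbox p q mu -> nrm d <= 1 ->
  decays (shiftK1 * nrm d ^+ 2)
  (fun x => gterm 1 (p + d) q mu x - gterm 1 p q mu x - d *
    (- (2 * pi%:C * mu) * gterm 2 p q mu x + 2 * pi%:C * 'i * q * gterm 1 p q mu x
     + gterm 0 p q mu x)).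
Proof.
move=> hB d1.
(* The five error terms: two Taylor remainders, and three products of second or third order in d.
   [shiftK1] adds up their bounds. *)
pose F x := gterm 1 p q mu x * (cexp (sw p q mu d x) - 1 - sw p q mu d x)
  + d * (gterm 0 p q mu x * (cexp (sw p q mu d x) - 1 - sw p q mu d x))
  - pi%:C * mu * d ^+ 2 * gterm 1 p q mu x + d ^+ 2 * ls p q mu x
  - d * (pi%:C * mu * d ^+ 2) * gterm 0 p q mu x.
have FE : F =1 (fun x => gterm 1 (p + d) q mu x - gterm 1 p q mu x - d *
    (- (2 * pi%:C * mu) * gterm 2 p q mu x + 2 * pi%:C * 'i * q * gterm 1 p q mu x
     + gterm 0 p q mu x)).
  move=> x; rewrite /F gterm_sw1.
  rewrite !mulrBr !mulr1 gterm1_sw gterm0_sw; ring.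
apply: eq_decays FE _.
have := decaysB (decaysD (decaysB (decaysD (tau0 1 hB d1) (decaysZ d (tau0 0 hB d1)))
  (decaysZ (pi%:C * mu * d ^+ 2) (gterm_decays 1 hB))) (decaysZ (d ^+ 2) (ls_decays hB)))
  (decaysZ (d * (pi%:C * mu * d ^+ 2)) (gterm_decays 0 hB)).
move=> H; apply: (decays_le H).
rewrite (nrmM d) (nrmX d 2).
have e1 := nrm_pimud2 d hB; set X := nrm (pi%:C * mu * d ^+ 2) in e1 *.
have X0 : 0 <= X by exact: nrm_ge0.
have e2 := ler_wpM2r (gK_ge0 0) e1; have e3 := ler_wpM2r (gK_ge0 1) e1.
have e4 : nrm d * X * gK 0 <= 1 * X * gK 0.
  by rewrite ler_wpM2r ?gK_ge0// ler_wpM2r.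
have t0 : 0 <= nrm d ^+ 2 * tK 0 0 sb sc by rewrite mulr_ge0 ?sqr_ge0 ?tK_ge0.
have e5 := ler_wpM2r t0 d1.
rewrite /shiftK1 /K1 /K0; lra.
Qed.

Definition muK : R := tK 0 pi (2 * pi * P) (pi * P ^+ 2).

Lemma gterm_addmu p q mu d : inbox p q mu -> nrm d <= 1 -> nrm d <= al / 2 ->
  decays (muK * nrm d ^+ 2)
  (fun x => gterm 0 p q (mu + d) x - gterm 0 p q mu x - d * (- pi%:C * gterm 2 p q mu x)).
Proof.
move=> hB d1 d2; have [hp _ _ _] := hB.
have := @gterm_taylor 0 p q mu (nrm d) pi (2 * pi * P) (pi * P ^+ 2)
  (fun x => - pi%:C * (x%:C + p) ^+ 2 * d) hB (pi_ge0 R).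
have b0 : 0 <= 2 * pi * P by rewrite !mulr_ge0.
have c0 : 0 <= pi * P ^+ 2 by rewrite mulr_ge0 ?sqr_ge0.
move=> /(_ b0 c0 (d01 d1)) H.
rewrite mulrC; apply: eq_decays (H _ _) => [x||x].
- rewrite (_ : gterm 0 p q (mu + d) x = gterm 0 p q mu x *
     cexp (- pi%:C * (x%:C + p) ^+ 2 * d)).
    by rewrite /gterm !expr0 !mul1r; ring.
  by rewrite /gterm !expr0 !mul1r -cexpD; congr cexp; ring.
- by rewrite mulrC -mulrA ler_wpM2l.
rewrite !nrmM nrmN nrm_pi mulrC ler_wpM2l ?nrm_ge0// -expr2.
have : nrm (x%:C + p) ^+ 2 <= (`|x| + P) ^+ 2.
  rewrite lerXn2r ?nnegrE ?addr_ge0 ?nrm_ge0//.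
  by apply: le_trans (nrmD _ _) _; rewrite nrm_real lerD.
rewrite sqrrD real_normK ?num_real//.
by move=> /(ler_wpM2l pi0) => G; apply: (le_trans G); lra.
Qed.

Let invN (N : nat) : (0 < N)%N -> nrm (N%:R^-1 : R[i]) = N%:R^-1.
Proof. by move=> N0; rewrite nrmV nrm_nat. Qed.

Let invN1 (N : nat) : (0 < N)%N -> nrm (N%:R^-1 : R[i]) <= 1.
Proof. by move=> N0; rewrite invN// invf_le1 ?ler1n ?ltr0n. Qed.

Let gterm_addx k p q mu N x :
  gterm k (p + N%:R^-1) q mu x = gterm k p q mu (x + N%:R^-1).
Proof.
have -> : (N%:R^-1 : R[i]) = (N%:R^-1 : R)%:C by rewrite fmorphV rmorph_nat.
rewrite /gterm rmorphD /=; congr (_ ^+ _ * cexp _); ring.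
Qed.

Let rsum_shiftN k p q mu N : (0 < N)%N -> inbox p q mu ->
  rsum N (gterm k (p + N%:R^-1) q mu) = rsum N (gterm k p q mu).
Proof.
move=> N0 hB; rewrite (eq_rsum _ (gterm_addx k p q mu N)).
exact: rsum_shift N0 (gterm_decays k hB).
Qed.

(* Summing over one period of the grid cancels a difference quotient with step 1/N. *)
Let rsum_der k p q mu N (G : R -> R[i]) (C D : R) : (0 < N)%N -> inbox p q mu ->
  decays D G ->
  decays (C * nrm (N%:R^-1 : R[i]) ^+ 2)
   (fun x => gterm k (p + N%:R^-1) q mu x - gterm k p q mu x - N%:R^-1 * G x) ->
  nrm (rsum N G) <= 4 * C / N%:R.
Proof.
move=> N0 hB GD H; have Np : 0 < N%:R :> R by rewrite ltr0n.
have [_] := rsumP N0 H.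
have gs : decays (gK k * expR 1) (gterm k (p + N%:R^-1) q mu).
  apply: eq_decays (decays_shift (gterm_decays k hB) (h := N%:R^-1) _) => [x|].
    by rewrite gterm_addx.
  by rewrite ger0_norm ?invr_ge0// invf_le1 ?ler1n.
rewrite (rsumB N0 (decaysB gs (gterm_decays k hB)) (decaysZ _ GD)).
rewrite (rsumB N0 gs (gterm_decays k hB)) rsum_shiftN// subrr sub0r nrmN.
rewrite (rsumZ _ N0 GD) nrmM invN//.
rewrite ler_pdivlMr// => h.
have iN : N%:R^-1 * N%:R = 1 :> R by rewrite mulVf// gt_eqF.
have {h} := ler_wpM2r (mulr_ge0 (ltW Np) (ltW Np)) h.
set X := nrm _; set i := (N%:R^-1 : R) in iN *; set n := (N%:R : R) in iN *.
have -> : i * X * (n * n) = X * n * (i * n) by ring.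
have -> : 4 * (C * i ^+ 2) * (n * n) = 4 * C * (i * n) ^+ 2 by ring.
by rewrite iN expr1n !mulr1.
Qed.

(** The first order term is d times the Riemann sum of a derivative, and such a sum is O(1/N). Along
    a path cut into L steps the total error is therefore O(1/N + 1/L). *)
Lemma rsum_move p q mu d N : (0 < N)%N -> inbox p q mu -> inbox (p + d) q mu ->
  nrm d <= 1 ->
  nrm (rsum N (gterm 0 (p + d) q mu) - rsum N (gterm 0 p q mu)) <=
  4 * shiftK0 * (nrm d / N%:R + nrm d ^+ 2).
Proof.
move=> N0 hB hB' d1.
have L := rsum_der N0 hB (ls_decays hB) (gterm_shift0 hB (invN1 N0)).
have S := gterm_shift0 hB d1.
have [_] := rsumP N0 S.
have D1 := decaysB (gterm_decays 0 hB') (gterm_decays 0 hB).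
rewrite (rsumB N0 D1 (decaysZ d (ls_decays hB))).
rewrite (rsumB N0 (gterm_decays 0 hB') (gterm_decays 0 hB)).
rewrite (rsumZ d N0 (ls_decays hB)).
set U := rsum N (gterm 0 (p + d) q mu) - _.
set V := rsum N (ls p q mu) in L *; move=> h.
rewrite (_ : U = (U - d * V) + d * V); last by rewrite subrK.
apply: le_trans (nrmD _ _) _; rewrite nrmM.
by have := ler_wpM2l (nrm_ge0 d) L; lra.
Qed.

Let in00 mu : nrm mu <= M -> al <= Re mu -> inbox 0 0 mu.
Proof. by move=> h k; split=> //; rewrite nrm0. Qed.

(** Discrete integration by parts: the derivative of x exp (-pi mu x^2) is (1 - 2 pi mu x^2) exp
    (-pi mu x^2), and its Riemann sum is O(1/N). *)
Let rsum_K mu N : (0 < N)%N -> inbox 0 0 mu ->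
  nrm (rsum N (gterm 0 0 0 mu) - 2 * pi%:C * mu * rsum N (gterm 2 0 0 mu)) <=
  4 * shiftK1 / N%:R.
Proof.
move=> N0 hB.
have D0 := gterm_decays 0 hB; have D1 := gterm_decays 1 hB; have D2 := gterm_decays 2 hB.
have DG := decaysD (decaysD (decaysZ (- (2 * pi%:C * mu)) D2) (decaysZ (2 * pi%:C * 'i * 0) D1)) D0.
have := rsum_der N0 hB DG (gterm_shift1 hB (invN1 N0)).
rewrite (rsumD N0 (decaysD (decaysZ _ D2) (decaysZ _ D1)) D0).
rewrite (rsumD N0 (decaysZ _ D2) (decaysZ _ D1)) (rsumZ _ N0 D2) (rsumZ _ N0 D1).
by rewrite mulr0 mul0r addr0 addrC mulNr.
Qed.

Let yK : R := 4 * pi * gK 2 + 4 * muK.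

Definition sqK : R := 16 * gK 0 * shiftK1 + 32 * M * gK 0 * muK + M * yK ^+ 2 +
  8 * gK 0 * yK + yK ^+ 2.

(** With X the Gaussian sum and Z its second moment, the derivative of mu X^2 in mu is X (X - 2 pi
    mu Z), which [rsum_K] makes O(1/N). This is the step that makes mu X^2 asymptotically
    constant. *)
Lemma rsum_sqr_move mu d N : (0 < N)%N -> inbox 0 0 mu -> inbox 0 0 (mu + d) ->
  nrm d <= 1 -> nrm d <= al / 2 ->
  nrm ((mu + d) * rsum N (gterm 0 0 0 (mu + d)) ^+ 2 -
       mu * rsum N (gterm 0 0 0 mu) ^+ 2) <= sqK * (nrm d / N%:R + nrm d ^+ 2).
Proof.
move=> N0 hB hB' d1 d2; have [_ _ hmu _] := hB.
have hK := rsum_K N0 hB.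
have D0 := gterm_decays 0 hB; have D2 := gterm_decays 2 hB.
have D0' := gterm_decays 0 hB'.
have [_ hX] := rsumP N0 D0; have [_ hZ] := rsumP N0 D2.
have [_] := rsumP N0 (gterm_addmu hB d1 d2).
rewrite (rsumB N0 (decaysB D0' D0) (decaysZ d (decaysZ (- pi%:C) D2))).
rewrite (rsumB N0 D0' D0) (rsumZ d N0 (decaysZ _ D2)) (rsumZ _ N0 D2).
set X := rsum N (gterm 0 0 0 mu) in hX hK *; set Z := rsum N (gterm 2 0 0 mu) in hZ hK *.
set X' := rsum N _; clearbody X Z X'; set E := _ - _ => hE.
pose Y := d * (- pi%:C * Z) + E.
have YE : X' = X + Y by rewrite /Y /E; ring.
clearbody E.
have m0 : 0 <= muK by exact: tK_ge0.
have g0 := gK_ge0 0; have g2 := gK_ge0 2.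
have yK0 : 0 <= yK.
  by apply: addr_ge0; apply: mulr_ge0 => //; exact: mulr_ge0.
have dn := nrm_ge0 d.
have dd : nrm d ^+ 2 <= nrm d by rewrite expr2 ler_piMl.
have hY : nrm Y <= yK * nrm d.
  apply: le_trans (nrmD _ _) _; rewrite !nrmM nrmN nrm_pi.
  have h1 : nrm d * (pi * nrm Z) <= nrm d * (pi * (4 * gK 2)) by rewrite !ler_wpM2l.
  have h2 : 4 * muK * nrm d ^+ 2 <= 4 * muK * nrm d.
    by apply: ler_wpM2l => //; exact: mulr_ge0.
  by rewrite /yK; lra.
have hY2 : nrm Y ^+ 2 <= yK ^+ 2 * nrm d ^+ 2.
  by rewrite -exprMn lerXn2r ?nnegrE ?nrm_ge0 ?mulr_ge0.
(* The first summand is the first order term treated by [rsum_K]; the three others are of second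
   order in d. *)
have -> : (mu + d) * X' ^+ 2 - mu * X ^+ 2 =
  d * (X * (X - 2 * pi%:C * mu * Z)) + 2 * (mu * (X * E)) + mu * Y ^+ 2 +
  d * (2 * (X * Y) + Y ^+ 2) by rewrite YE /Y; ring.
have n2 : nrm (2 : R[i]) = 2 := nrm2.
have b1 : nrm (d * (X * (X - 2 * pi%:C * mu * Z))) <=
    16 * gK 0 * shiftK1 * (nrm d / N%:R).
  rewrite !nrmM (_ : _ * (nrm d / N%:R) = nrm d * (4 * gK 0 * (4 * shiftK1 / N%:R))); last by ring.
  by rewrite ler_wpM2l// ler_pM ?nrm_ge0.
have b2 : nrm (2 * (mu * (X * E))) <= 32 * M * gK 0 * muK * nrm d ^+ 2.
  rewrite !nrmM n2 (_ : _ * nrm d ^+ 2 = 2 * (M * (4 * gK 0 * (4 * (muK * nrm d ^+ 2)))));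
    last by ring.
  by rewrite ler_wpM2l// ler_pM ?mulr_ge0 ?nrm_ge0// ler_pM ?nrm_ge0.
have b3 : nrm (mu * Y ^+ 2) <= M * yK ^+ 2 * nrm d ^+ 2.
  by rewrite nrmM nrmX -mulrA ler_pM ?exprn_ge0 ?nrm_ge0.
have b4 : nrm (d * (2 * (X * Y) + Y ^+ 2)) <= (8 * gK 0 * yK + yK ^+ 2) * nrm d ^+ 2.
  rewrite nrmM.
  have c1 : nrm (2 * (X * Y) + Y ^+ 2) <= 8 * gK 0 * yK * nrm d + yK ^+ 2 * nrm d.
    apply: le_trans (nrmD _ _) _; rewrite lerD//.
      rewrite !nrmM n2 (_ : _ * nrm d = 2 * (4 * gK 0 * (yK * nrm d))); last by ring.
      by rewrite ler_wpM2l// ler_pM ?nrm_ge0.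
    rewrite nrmX; apply: (le_trans hY2); rewrite ler_wpM2l ?sqr_ge0//.
  by have := ler_wpM2l dn c1; lra.
have t1 := nrmD (d * (X * (X - 2 * pi%:C * mu * Z)) + 2 * (mu * (X * E)) + mu * Y ^+ 2)
  (d * (2 * (X * Y) + Y ^+ 2)).
have t2 := nrmD (d * (X * (X - 2 * pi%:C * mu * Z)) + 2 * (mu * (X * E))) (mu * Y ^+ 2).
have t3 := nrmD (d * (X * (X - 2 * pi%:C * mu * Z))) (2 * (mu * (X * E))).
have s1 : 0 <= shiftK1.
  have := tK_ge0 0 0 sb sc; have := tK_ge0 1 0 sb sc; have g1 := gK_ge0 1.
  have := mulr_ge0 pi0 M0 => pM.
  have := mulr_ge0 pM g1; have := mulr_ge0 pM g0; have := mulr_ge0 (mulr_ge0 pi0 Q0) g0.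
  by rewrite /shiftK1 /lK /K1 /K0; lra.
have dN : 0 <= nrm d / N%:R by rewrite divr_ge0.
have p1 : 0 <= 32 * M * gK 0 * muK * (nrm d / N%:R) by do 4 apply: mulr_ge0 => //.
have p2 : 0 <= M * yK ^+ 2 * (nrm d / N%:R).
  by apply: mulr_ge0 => //; apply: mulr_ge0 => //; exact: sqr_ge0.
have p3 : 0 <= 8 * gK 0 * yK * (nrm d / N%:R) by do 3 apply: mulr_ge0 => //.
have p4 : 0 <= yK ^+ 2 * (nrm d / N%:R).
  by apply: mulr_ge0 => //; exact: sqr_ge0.
have p5 : 0 <= 16 * gK 0 * shiftK1 * nrm d ^+ 2.
  by apply: mulr_ge0; [do 2 apply: mulr_ge0 => //|exact: sqr_ge0].
rewrite /sqK; lra.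
Qed.

End GaussianRiemannSums.

(** * Convergence of complex sequences *)

Section Convergence.
Context {R : realType}.
Implicit Types (u v : nat -> R[i]) (a b c : R[i]).

Definition cv u a := forall e : R, 0 < e -> exists K, forall k, (K <= k)%N -> nrm (u k - a) <= e.

Lemma cv_scale u a (C : R) : 0 <= C ->
  (forall e : R, 0 < e -> exists K, forall k, (K <= k)%N -> nrm (u k - a) <= C * e) -> cv u a.
Proof.
move=> C0 h e e0; have C1 : 0 < C + 1 by lra.
have [K hK] := h _ (divr_gt0 e0 C1); exists K => k /hK /le_trans; apply.
by rewrite mulrA ler_pdivrMr// mulrC ler_wpM2l ?(ltW e0)//; lra.
Qed.

Lemma cv_unique u a b : cv u a -> cv u b -> a = b.
Proof.
move=> ha hb; apply/eqP; rewrite -subr_eq0 -nrm_eq0 eq_le nrm_ge0 andbT.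
apply: (@le_eps_eq0 _ _ 2) => // e e0.
have [K hK] := ha e e0; have [L hL] := hb e e0.
have := hK (maxn K L) (leq_maxl _ _); have := hL (maxn K L) (leq_maxr _ _).
set P := u _ => h1 h2.
have -> : a - b = (P - b) - (P - a) by ring.
apply: le_trans (nrmB _ _) _; lra.
Qed.

Lemma eq_cv u v a : u =1 v -> cv u a -> cv v a.
Proof. by move=> uv h e /h[K hK]; exists K => k; rewrite -uv; exact: hK. Qed.

Lemma cv_cst a : cv (fun=> a) a.
Proof. by move=> e e0; exists 0%N => k _; rewrite subrr nrm0 ltW. Qed.

Lemma cvM u v a b : cv u a -> cv v b -> cv (fun k => u k * v k) (a * b).
Proof.
move=> ha hb; apply: (@cv_scale _ _ (1 + nrm a + nrm b)) => [|e0 e00].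
  by rewrite !addr_ge0 ?nrm_ge0.
pose e := Num.min e0 1.
have e_gt0 : 0 < e by rewrite lt_min e00 ltr01.
have [K hK] := ha e e_gt0; have [L hL] := hb e e_gt0.
exists (maxn K L) => k; rewrite geq_max => /andP[/hK h1 /hL h2].
have -> : u k * v k - a * b = (u k - a) * (v k - b) + a * (v k - b) + (u k - a) * b by ring.
have e1 : e <= 1 by rewrite ge_min lexx orbT.
have e2 : e <= e0 by rewrite ge_min lexx.
have b1 : nrm ((u k - a) * (v k - b)) <= e.
  rewrite nrmM -[e]mulr1; apply: ler_pM; rewrite ?nrm_ge0//; exact: le_trans h2 e1.
have b2 : nrm (a * (v k - b)) <= nrm a * e by rewrite nrmM ler_wpM2l ?nrm_ge0.
have b3 : nrm ((u k - a) * b) <= nrm b * e by rewrite nrmM mulrC ler_wpM2l ?nrm_ge0.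
have := nrmD ((u k - a) * (v k - b) + a * (v k - b)) ((u k - a) * b).
have := nrmD ((u k - a) * (v k - b)) (a * (v k - b)).
have : (1 + nrm a + nrm b) * e <= (1 + nrm a + nrm b) * e0.
  by rewrite ler_wpM2l// !addr_ge0 ?nrm_ge0.
lra.
Qed.

(** The denominators are the odd grid sizes 2 k + 1, for which the frequencies -k, ..., k form a
    complete set of residues. *)
Lemma cv_le_inv u a (C : R) :
  (forall k, nrm (u k - a) <= C / (k.*2.+1)%:R) -> cv u a.
Proof.
move=> h; have C0 : 0 <= C.
  by have := le_trans (nrm_ge0 _) (h 0%N); rewrite divr1.
apply: (@cv_scale _ _ C) => // e e0.
exists (Num.bound e^-1) => k Kk; apply: le_trans (h k) _.
rewrite ler_wpM2l// -[e]invrK lef_pV2 ?posrE ?invr_gt0// ?ltr0n//.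
have := archi_boundP (ltW (_ : 0 < e^-1)); rewrite invr_gt0 e0 => /(_ isT)/ltW/le_trans; apply.
by rewrite ler_nat (leq_trans Kk)// -addnn leqW// leq_addr.
Qed.

Lemma chain_bound (f : R[i] -> R[i]) (a d : R[i]) (L : nat) (e : R) :
  (forall j, (j < L)%N -> nrm (f (a + j.+1%:R * d) - f (a + j%:R * d)) <= e) ->
  nrm (f (a + L%:R * d) - f a) <= L%:R * e.
Proof.
elim: L => [|L IH] h; first by rewrite !mul0r addr0 subrr nrm0.
have := IH (fun j jL => h j (leqW jL)); have := h L (ltnSn L).
have := nrmD (f (a + L.+1%:R * d) - f (a + L%:R * d)) (f (a + L%:R * d) - f a).
rewrite addrA subrK [X in _ -> _ -> _ -> _ <= X * e](_ : _ = L%:R + 1); last by rewrite -natr1.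
lra.
Qed.

End Convergence.

(** * Asymptotic independence of the parameters *)

Section GaussianLimits.
Context {R : realType}.
Implicit Types (p q mu nu d : R[i]) (N : nat).

(** For L steps of length x / L the accumulated error is of order 1/N + 1/L. The second condition
    turns this into O(1/N), the first keeps each step short enough for the Taylor estimates. *)
Let fine_grid (x : R) N : (0 < N)%N -> exists2 L, (0 < L)%N &
  x / L%:R <= N%:R^-1 /\ (N%:R : R) <= L%:R.
Proof.
move=> N0; pose B := (Num.bound `|x|).+1; exists (N * B)%N; first by rewrite muln_gt0 N0.
have Np : 0 < N%:R :> R by rewrite ltr0n.
have Bp : 0 < B%:R :> R by rewrite ltr0n.
have xB : x <= B%:R.
  have := archi_boundP (normr_ge0 x) => /ltW h.
  apply: le_trans (ler_norm x) (le_trans h _); by rewrite ler_nat.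
rewrite natrM invfM mulrCA; split.
  by rewrite ler_piMr ?invr_ge0 ?(ltW Np)// ler_pdivrMr// mul1r.
by rewrite ler_peMr ?(ltW Np)// ler1n.
Qed.

(** The translation p is complex, so this stands for a shift of the contour of a Gaussian integral.
    It is carried out in small steps from 0 to p. *)
Lemma rsum_indep p nu : 0 < Re nu -> exists C, forall N, (0 < N)%N ->
  nrm (rsum N (gterm 0 p 0 nu) - rsum N (gterm 0 0 0 nu)) <= C / N%:R.
Proof.
move=> nu0; have P0 := nrm_ge0 p; have M0 := nrm_ge0 nu.
set K := shiftK0 (nrm p) 0 (nrm nu) (Re nu).
exists (4 * K * (nrm p + nrm p ^+ 2)) => N N0.
have [L L0 [h1 h2]] := fine_grid (nrm p) N0.
have Np : 0 < N%:R :> R by rewrite ltr0n.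
have Lp : 0 < L%:R :> R by rewrite ltr0n.
have iN1 : N%:R^-1 <= 1 :> R by rewrite invf_le1// ler1n.
pose d := p / L%:R.
have nd : nrm d = nrm p / L%:R by rewrite /d nrmM nrmV nrm_nat.
have K0 : 0 <= K.
  rewrite /K /shiftK0; apply: addr_ge0; first exact: tK_ge0.
  by apply: mulr_ge0 (gK_ge0 _ _ _ _ _); rewrite mulr_ge0 ?pi_ge0.
have box j : (j <= L)%N -> inbox (nrm p) 0 (nrm nu) (Re nu) (0 + j%:R * d) 0 nu.
  move=> jL; split; rewrite ?nrm0// add0r nrmM nrm_nat nd mulrA mulrAC.
  by rewrite ler_piMl// ler_pdivrMr// mul1r ler_nat.
have := @chain_bound _ (fun w => rsum N (gterm 0 w 0 nu)) 0 d L
   (4 * K * (nrm d / N%:R + nrm d ^+ 2)).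
rewrite {2}/d mulrCA divff ?mulr1 ?add0r; last by rewrite pnatr_eq0 -lt0n.
move=> H; apply: le_trans (H _) _ => [j jL|].
  rewrite -(natr1 j) mulrDl mul1r addrA.
  apply: rsum_move => //.
  - exact: (box j (ltnW jL)).
  - by have := box j.+1 jL; rewrite -(natr1 j) mulrDl mul1r addrA.
  - by rewrite nd; apply: le_trans h1 iN1.
rewrite [X in X <= _](_ : _ = 4 * K * (L%:R * nrm d * (N%:R^-1 + nrm d))); last by ring.
rewrite -!(mulrA (4 * K)) ler_wpM2l ?mulr_ge0//.
have -> : L%:R * nrm d = nrm p by rewrite nd mulrCA divff ?mulr1 ?gt_eqF.
rewrite mulrDr mulrDl lerD// expr2 -mulrA ler_wpM2l// nd ler_wpM2l//.
by rewrite lef_pV2.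
Qed.

Lemma rsum_sqr mu : 0 < Re mu -> exists C, forall N, (0 < N)%N ->
  nrm (mu * rsum N (gterm 0 0 0 mu) ^+ 2 - 1 * rsum N (gterm 0 0 0 1) ^+ 2) <= C / N%:R.
Proof.
(* M bounds the modulus and [al] the real part from below, along the whole segment from 1 to mu. *)
move=> mu0; pose M := nrm mu + 1; pose al := Num.min 1 (Re mu).
have M0 : 0 <= M by rewrite addr_ge0 ?nrm_ge0.
have al0 : 0 < al by rewrite lt_min ltr01.
set K := sqK 0 0 M al; pose D := mu - 1.
exists (`|K| * (nrm D + nrm D ^+ 2)) => N N0.
(* The factor 1 + 2 / al makes each step at most 1 and at most al / 2 at once. *)
have [L L0 [h1 h2]] := fine_grid (nrm D * (1 + 2 / al)) N0.
have Np : 0 < N%:R :> R by rewrite ltr0n.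
have Lp : 0 < L%:R :> R by rewrite ltr0n.
have iN1 : N%:R^-1 <= 1 :> R by rewrite invf_le1// ler1n.
pose d := D / L%:R.
have nd : nrm d = nrm D / L%:R by rewrite /d nrmM nrmV nrm_nat.
have nd1 : nrm d * (1 + 2 / al) <= 1.
  by rewrite nd mulrAC; exact: le_trans h1 iN1.
have dn := nrm_ge0 d.
have al2 : 0 <= 2 / al by rewrite divr_ge0 ?ltW.
have d1 : nrm d <= 1 by have := mulr_ge0 dn al2; lra.
have d2 : nrm d <= al / 2.
  rewrite -[al / 2]mul1r -ler_pdivrMr ?divr_gt0// invf_div.
  by have := mulr_ge0 dn al2; lra.
have box j : (j <= L)%N -> inbox 0 0 M al 0 0 (1 + j%:R * d).
  move=> jL; pose s : R := j%:R / L%:R.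
  have s0 : 0 <= s by rewrite divr_ge0.
  have s1 : s <= 1 by rewrite ler_pdivrMr// mul1r ler_nat.
  have E : 1 + j%:R * d = (1 - s)%:C + s%:C * mu.
    have sC : s%:C = j%:R / L%:R by rewrite /s rmorphM fmorphV !rmorph_nat.
    by rewrite rmorphB rmorph1 /= sC /d /D; ring.

  rewrite E; split; rewrite ?nrm0//.
    apply: le_trans (nrmD _ _) _; rewrite nrmM !nrm_real !ger0_norm ?subr_ge0//.
    have : s * nrm mu <= 1 * nrm mu by rewrite ler_wpM2r ?nrm_ge0.
    by rewrite /M; lra.
  rewrite ReD ReM /= mul0r subr0.
  have : s * al <= s * Re mu by rewrite ler_wpM2l// /al ge_min lexx orbT.
  have : (1 - s) * al <= (1 - s) * 1 by rewrite ler_wpM2l ?subr_ge0// /al ge_min lexx.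
  lra.
have := @chain_bound _ (fun w => w * rsum N (gterm 0 0 0 w) ^+ 2) 1 d L
   (`|K| * (nrm d / N%:R + nrm d ^+ 2)).
have -> : 1 + L%:R * d = mu by rewrite /d /D; field; rewrite pnatr_eq0 -lt0n.
move=> H; apply: le_trans (H _) _ => [j jL|].
  have E : 1 + j.+1%:R * d = 1 + j%:R * d + d by rewrite -(natr1 j); ring.
  rewrite E; apply: le_trans (rsum_sqr_move _ _ _ _ N0 (box j (ltnW jL)) _ d1 d2) _ => //.
    by have := box j.+1 jL; rewrite E.
  by rewrite ler_wpM2r ?ler_norm// addr_ge0 ?divr_ge0 ?sqr_ge0.
rewrite [X in X <= _](_ : _ = `|K| * (L%:R * nrm d * (N%:R^-1 + nrm d))); last by ring.
rewrite -!(mulrA `|K|) ler_wpM2l//.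
have -> : L%:R * nrm d = nrm D by rewrite nd mulrCA divff ?mulr1 ?gt_eqF.
rewrite mulrDr mulrDl lerD// expr2 -mulrA ler_wpM2l ?nrm_ge0// nd ler_wpM2l ?nrm_ge0//.
by rewrite lef_pV2.
Qed.

Lemma rsum_bounded nu : 0 < Re nu -> exists2 C, 0 <= C & forall N, (0 < N)%N ->
  nrm (rsum N (gterm 0 0 0 nu)) <= C.
Proof.
move=> nu0; exists (4 * gK 0 0 (nrm nu) (Re nu) 0).
  by rewrite mulr_ge0// gK_ge0.
move=> N N0; have hB : inbox 0 0 (nrm nu) (Re nu) 0 0 nu by split; rewrite ?nrm0.
by have [] := rsumP N0 (gterm_decays nu0 0 hB).
Qed.

End GaussianLimits.

(** * Roots of unity and finite Fourier inversion *)

Section RootsOfUnity.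
Context {R : realType}.

Lemma cexp_2pii_neq1 (x : R) : 0 < x < 1 -> cexp (2 * pi%:C * 'i * x%:C) != 1.
Proof.
move=> /andP[x0 x1]; apply/eqP => h.
have px : 0 < sin (pi * x).
  by apply: sin_gt0_pi; rewrite mulr_gt0 ?pi_gt0//= gtr_pMr// pi_gt0.
have : cos (pi * x *+ 2) = 1.
  have := congr1 (@complex.Re R) h.
  rewrite (_ : 2 * pi%:C * 'i * x%:C = pi%:C * 'i * (x *+ 2)%:C) ?cexp_piM /=.
    by rewrite mulrnAr.
  by rewrite raddfMn /=; ring.
by rewrite cos_mulr2n cos2sin2; nra.
Qed.

(** With a = y / 2, sin y = 2 sin a cos a >= 2 a cos^2 a >= a, because a cos a <= sin a and cos y >=
    0 gives 2 cos^2 a >= 1. *)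
Lemma sin_ge_half (y : R) : 0 <= y <= pi / 2 -> y / 2 <= sin y.
Proof.
move=> /andP[y0 y1].
have cosp (c : R) : 0 <= c -> c <= pi / 2 -> 0 <= cos c.
  by move=> c0 c1; apply: cos_ge0_pihalf; rewrite c1 andbT; have := pi_ge0 R; lra.
pose f t : R := sin t - t * cos t.
have fd (t : R) : is_derive t 1 f (t * sin t).
  have H : is_derive t 1 f (cos t - (t * - sin t + cos t * 1)).
    exact: is_deriveB.
  by apply: is_derive_eq H _; ring.
have fc : continuous f.
  move=> t; apply: differentiable_continuous; apply/derivable1_diffP.
  by have [] := fd t.
have key (a : R) : 0 <= a -> a <= pi / 2 -> a * cos a <= sin a.
  move=> a0 a1.
  have [c cb] := MVT_segment a0 (fun x _ => fd x) (continuous_subspaceT fc).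
  rewrite /f sin0 mul0r !subr0 => h.
  have : 0 <= c * sin c * a.
    move: cb; rewrite in_itv /= => /andP[c0 ca].
    rewrite !mulr_ge0// sin_ge0_pi// c0 /=; have := pi_ge0 R; lra.
  by rewrite -h subr_ge0.
pose a := y / 2.
have a0 : 0 <= a by rewrite divr_ge0.
have ya : y = a *+ 2 by rewrite /a -mulr_natr; field.
have pa : a <= pi / 2 by have := pi_ge0 R; rewrite /a; lra.
have h1 := key a a0 pa.
have ca := cosp _ a0 pa.
have c2 : 1 <= 2 * cos a ^+ 2.
  by have := cosp _ y0 y1; rewrite {1}ya cos_mulr2n -mulr_natr; lra.
have -> : sin y = 2 * (cos a * sin a) by rewrite {1}ya sin_mulr2n -mulr_natl.
rewrite -/a.
have : cos a * (a * cos a) <= cos a * sin a by rewrite ler_wpM2l.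
have : a * 1 <= a * (2 * cos a ^+ 2) by rewrite ler_wpM2l.
lra.
Qed.

(** The modulus equals 4 sin^2 (pi x). It is the Fourier multiplier of a second difference, and this
    lower bound allows dividing by it. *)
Lemma nrm_second_difference (x : R) : `|x| <= 1 / 2 ->
  x ^+ 2 <= nrm (cexp (2 * pi%:C * 'i * x%:C) + cexp (- (2 * pi%:C * 'i * x%:C)) - 2).
Proof.
move=> hx.
have E y : 2 * pi%:C * 'i * y%:C = pi%:C * 'i * (y *+ 2)%:C :> R[i].
  by rewrite raddfMn /=; ring.
have E' : - (2 * pi%:C * 'i * x%:C) = pi%:C * 'i * (- x *+ 2)%:C :> R[i].
  by apply: complexP; rewrite ?(ReN, ImN) !(ReM, ImM) /= ?mulr2n; ring.
rewrite E' E !cexp_piM mulNrn mulrN cosN sinN.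
rewrite (_ : _ - 2 = ((cos (pi * (x *+ 2)) - 1) *+ 2)%:C); last first.
  by apply: complexP; rewrite /= ?mulr2n; ring.
rewrite nrm_real mulrnAr cos_mulr2n cos2sin2.
have -> : ((1 - sin (pi * x) ^+ 2) *+ 2 - 1 - 1) *+ 2 = - (4 * sin (pi * x) ^+ 2).
  by rewrite !mulr2n; ring.
rewrite normrN ger0_norm; last by rewrite mulr_ge0// sqr_ge0.
have -> : sin (pi * x) ^+ 2 = sin (pi * `|x|) ^+ 2.
  by case: (ler0P x) => _ //; rewrite mulrN sinN sqrrN.
have p2 := @pi_ge2 R; have x0 := normr_ge0 x.
have : pi * `|x| / 2 <= sin (pi * `|x|).
  by apply: sin_ge_half; rewrite mulr_ge0 ?pi_ge0//=; nra.
rewrite -(real_normK (num_real x)); set s := sin _; set y := `|x| in x0 *.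
have : y <= pi * y / 2 by nra.
nra.
Qed.

(** Orthogonality of characters, with the frequencies centred at 0. Outside the multiples of N it is
    a geometric sum of a nontrivial root of unity. *)
Lemma root_sum K (m : int) : let N := K.*2.+1 in
  \sum_(k < N) cexp (- (2 * pi%:C * 'i * (k%:Z - K%:Z)%:~R * (m%:~R / N%:R))) =
  (if (N %| m)%Z then N%:R else 0) :> R[i].
Proof.
move=> N; have Np : (N%:R : R[i]) != 0 by rewrite pnatr_eq0.
pose z : R[i] := cexp (- (2 * pi%:C * 'i * (m%:~R / N%:R))).
pose c : R[i] := cexp (2 * pi%:C * 'i * K%:R * (m%:~R / N%:R)).
have E (k : nat) : cexp (- (2 * pi%:C * 'i * (k%:Z - K%:Z)%:~R * (m%:~R / N%:R))) = c * z ^+ k.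
  rewrite -cexpMn -cexpD; congr cexp; rewrite intrB -!pmulrn mulNrn -mulrnAr -[_ / _ *+ _]mulr_natr; ring.
under eq_bigr do rewrite E.
rewrite -mulr_sumr.
have zN : z ^+ N = 1.
  rewrite -cexpMn mulNrn -mulrnAr -[X in _ * X]mulr_natr divfK//.
  by rewrite cexpN cexp_2pii_int invr1.
case: ifP => [/dvdzP[l hl]|ndv].
  have mN : m%:~R / N%:R = l%:~R :> R[i] by rewrite hl intrM -pmulrn mulfK.
  have z1 : z = 1 by rewrite /z mN cexpN cexp_2pii_int invr1.
  have -> : c = 1.
    by rewrite /c mN -mulrA (_ : K%:R * _ = (K%:Z * l)%:~R) ?cexp_2pii_int// intrM.
  under eq_bigr do rewrite z1 expr1n.
  by rewrite sumr_const card_ord mul1r.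
(* Only the remainder r of m modulo N counts, and 0 < r < N puts r / N strictly between 0 and 1. *)
have z1 : z != 1.
  have Nz : (N%:Z != 0)%R by [].
  have hm := divz_eq m N%:Z.
  have r0 := modz_ge0 m Nz; have rN := ltz_mod m Nz.
  move: hm r0 rN; case: (modz m N%:Z) (negbT ndv) => // r _ hm _.
  rewrite ltz_nat => rN.
  have r0 : (0 < r)%N.
    rewrite lt0n; apply/eqP => r0; move/negbT/negP: ndv; apply; apply/dvdzP.
    by exists (divz m N%:Z); rewrite [LHS]hm r0 addr0.
  have mN : m%:~R / N%:R = (divz m N%:Z)%:~R + (r%:R / N%:R : R)%:C :> R[i].
    rewrite {1}hm intrD intrM -!pmulrn mulrDl mulfK//; congr (_ + _).
    by rewrite rmorphM fmorphV !rmorph_nat.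
  rewrite /z mN mulrDr opprD cexpD cexpN cexp_2pii_int invr1 mul1r cexpN.
  rewrite invr_eq1 cexp_2pii_neq1// divr_gt0 ?ltr0n//=.
  by rewrite ltr_pdivrMr ?ltr0n// mul1r ltr_nat.
apply/eqP; rewrite mulf_eq0; apply/orP; right.
have /eqP := subrX1 z N; rewrite zN subrr eq_sym mulf_eq0 subr_eq0 (negbTE z1) //.
Qed.

End RootsOfUnity.

(** * Poisson summation on finite grids and its limit *)

Section PoissonSummation.
Context {R : realType}.
Implicit Types (n m : int).

Section FixedParameters.
Variables (p q nu : R[i]).
Hypothesis nu0 : 0 < Re nu.

Let cchar n (x : R) : R[i] := cexp (- (2 * pi%:C * 'i * n%:~R * x%:C)).
(** Grid approximation of the n-th Fourier coefficient of the Gaussian. *)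
Let A N n : R[i] := rsum N (fun x => cchar n x * gterm 0 p q nu x).

Let nrm_cchar n x : nrm (cchar n x) = 1.
Proof.
have -> : cchar n x = cexp ('i * (- (2 * pi * n%:~R * x))%:C).
  by congr cexp; rewrite rmorphN !rmorphM rmorph_int rmorph_nat /=; ring.
by rewrite cexp_i /= cos2Dsin2 sqrtr1.
Qed.

Let box : inbox (nrm p) (nrm q) (nrm nu) (Re nu) p q nu.
Proof. by split. Qed.

Let pg := nrm_ge0 p. Let qg := nrm_ge0 q. Let ng := nrm_ge0 nu.

Let gdec := gterm_decays nu0 0 box.

Let cdec n C (f : R -> R[i]) : decays C f -> decays C (fun x => cchar n x * f x).
Proof. by move=> h x; rewrite nrmM nrm_cchar mul1r. Qed.

(** Exact for every K: summing the characters over -K <= n <= K annihilates the grid points that are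
    not integers and leaves the theta series. *)
Lemma dft K : psum (A K.*2.+1) K K.+1 = tsum 0 p q nu.
Proof.
set N := K.*2.+1; have N0 : (0 < N)%N by [].
have Np : (N%:R : R[i]) != 0 by rewrite pnatr_eq0.
pose F m : R[i] := \sum_(k < N) cchar (k%:Z - K%:Z) (m%:~R / N%:R) *
    gterm 0 p q nu (m%:~R / N%:R).
have Fs : zsums F (N%:R * psum (A N) K K.+1).
  rewrite /psum addnS addnn mulr_sumr.
  apply: zsums_sum => k; rewrite /A /rsum mulVKf//.
  by have [] := rsumP N0 (cdec (k%:Z - K%:Z) gdec).
have FE m : F m = (if (N %| m)%Z then N%:R else 0) * gterm 0 p q nu (m%:~R / N%:R).
  rewrite -root_sum mulr_suml; apply: eq_bigr => k _; congr (cexp (- (_ * _)) * _).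
  by rewrite rmorphM fmorphV rmorph_int rmorph_nat.
have := zsums_dissect N0 Fs.
have E k : \sum_(j < N) F (N%:Z * k + j%:Z) = N%:R * tterm 0 p q nu k.
  rewrite big_ord_recl [X in _ + X]big1 => [|j _]; last first.
    rewrite FE; case: ifP => [/dvdz_mod0P|_]; last by rewrite mul0r.
    rewrite [_ * k]mulrC modzMDl modz_small //=.
    by rewrite ltz_nat (ltn_ord (lift ord0 j)).
  rewrite /= !addr0 FE dvdz_mulr ?dvdzz//= ttermE; congr (_ * gterm _ _ _ _ _).
  by rewrite intrM -pmulrn mulrAC divff ?mul1r// pnatr_eq0.
move=> /(eq_zsums E) H.
have := zsums_unique H (zsumsZ N%:R (tsumP 0 p q nu0)).
exact: mulfI.
Qed.

Definition poisson_coef n : R[i] := cexp (2 * pi%:C * 'i * p * q) * theta_term (- q) p nu^-1 n.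

(** Completing the square turns the character into a complex translation of the centred Gaussian,
    the dual theta term being the factor left over. *)
Let A_gauss N n : (0 < N)%N ->
  A N n = poisson_coef n * rsum N (gterm 0 (p - 'i * nu^-1 * (q - n%:~R)) 0 nu).
Proof.
move=> N0; have nun : nu != 0 by apply: contraTneq nu0 => ->; rewrite ltxx.
set w := p - _.
have box' : inbox (nrm w) 0 (nrm nu) (Re nu) w 0 nu by split; rewrite ?nrm0.
rewrite /A -(rsumZ _ N0 (gterm_decays nu0 0 box')); apply: eq_rsum => x.
rewrite /cchar /poisson_coef /theta_term /gterm !expr0 !mul1r -!cexpD; congr cexp.
rewrite /w; field: (@mulii R).
exact: nun.
Qed.

(** Two summations by parts. The second difference of the Gaussian has a Riemann sum O(1/N^2), while
    its multiplier is at least (n/N)^2 when 2 |n| <= N. The resulting decay in n is uniform in N, as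
    needed to exchange limit and sum. *)
Let A_bound : exists2 B, 0 <= B & forall N n, (0 < N)%N -> (`|n|%N.*2 <= N)%N ->
  nrm (A N n) * (`|n|%N%:R ^+ 2) <= B.
Proof.
have D0 := gdec.
set S := shiftK0 (nrm p) (nrm q) (nrm nu) (Re nu).
exists (8 * S) => [|N n N0 nN].
  rewrite mulr_ge0// /S /shiftK0 addr_ge0 ?tK_ge0//.
  by apply: mulr_ge0; [rewrite mulr_ge0 ?pi_ge0|exact: gK_ge0].
have Np : 0 < N%:R :> R by rewrite ltr0n.
have NC : (N%:R^-1 : R[i]) = (N%:R^-1 : R)%:C by rewrite fmorphV rmorph_nat.
have i1 : nrm (N%:R^-1 : R[i]) <= 1 by rewrite nrmV nrm_nat invf_le1// ler1n.
have i1' : nrm (- N%:R^-1 : R[i]) <= 1 by rewrite nrmN.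
have h1 := gterm_shift0 pg qg ng nu0 box i1.
have h2 := gterm_shift0 pg qg ng nu0 box i1'.
pose h : R := N%:R^-1.
have hn : `|h| <= 1 by rewrite ger0_norm ?invr_ge0// invf_le1// ler1n.
pose g := gterm 0 p q nu.
have gx d x : gterm 0 (p + d%:C) q nu x = g (x + d).
  by rewrite /g /gterm rmorphD /=; congr (_ ^+ _ * cexp _); ring.
(* Adding the expansions at h and -h cancels the first order terms. *)
have D2 : decays (2 * S * h ^+ 2) (fun x => g (x + h) + g (x - h) - 2 * g x).
  have := decaysD h1 h2; rewrite nrmN nrmV nrm_nat -/h -/S -mulrDl => H.
  have H2 : S + S = 2 * S by ring.
  rewrite H2 in H; apply: eq_decays H => x.
  rewrite NC -(rmorphN (real_complex R)) /= !gx -/h -/g rmorphN; ring.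
have e1 : decays (2 * S * h ^+ 2) (fun x => cchar n x * (g (x + h) + g (x - h) - 2 * g x)) :=
  cdec n D2.
have [_] := rsumP N0 e1.
pose z := cchar n h.
have cD x y : cchar n (x + y) = cchar n x * cchar n y.
  by rewrite /cchar -cexpD rmorphD /=; congr cexp; ring.
have dp : decays (gK (nrm p) (nrm q) (nrm nu) (Re nu) 0 * expR 1) (fun x => cchar n x * g (x + h)).
  exact/cdec/decays_shift.
have dm : decays (gK (nrm p) (nrm q) (nrm nu) (Re nu) 0 * expR 1) (fun x => cchar n x * g (x - h)).
  by apply/cdec/decays_shift => //; rewrite normrN.
have dz : decays _ (fun x => cchar n x * g x) := cdec n D0.
have zc : cchar n (- h) * cchar n h = 1.
  by rewrite -cD addNr /cchar mulr0 oppr0 cexp0.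
have Ep : rsum N (fun x => cchar n x * g (x + h)) = cchar n (- h) * A N n.
  rewrite -[A N n]/(rsum N (fun x => cchar n x * g x)).
  rewrite -(rsum_shift N0 dz) -(rsumZ _ N0 (decays_shift dz hn)).
  apply: eq_rsum => x; rewrite -/h.
  transitivity ((cchar n (- h) * cchar n h) * (cchar n x * g (x + h))).
    by rewrite zc mul1r.
  by rewrite cD; ring.
have Em : rsum N (fun x => cchar n x * g (x - h)) = cchar n h * A N n.
  rewrite -[A N n]/(rsum N (fun x => cchar n x * g x)).
  rewrite -(rsum_shift N0 dm) -(rsumZ _ N0 dz).
  by apply: eq_rsum => x; rewrite cD -/h addrK; ring.
rewrite (_ : rsum N _ = (cchar n (- h) + cchar n h - 2) * A N n); last first.
  rewrite mulrBl mulrDl -Ep -Em.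
  rewrite -(rsumD N0 dp dm) -(rsumZ 2 N0 dz) -(rsumB N0 (decaysD dp dm) (decaysZ 2 dz)).
  by apply: eq_rsum => x; ring.
rewrite nrmM => H.
have hn2 : `|n%:~R / N%:R : R| <= 1 / 2.
  rewrite normrM normfV normr_nat ler_pdivrMr// -intr_norm -abszE -pmulrn.
  have : (`|n|%N.*2%:R : R) <= N%:R by rewrite ler_nat.
  by rewrite -addnn natrD; lra.
have := nrm_second_difference hn2.
rewrite (_ : 2 * pi%:C * 'i * (n%:~R / N%:R : R)%:C = 2 * pi%:C * 'i * n%:~R * h%:C); last first.
  by rewrite rmorphM /= -[(n%:~R)%:C]/(real_complex R n%:~R) rmorph_int /h; ring.
have -> : cexp (2 * pi%:C * 'i * n%:~R * h%:C) = cchar n (- h).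
  by rewrite /cchar rmorphN /= mulrN opprK.
rewrite -[cexp (- _)]/(cchar n h) => H2.
have {H H2} := le_trans (ler_wpM2r (nrm_ge0 (A N n)) H2) H.
have -> : (n%:~R / N%:R : R) ^+ 2 = `|n|%N%:R ^+ 2 * h ^+ 2.
  rewrite exprMn -/h; congr (_ * _).
  by rewrite -real_normK ?num_real// -intr_norm -abszE -pmulrn.
set X := nrm _; set Y := _ ^+ 2.
have h2p : 0 < h ^+ 2 by rewrite exprn_gt0// invr_gt0.
rewrite (_ : Y * _ * X = (X * Y) * h ^+ 2); last by ring.
rewrite (_ : 4 * _ = 8 * S * h ^+ 2); last by ring.
by rewrite ler_pM2r.
Qed.

Let psum_split (f : int -> R[i]) (a b r : nat) :
  psum f (a + r) (b + r) =
  psum f a b + \sum_(j < r) f ((b + j)%N%:Z) + \sum_(j < r) f (- (a + j).+1%:Z).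
Proof.
elim: r => [|r IH]; first by rewrite !addn0 !big_ord0 !addr0.
rewrite !big_ord_recr /= !addnS.
have -> : psum f (a + r).+1 (b + r).+1 =
    f (- (a + r).+1%:Z) + (psum f (a + r) (b + r) + f ((b + r)%N%:Z)).
  rewrite /psum addSn addnS big_ord_recl big_ord_recr /=; congr (_ + (_ + _)).
  - exact: (congr1 f (sub0r _)).
  - apply: eq_bigr => k _; congr f.
    by rewrite /bump leq0n add1n (intS k) (intS (a + r)); ring.
  - congr f; rewrite /bump leq0n add1n (intS (a + r)) intS !PoszD; ring.
rewrite IH; ring.
Qed.

(** Comparison of 1 / (m + 1)^2 with the telescoping difference 1 / m - 1 / (m + 1). *)
Let inv_sqr_sum (a r : nat) : (0 < a)%N ->
  \sum_(j < r) (((a + j).+1%:R : R) ^+ 2)^-1 <= a%:R^-1.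
Proof.
move=> a0.
have : \sum_(j < r) (((a + j).+1%:R : R) ^+ 2)^-1 <= a%:R^-1 - (a + r)%:R^-1.
  elim: r => [|r IH]; first by rewrite big_ord0 addn0 subrr.
  rewrite big_ord_recr /=; apply: le_trans (lerD IH (lexx _)) _.
  have m0 : 0 < (a + r)%:R :> R by rewrite ltr0n addn_gt0 a0.
  rewrite addnS -natr1; set m := (a + r)%:R in m0 *.
  have m1 : 0 < m + 1 by lra.
  rewrite -addrA lerD2l -subr_ge0.
  rewrite (_ : _ - _ = (m * (m + 1) ^+ 2)^-1).
    by rewrite invr_ge0 mulr_ge0 ?exprn_ge0 ?ltW.
  by clearbody m; field; rewrite !gt_eqF.
by move=> /le_trans; apply; rewrite gerBl invr_ge0.
Qed.

(** A dominated convergence argument: finitely many frequencies are treated one by one through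
    [rsum_indep], the remaining ones uniformly through [A_bound]. *)
Lemma poisson_limit : cv (fun K => rsum K.*2.+1 (gterm 0 0 0 nu) *
  (cexp (2 * pi%:C * 'i * p * q) * tsum 0 (- q) p nu^-1)) (tsum 0 p q nu).
Proof.
have nun : nu != 0 by apply: contraTneq nu0 => ->; rewrite ltxx.
have mu0 : 0 < Re nu^-1.
  by case: (nu) nu0 nun => a b /= a0 _; rewrite divr_gt0// ltr_wpDr ?sqr_ge0// exprn_gt0.
have [B B0 hB] := A_bound.
have [S S0 hS] := rsum_bounded nu0.
have cZ : zsums poisson_coef (cexp (2 * pi%:C * 'i * p * q) * tsum 0 (- q) p nu^-1).
  apply: eq_zsums (zsumsZ _ (tsumP 0 (- q) p mu0)) => m.
  by rewrite /tterm expr0 mul1r.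
set H := _ * tsum _ _ _ _ in cZ *.
(* [rsum_indep] gives a constant for each frequency n separately; one is selected for every n, and
   only those with -n0 <= n <= n0 are used. *)
pose C n : R := xget 0 [set C | forall N, (0 < N)%N ->
  nrm (A N n - rsum N (gterm 0 0 0 nu) * poisson_coef n) <= C / N%:R].
have CP n N : (0 < N)%N ->
    nrm (A N n - rsum N (gterm 0 0 0 nu) * poisson_coef n) <= C n / N%:R.
  have [D hD] := rsum_indep (p - 'i * nu^-1 * (q - n%:~R)) nu0.
  rewrite /C; case: xgetP => [C' _ hC'|/(_ (nrm (poisson_coef n) * D))]; first exact: hC'.
  move=> /(_ _)[]// N' N0; rewrite A_gauss// [rsum N' _ * _]mulrC -mulrBr nrmM -[X in _ <= X]mulrA.
  by rewrite ler_wpM2l ?nrm_ge0// hD.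
(* Errors: e for the finite head, S e for truncating the dual series, e for the two tails
   together. *)
apply: (@cv_scale _ _ _ (2 + S)) => [|e e0]; first by rewrite addr_ge0.
have [K1 hK1] := cZ e e0.
pose n0 := maxn K1 (Num.bound (2 * B / e)).+1.
have n0_gt0 : (0 < n0)%N by rewrite leq_max orbT.
have n0B : 2 * B / n0%:R <= e.
  rewrite ler_pdivrMr ?ltr0n// [e * _]mulrC -ler_pdivrMr//.
  apply: le_trans (ltW (archi_boundP (divr_ge0 (mulr_ge0 (ler0n _ 2) B0) (ltW e0)))) _.
  by rewrite ler_nat leq_max leqnSn orbT.
pose Cs := \sum_(k < n0 + n0.+1) `|C (k%:Z - n0%:Z)|.
have Cs0 : 0 <= Cs by apply: sumr_ge0.
exists (n0 + Num.bound (Cs / e))%N => k hk.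
set N := k.*2.+1; have N0 : (0 < N)%N by [].
have Np : 0 < N%:R :> R by rewrite ltr0n.
have CsN : Cs / N%:R <= e.
  rewrite ler_pdivrMr// [e * _]mulrC -ler_pdivrMr//.
  apply: le_trans (ltW (archi_boundP (divr_ge0 Cs0 (ltW e0)))) _.
  rewrite ler_nat (leq_trans (leq_addl n0 _))// (leq_trans hk)// /N -addnn.
  by rewrite leqW// leq_addr.
have n0k : (n0 <= k)%N by rewrite (leq_trans _ hk)// leq_addr.
rewrite -(dft k) -/N; set r := (k - n0)%N.
have kE : k = (n0 + r)%N by rewrite subnKC.
(* The frequencies from -k to k split into those from -n0 to n0 and two tails of r = k - n0
   terms. *)
rewrite {1 2}kE -addSn psum_split.
set X := rsum N _.
set T1 := \sum_(j < r) _; set T2 := \sum_(j < r) _.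
have tail (f : nat -> int) : (forall j, `|f j|%N = (n0 + j).+1) ->
    nrm (\sum_(j < r) A N (f j)) <= B / n0%:R.
  move=> hf; apply: le_trans (nrm_sum _ _ _) _.
  apply: le_trans (ler_wpM2l B0 (inv_sqr_sum r n0_gt0)).
  rewrite mulr_sumr; apply: ler_sum => j _.
  rewrite ler_pdivlMr ?exprn_gt0 ?ltr0n// -hf.
  apply: hB => //; rewrite hf /N kE.
  by rewrite ltnW// ltnS leq_double -addnS leq_add2l.
have t1 : nrm T1 <= B / n0%:R by apply: (tail (fun j => (n0.+1 + j)%N%:Z)) => j; rewrite absz_nat addSn.
have t2 : nrm T2 <= B / n0%:R by apply: (tail (fun j => - (n0 + j).+1%:Z)) => j; rewrite abszN absz_nat.
have P1 : nrm (psum (A N) n0 n0.+1 - X * psum poisson_coef n0 n0.+1) <= Cs / N%:R.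
  rewrite /psum mulr_sumr -sumrB; apply: le_trans (nrm_sum _ _ _) _.
  rewrite /Cs mulr_suml; apply: ler_sum => j _.
  apply: le_trans (CP _ _ N0) _; rewrite ler_wpM2r ?invr_ge0// ler_norm//.
have P2 := hK1 n0 n0.+1 (leq_maxl _ _) (leqW (leq_maxl _ _)).
have P3 : nrm (X * (psum poisson_coef n0 n0.+1 - H)) <= S * e.
  by rewrite nrmM ler_pM ?nrm_ge0// hS.
have -> : X * H - (psum (A N) n0 n0.+1 + T1 + T2) =
  - ((psum (A N) n0 n0.+1 - X * psum poisson_coef n0 n0.+1) +
     X * (psum poisson_coef n0 n0.+1 - H) + T1 + T2) by ring.
rewrite nrmN.
have := nrmD (psum (A N) n0 n0.+1 - X * psum poisson_coef n0 n0.+1 +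
     X * (psum poisson_coef n0 n0.+1 - H) + T1) T2.
have := nrmD (psum (A N) n0 n0.+1 - X * psum poisson_coef n0 n0.+1 +
     X * (psum poisson_coef n0 n0.+1 - H)) T1.
have := nrmD (psum (A N) n0 n0.+1 - X * psum poisson_coef n0 n0.+1)
     (X * (psum poisson_coef n0 n0.+1 - H)).
have : 2 * B / n0%:R = B / n0%:R + B / n0%:R by ring.
lra.
Qed.

End FixedParameters.
End PoissonSummation.

(** * The inversion law of theta *)

Section ThetaInversion.
Context {R : realType}.
Implicit Types (p q mu nu : R[i]).

Lemma cvD (u v : nat -> R[i]) a b : cv u a -> cv v b -> cv (fun k => u k + v k) (a + b).
Proof.
move=> ha hb e e0; have e2 : 0 < e / 2 by rewrite divr_gt0.
have [K hK] := ha _ e2; have [L hL] := hb _ e2.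
exists (maxn K L) => k; rewrite geq_max => /andP[/hK h1 /hL h2].
rewrite (_ : _ - _ = (u k - a) + (v k - b)); last by ring.
by apply: le_trans (nrmD _ _) _; lra.
Qed.

Lemma Re_inv_gt0 nu : 0 < Re nu -> 0 < Re nu^-1.
Proof.
case: nu => a b /= a0; rewrite divr_gt0// ltr_wpDr ?sqr_ge0// exprn_gt0//.
Qed.

Lemma Re_gt0_neq0 nu : 0 < Re nu -> nu != 0.
Proof. by apply: contraTneq => ->; rewrite ltxx. Qed.

(** All terms are positive reals and the one with m = 0 is 1, so the partial sums stay away from
    0. *)
Lemma tsum_one_neq0 : tsum 0 0 0 1 != 0 :> R[i].
Proof.
apply/eqP => h0; have := @tsumP R 0 0 0 1 ltr01; rewrite h0 => H.
have [|K hK] := H (1 / 2); first by rewrite divr_gt0.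
have := hK K.+1 K.+1 (leqnSn _) (leqnSn _); rewrite subr0.
have t m : tterm 0 0 0 1 m = (expR (- pi * m%:~R ^+ 2) : R)%:C.
  rewrite /tterm /theta_term expr0 mul1r -cexp_real; congr cexp.
  by rewrite rmorphM rmorphN rmorphXn rmorph_int /=; ring.
suff h1 : 1 <= Re (psum (tterm 0 0 0 (1 : R[i])) K.+1 K.+1).
  move=> h2; have := le_trans h1 (le_trans (Re_le_nrm _) h2); lra.
have i0 : (K.+1 < K.+1 + K.+1)%N by rewrite -[X in (X < _)%N]addn0 ltn_add2l.
rewrite /psum Re_sum (bigD1 (Ordinal i0))//.
rewrite (_ : tterm _ _ _ _ _ = 1); last by rewrite t subrr expr0n mulr0 expR0.
rewrite [Re 1]/= lerDl.
by apply: sumr_ge0 => i _; rewrite t expR_ge0.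
Qed.

Let Kn mu (k : nat) := rsum k.*2.+1 (gterm 0 0 0 mu).

(** At nu = 1 and p = q = 0 the theta value is its own dual, so the limit formula determines the
    Gaussian constant after division by this nonzero value. *)
Lemma gauss_limit1 : cv (Kn 1) 1.
Proof.
have := @poisson_limit R 0 0 1 ltr01.
rewrite mulr0 cexp0 mul1r oppr0 invr1 => H.
have := cvM H (cv_cst (tsum 0 0 0 1)^-1); rewrite divff ?tsum_one_neq0//.
by apply: eq_cv => k; rewrite mulfK ?tsum_one_neq0.
Qed.

Lemma gauss_limit_sqr mu : 0 < Re mu -> cv (fun k => mu * Kn mu k ^+ 2) 1.
Proof.
move=> mu0; have [C hC] := rsum_sqr mu0.
have H : cv (fun k => mu * Kn mu k ^+ 2 - 1 * Kn 1 k ^+ 2) 0.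
  by apply: (@cv_le_inv _ _ _ C) => k; rewrite subr0; exact: hC.
have := cvD H (cvM gauss_limit1 gauss_limit1); rewrite mulr1 add0r.
by apply: eq_cv => k; rewrite -expr2 mul1r subrK.
Qed.

Let dual p q nu : R[i] := cexp (2 * pi%:C * 'i * p * q) * tsum 0 (- q) p nu^-1.

(** Products of two theta values are compared because only the square of the Gaussian sum has a
    known limit. *)
Lemma tsum_inversion_prod p q p' q' nu : 0 < Re nu ->
  nu * (tsum 0 p q nu * tsum 0 p' q' nu) = dual p q nu * dual p' q' nu.
Proof.
move=> nu0; have h1 := poisson_limit p q nu0; have h2 := poisson_limit p' q' nu0.
have g := gauss_limit_sqr nu0.
have := cvM g (cv_cst (dual p q nu * dual p' q' nu)); rewrite mul1r => H.
apply: cv_unique (cvM (cv_cst nu) (cvM h1 h2)) _.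
by apply: eq_cv H => k; rewrite /dual /Kn; ring.
Qed.

(** The same root L serves all p and q. Which of the two roots it is remains open, and does not
    affect the w_j and F. *)
Lemma theta_inversion mu : 0 < Re mu -> exists2 L : R[i], L ^+ 2 = mu &
  forall p q, theta p q mu^-1 = L * cexp (2 * pi%:C * 'i * p * q) * theta (- q) p mu.
Proof.
move=> mu0; have nu0 := Re_inv_gt0 mu0; have mun := Re_gt0_neq0 mu0.
have D p q : dual p q mu^-1 = cexp (2 * pi%:C * 'i * p * q) * theta (- q) p mu.
  by rewrite /dual invrK thetaE.
(* A nonzero value at some (p0, q0) fixes L as a quotient. If every value vanished, so would every
   dual value, and any root of mu would do. *)
have [[p0 [q0 T0]]|T0] := pselect (exists p0 q0, tsum 0 p0 q0 mu^-1 != 0).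
  have E := tsum_inversion_prod p0 q0 p0 q0 nu0.
  set T := tsum _ _ _ _ in T0 E; set H := dual _ _ _ in E.
  have H0 : H != 0.
    by apply: contra_neq T0 => h; move/eqP: E; rewrite h mul0r !mulf_eq0 invr_eq0 (negbTE mun) orbb => /eqP.
  exists (T / H).
    have E' : T ^+ 2 = mu * H ^+ 2 by rewrite [H ^+ 2]expr2 -E expr2 mulVKf.
    by rewrite expr_div_n E' mulfK// expf_neq0.
  move=> p q; rewrite thetaE// -mulrA -D.
  have := tsum_inversion_prod p q p0 q0 nu0; rewrite -/T -/H => F.
  have E' : T * T = mu * (H * H) by rewrite -E mulVKf.
  apply: (mulIf T0); rewrite mulrAC -[T / H * T]mulrAC E'.
  have -> : mu * (H * H) / H = mu * H by field.
  by rewrite -mulrA [H * _]mulrC -F mulVKf.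
exists (sqrtc mu); first exact: sqr_sqrtc.
have Z p q : tsum 0 p q mu^-1 = 0.
  by apply/eqP/negPn/negP => h; apply: T0; exists p, q.
move=> p q; rewrite thetaE// Z -mulrA -D.
have := tsum_inversion_prod p q p q nu0; rewrite Z mul0r mulr0.
by move/esym/eqP; rewrite mulf_eq0 orbb => /eqP ->; rewrite mulr0.
Qed.

End ThetaInversion.

(** * Derivatives by explicit estimates *)

Section EpsilonDerivative.
Context {R : realType} {D : zmodType} (io : D -> R[i]).
Implicit Types (f g : D -> R[i]) (x h : D) (l : R[i]).

(* With io the identity of R[i] this is the complex derivative, with io the
   embedding of R that of a complex function of a real variable. *)
Definition der f x l := forall e : R, 0 < e -> exists2 d, 0 < d &
  forall h, nrm (io h) <= d -> nrm (f (x + h) - f x - l * io h) <= e * nrm (io h).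

Definition econt f x := forall e : R, 0 < e -> exists2 d, 0 < d &
  forall h, nrm (io h) <= d -> nrm (f (x + h) - f x) <= e.

Lemma der_scale f x l (C : R) : 0 <= C ->
  (forall e : R, 0 < e -> exists2 d, 0 < d & forall h, nrm (io h) <= d ->
    nrm (f (x + h) - f x - l * io h) <= C * e * nrm (io h)) -> der f x l.
Proof.
move=> C0 H e e0; have C1 : 0 < C + 1 by lra.
have [d d0 hd] := H _ (divr_gt0 e0 C1); exists d => // h /hd /le_trans; apply.
rewrite ler_wpM2r ?nrm_ge0// mulrA ler_pdivrMr// mulrC ler_wpM2l ?(ltW e0)//; lra.
Qed.

Lemma der_quad f x l (K d : R) : 0 < d ->
  (forall h, nrm (io h) <= d -> nrm (f (x + h) - f x - l * io h) <= K * nrm (io h) ^+ 2) ->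
  der f x l.
Proof.
move=> d0 H; apply: (@der_scale _ _ _ `|K|) => // e e0.
exists (Num.min d e) => [|h]; first by rewrite lt_min d0.
rewrite le_min => /andP[/H/le_trans h1 he]; apply: h1.
rewrite expr2 mulrA ler_wpM2r ?nrm_ge0//.
apply: (@le_trans _ _ (`|K| * nrm (io h))).
  by rewrite ler_wpM2r ?nrm_ge0// ler_norm.
by rewrite ler_wpM2l.
Qed.

Lemma der_econt f x l : der f x l -> econt f x.
Proof.
move=> H e e0; have [d d0 hd] := H 1 ltr01.
have c0 : 0 < nrm l + 1 by rewrite ltr_wpDl ?nrm_ge0.
exists (Num.min d (e / (nrm l + 1))) => [|h]; first by rewrite lt_min d0 divr_gt0.
rewrite le_min => /andP[/hd h1 h2].
rewrite -[_ - _](subrK (l * io h)); apply: le_trans (nrmD _ _) _.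
rewrite nrmM; move: h2; rewrite ler_pdivlMr// => h2.
have := nrm_ge0 (io h); lra.
Qed.

Lemma der_near f g x l (d : R) : 0 < d ->
  (forall h, nrm (io h) <= d -> f (x + h) - f x = g (x + h) - g x) -> der f x l -> der g x l.
Proof.
move=> d0 H F e e0; have [d' d'0 hd] := F e e0.
exists (Num.min d d') => [|h]; first by rewrite lt_min d0.
by rewrite le_min => /andP[/H <- /hd].
Qed.

Lemma eq_der f g x l : f =1 g -> der f x l -> der g x l.
Proof. by move=> fg; apply: (@der_near _ _ _ _ 1) => // h _; rewrite !fg. Qed.

Lemma der_cst c x : der (fun=> c) x 0.
Proof.
move=> e e0; exists 1 => // h _.
by rewrite subrr mul0r subr0 nrm0 mulr_ge0 ?nrm_ge0 ?ltW.
Qed.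

Lemma derD f g x l m : der f x l -> der g x m -> der (fun y => f y + g y) x (l + m).
Proof.
move=> hf hg; apply: (@der_scale _ _ _ 2) => // e e0.
have [d d0 hd] := hf e e0; have [d' d'0 hd'] := hg e e0.
exists (Num.min d d') => [|h]; first by rewrite lt_min d0.
rewrite le_min => /andP[/hd h1 /hd' h2].
rewrite (_ : _ - _ = (f (x + h) - f x - l * io h) + (g (x + h) - g x - m * io h)); last by ring.
by apply: le_trans (nrmD _ _) _; lra.
Qed.

Lemma derM f g x l m : der f x l -> der g x m ->
  der (fun y => f y * g y) x (l * g x + f x * m).
Proof.
move=> hf hg.
have C0 : 0 <= nrm (f x) + nrm (g x) + (nrm l + 1) * (nrm m + 1).
  by rewrite !addr_ge0 ?mulr_ge0 ?addr_ge0 ?nrm_ge0.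
apply: (der_scale C0) => e0 e00; pose e := Num.min e0 1.
have e_gt0 : 0 < e by rewrite lt_min e00 ltr01.
have e1 : e <= 1 by rewrite ge_min lexx orbT.
have ee0 : e <= e0 by rewrite ge_min lexx.
clearbody e.
have [d d0 hd] := hf e e_gt0; have [d' d'0 hd'] := hg e e_gt0.
exists (Num.min (Num.min d d') e) => [|h]; first by rewrite lt_min e_gt0 lt_min d0 d'0.
rewrite !le_min => /andP[/andP[/hd H1 /hd' H2] ke]; move: H1 H2.
set k := nrm (io h) in ke *; have k0 : 0 <= k by exact: nrm_ge0.
set E := f (x + h) - _ - _; set E' := g (x + h) - _ - _ => h1 h2.
have -> : f (x + h) * g (x + h) - f x * g x - (l * g x + f x * m) * io h =
  f x * E' + g x * E + (l * io h + E) * (m * io h + E') by rewrite /E /E'; ring.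
have b1 : nrm (f x * E') <= nrm (f x) * (e * k) by rewrite nrmM ler_wpM2l ?nrm_ge0.
have b2 : nrm (g x * E) <= nrm (g x) * (e * k) by rewrite nrmM ler_wpM2l ?nrm_ge0.
have s l' X : nrm X <= e * k -> nrm (l' * io h + X) <= (nrm l' + 1) * k.
  move=> hX; apply: le_trans (nrmD _ _) _; rewrite nrmM -/k mulrDl mul1r lerD2l.
  by apply: le_trans hX _; rewrite ler_piMl.
have b3 : nrm ((l * io h + E) * (m * io h + E')) <= (nrm l + 1) * (nrm m + 1) * (e * k).
  rewrite nrmM; apply: (@le_trans _ _ ((nrm l + 1) * k * ((nrm m + 1) * k))).
    by apply: ler_pM; [exact: nrm_ge0|exact: nrm_ge0|exact: s|exact: s].
  rewrite (_ : _ * _ = (nrm l + 1) * (nrm m + 1) * (k * k)); last by ring.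
  apply: ler_wpM2l; first by rewrite mulr_ge0 ?addr_ge0 ?nrm_ge0.
  by rewrite ler_wpM2r.
have t1 := nrmD (f x * E' + g x * E) ((l * io h + E) * (m * io h + E')).
have t2 := nrmD (f x * E') (g x * E).
have : (nrm (f x) + nrm (g x) + (nrm l + 1) * (nrm m + 1)) * (e * k) <=
   (nrm (f x) + nrm (g x) + (nrm l + 1) * (nrm m + 1)) * (e0 * k).
  by rewrite ler_wpM2l// ler_wpM2r.
rewrite -(mulrA _ e0 k); lra.
Qed.

Lemma derZ f x l c : der f x l -> der (fun y => c * f y) x (c * l).
Proof. by move=> h; have := derM (der_cst c x) h; rewrite mul0r add0r. Qed.

Lemma derN f x l : der f x l -> der (fun y => - f y) x (- l).
Proof.
move=> h; have := derZ (-1) h; rewrite mulN1r; apply: eq_der => y.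
by rewrite mulN1r.
Qed.

Lemma derB f g x l m : der f x l -> der g x m -> der (fun y => f y - g y) x (l - m).
Proof. by move=> hf hg; exact: derD hf (derN hg). Qed.

Lemma der_additive x : {morph io : x y / x + y} -> der io x 1.
Proof.
move=> H e e0; exists 1 => // h _.
rewrite H (_ : _ - _ = 0) ?nrm0 ?mulr_ge0 ?nrm_ge0 ?ltW//; ring.
Qed.

Lemma der_unique f x l m : (forall d : R, 0 < d -> exists2 h, io h != 0 & nrm (io h) <= d) ->
  der f x l -> der f x m -> l = m.
Proof.
move=> small hl hm; apply/eqP; rewrite -subr_eq0 -nrm_eq0 eq_le nrm_ge0 andbT.
apply/ler_addgt0Pr => e e0; rewrite add0r.
have e20 : 0 < e / 2 by rewrite divr_gt0.
have [d d0 hd] := hl _ e20; have [d' d'0 hd'] := hm _ e20.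
have [h h0] : exists2 h, io h != 0 & nrm (io h) <= Num.min d d'.
  by apply: small; rewrite lt_min d0.
rewrite le_min => /andP[/hd h1 /hd' h2].
have hp : 0 < nrm (io h) by rewrite nrm_gt0.
rewrite -(ler_pM2r hp) -nrmM.
have -> : (l - m) * io h = (f (x + h) - f x - m * io h) - (f (x + h) - f x - l * io h).
  by ring.
apply: le_trans (nrmB _ _) _; lra.
Qed.

(** The increment of r is the increment of f divided by r(x + h) + r(x). Continuity of the branch
    keeps this sum at modulus at least |r(x)|. *)
Lemma der_sqrt (r : D -> R[i]) f x l : r x != 0 -> econt r x ->
  (exists2 d : R, 0 < d & forall h, nrm (io h) <= d -> r (x + h) ^+ 2 = f (x + h)) ->
  r x ^+ 2 = f x -> der f x l -> der r x (l / (2 * r x)).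
Proof.
move=> r0 rc [d1 d10 hr] rx H.
set a := nrm (r x); have a0 : 0 < a by rewrite nrm_gt0.
apply: (@der_scale _ _ _ (a^-1 + nrm l / (2 * a ^+ 2))) => [|e e0].
  by rewrite addr_ge0 ?invr_ge0 ?divr_ge0 ?nrm_ge0 ?mulr_ge0 ?exprn_ge0 ?ltW.
have m0 : 0 < Num.min e a by rewrite lt_min e0.
have [d2 d20 h2] := rc _ m0; have [d3 d30 h3] := H e e0.
exists (Num.min d1 (Num.min d2 d3)) => [|h]; first by rewrite !lt_min d10 d20.
rewrite !le_min => /and3P[/hr rh /h2 + /h3 c3].
rewrite le_min => /andP[c1 c2].
set s := r (x + h) + r x.
have sE : s = 2 * r x + (r (x + h) - r x) by rewrite /s; ring.
have sa : a <= nrm s.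
  have := nrmB s (r (x + h) - r x); rewrite sE addrK nrmM (nrm_nat 2) -/a; lra.
have s0 : s != 0 by rewrite -nrm_gt0; exact: lt_le_trans a0 sa.
have n2 : nrm (2 : R[i]) = 2 by exact: (nrm_nat 2).
have -> : r (x + h) - r x - l / (2 * r x) * io h =
   (f (x + h) - f x - l * io h) / s - l * io h * (r (x + h) - r x) / (s * (2 * r x)).
  rewrite -rh -rx /s; move: s0; rewrite /s => s0; field.
  by rewrite s0 r0.
apply: le_trans (nrmB _ _) _; set k := nrm (io h) in c3 *.
have k0 : 0 <= k := nrm_ge0 _.
have b1 : nrm ((f (x + h) - f x - l * io h) / s) <= a^-1 * e * k.
  rewrite nrmM nrmV ler_pdivrMr ?(lt_le_trans a0 sa)//.
  apply: le_trans c3 _; rewrite [X in _ <= X](_ : _ = e * k * (nrm s / a)); last by ring.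
  rewrite ler_peMr//; first by rewrite mulr_ge0// ltW.
  by rewrite ler_pdivlMr// mul1r.
have b2 : nrm (l * io h * (r (x + h) - r x) / (s * (2 * r x))) <=
    nrm l / (2 * a ^+ 2) * e * k.
  rewrite !nrmM nrmV !nrmM n2 -/k -/a ler_pdivrMr ?mulr_gt0 ?(lt_le_trans a0 sa)//.
  have -> : nrm l / (2 * a ^+ 2) * e * k * (nrm s * (2 * a)) =
     nrm l * k * (e * (nrm s / a)).
    by field; rewrite gt_eqF.
  apply: ler_wpM2l; first by rewrite mulr_ge0 ?nrm_ge0.
  apply: le_trans c1 _; rewrite ler_peMr ?(ltW e0)//.
  by rewrite ler_pdivlMr// mul1r.
lra.
Qed.

End EpsilonDerivative.

Notation cder := (der id).
Notation rder := (der (fun t => t%:C)).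

(** * Complex derivatives, chain rule and inverse *)

Section ComplexDerivative.
Context {R : realType}.
Implicit Types (z l h : R[i]) (f g : R[i] -> R[i]).

Lemma der_comp (D : zmodType) (io : D -> R[i]) (g : D -> R[i]) f x l l' :
  der io g x l -> cder f (g x) l' -> der io (fun y => f (g y)) x (l' * l).
Proof.
move=> hg hf; apply: (@der_scale _ _ _ _ _ _ (nrm l + 1 + nrm l')) => [|e e0].
  by rewrite !addr_ge0 ?nrm_ge0.
have [d d0 hd] := hf e e0.
have m0 : 0 < Num.min e 1 by rewrite lt_min e0 ltr01.
have [d2 d20 hd2] := hg _ m0; have [d3 d30 hd3] := der_econt hg d0.
exists (Num.min d2 d3) => [|h]; first by rewrite lt_min d20.
rewrite le_min => /andP[/hd2 h2 /hd3 /hd].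
rewrite [g x + _]addrC subrK.
set G := g (x + h) - g x in h2 *; set E := G - _ in h2; set k := nrm (io h) in h2 *.
have k0 : 0 <= k := nrm_ge0 _.
have GE : G = l * io h + E by rewrite /E; ring.
have E1 : nrm E <= e * k.
  by apply: le_trans h2 _; rewrite ler_wpM2r// ge_min lexx.
have E2 : nrm E <= k.
  by apply: le_trans h2 _; rewrite -[X in _ <= X]mul1r ler_wpM2r// ge_min lexx orbT.
have G1 : nrm G <= (nrm l + 1) * k.
  by rewrite GE; apply: le_trans (nrmD _ _) _; rewrite nrmM mulrDl mul1r lerD.
move=> H.
have -> : f (g (x + h)) - f (g x) - l' * l * io h =
  (f (g (x + h)) - f (g x) - l' * G) + l' * E by rewrite GE; ring.
apply: le_trans (nrmD _ _) _.
have h5 : nrm (l' * E) <= nrm l' * (e * k) by rewrite nrmM ler_wpM2l ?nrm_ge0.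
have := ler_wpM2l (ltW e0) G1; lra.
Qed.

Lemma small_complex (d : R) : 0 < d -> exists2 h : R[i], id h != 0 & nrm (id h) <= d.
Proof.
move=> d0; have n : nrm (d%:C : R[i]) = d by rewrite nrm_real gtr0_norm.
by exists d%:C; rewrite -?nrm_gt0 (_ : nrm (id _) = d).
Qed.

Lemma cder_unique f z l m : cder f z l -> cder f z m -> l = m.
Proof. exact: der_unique small_complex. Qed.

Lemma cder_id z : cder id z 1.
Proof. exact: der_additive. Qed.

Lemma cder_inv z : z != 0 -> cder (fun w => w^-1) z (- z^-1 ^+ 2).
Proof.
move=> z0; have a0 : 0 < nrm z by rewrite nrm_gt0.
apply: (@der_quad _ _ _ _ _ _ (2 / nrm z ^+ 3) (nrm z / 2)) => [|h /= hz].
  by rewrite divr_gt0.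
have zh : nrm z / 2 <= nrm (z + h).
  by have := nrmB (z + h) h; rewrite addrK; lra.
have zh0 : z + h != 0.
  by rewrite -nrm_gt0; apply: lt_le_trans zh; rewrite divr_gt0.
have -> : (z + h)^-1 - z^-1 - - z^-1 ^+ 2 * h = h ^+ 2 / (z ^+ 2 * (z + h)).
  by field; rewrite zh0 z0.
rewrite nrmM nrmV nrmM !nrmX mulrC ler_wpM2r ?exprn_ge0 ?nrm_ge0//.
rewrite -[2 / _]invf_div lef_pV2 ?posrE ?divr_gt0 ?exprn_gt0 ?mulr_gt0 ?exprn_gt0 ?nrm_gt0//.
by rewrite exprSr -mulrA ler_wpM2l ?exprn_ge0 ?nrm_ge0.
Qed.

Lemma derV (D : zmodType) (io : D -> R[i]) (f : D -> R[i]) x l : f x != 0 ->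
  der io f x l -> der io (fun y => (f y)^-1) x (- l / f x ^+ 2).
Proof.
move=> f0 hf; have := der_comp hf (cder_inv f0).
by rewrite mulNr exprVn mulNr mulrC.
Qed.

Lemma cder_cexp z : cder cexp z (cexp z).
Proof.
apply: (@der_quad _ _ _ _ _ _ (nrm (cexp z) * (5 * expR 1)) 1) => // h /= h1.
have -> : cexp (z + h) - cexp z - cexp z * h = cexp z * (cexp h - 1 - h).
  by rewrite cexpD; ring.
rewrite nrmM -!mulrA ler_wpM2l ?nrm_ge0//; apply: le_trans (cexp_taylor1 h) _.
rewrite -[5 * _ * _]mulrA ler_wpM2l// [X in X <= _]mulrC ler_wpM2r ?sqr_ge0//.
by rewrite ler_expR.
Qed.

(** Link between the estimates and the derivative in which the operators are stated. *)
Lemma cder_cderive1 f z l : cder f z l -> cderive1 f z = l.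
Proof.
move=> H; rewrite /cderive1 /derive1.
suff : (fun h : R[i]^o => h^-1 *: ((f : R[i]^o -> R[i]^o) (h + z) - f z) : R[i]^o) @ (0 : R[i]^o)^'
    --> (l : R[i]^o).
  by move=> H2; apply: (cvg_lim _ H2); exact: (@norm_hausdorff _ R[i]^o).
apply/(@cvgrPdist_le _ R[i]^o) => e e0.
have e0' : 0 < Re e by move: e0; rewrite ltcE /= => /andP[].
have [d d0 hd] := H _ e0'.
have dC : 0 < d%:C by rewrite ltcR.
near=> h.
have h0 : h != 0 by near: h; exact: nbhs_dnbhs_neq.
have hd1 : `|h| < d%:C.
  near: h; apply: dnbhs0_lt => //.
have {hd} := hd h; rewrite nrmE ltcR in hd1 => /(_ (ltW hd1)) /= hd.
have -> : e = (Re e)%:C.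
  by move: e0; rewrite ltcE /= => /andP[/eqP i0 _]; apply: complexP.
rewrite nrmE lecR.
rewrite [h + z]addrC.
rewrite (_ : l - _ = - ((f (z + h) - f z - l * h) / h)).
  by rewrite nrmN nrmM nrmV ler_pdivrMr ?nrm_gt0.
by rewrite -[_ *: _]/(h^-1 * (f (z + h) - f z)); field.
Unshelve. all: by end_near. Qed.

End ComplexDerivative.

(** * Repeatedly differentiable complex functions *)

Section Holomorphic.
Context {R : realType}.
Implicit Types (f g : R[i] -> R[i]) (U : set R[i]) (z p q mu : R[i]).

Fixpoint holo n U f : Prop :=
  if n is n'.+1 then exists2 f', (forall z, U z -> cder f z (f' z)) & holo n' U f'
  else True.

Lemma holoS n U f : holo n.+1 U f -> holo n U f.
Proof.
elim: n f => // n IH f [f' ff' hf']; exists f' => //; exact: IH.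
Qed.

Lemma holo_cst n U c : holo n U (fun=> c).
Proof.
elim: n c => // n IH c; exists (fun=> 0); last exact: IH.
by move=> z _; exact: der_cst.
Qed.

Lemma holoD n U f g : holo n U f -> holo n U g -> holo n U (fun z => f z + g z).
Proof.
elim: n f g => // n IH f g [f' ff' hf'] [g' gg' hg'].
exists (fun z => f' z + g' z); last exact: IH.
by move=> z Uz; apply: derD; [exact: ff'|exact: gg'].
Qed.

Lemma holoM n U f g : holo n U f -> holo n U g -> holo n U (fun z => f z * g z).
Proof.
elim: n f g => // n IH f g Hf Hg; move: (Hf) (Hg) => [f' ff' hf'] [g' gg' hg'].
exists (fun z => f' z * g z + f z * g' z).
  by move=> z Uz; apply: derM; [exact: ff'|exact: gg'].
by apply: holoD; apply: IH => //; exact: holoS.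
Qed.

Lemma holoV n U f : (forall z, U z -> f z != 0) -> holo n U f -> holo n U (fun z => (f z)^-1).
Proof.
move=> f0; elim: n f f0 => // n IH f f0 Hf; move: (Hf) => [f' ff' hf'].
exists (fun z => (- 1 * f' z) * ((f z)^-1 * (f z)^-1)).
  move=> z Uz; have := derV (f0 z Uz) (ff' z Uz).
  by rewrite mulN1r expr2 invfM.
have hi := IH f f0 (holoS Hf).
by apply: holoM; apply: holoM => //; exact: holo_cst.
Qed.

(** The theta identities hold only for Re mu > 0. This half-plane is open, so agreement there
    suffices to transfer derivatives. *)
Lemma cder_halfplane f g z l : 0 < Re z -> (forall w, 0 < Re w -> f w = g w) ->
  cder f z l -> cder g z l.
Proof.
move=> z0 fg; apply: (@der_near _ _ _ _ _ _ _ (Re z / 2)); first by rewrite divr_gt0.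
move=> h /= hz; rewrite !fg// ReD.
by have := normr_Re h; rewrite ler_norml => /andP[]; lra.
Qed.

Lemma holo_halfplane n U f g : U `<=` [set z | 0 < Re z] ->
  (forall w, 0 < Re w -> f w = g w) -> holo n U f -> holo n U g.
Proof.
case: n => // n UR fg [f' ff' hf']; exists f' => // z Uz.
by apply: cder_halfplane (ff' z Uz) => //; exact: UR.
Qed.

End Holomorphic.

(** * Regularity of theta, of the w_j and of F *)

Section ThetaDerivatives.
Context {R : realType}.
Implicit Types (p q mu z : R[i]) (U : set R[i]).

Lemma cder_tsum_q k p q mu : 0 < Re mu ->
  cder (fun q' => tsum k p q' mu) q (2 * pi%:C * 'i * tsum k.+1 p q mu).
Proof.
by move=> mu0; have [K hK] := tsum_dq k p q mu0; apply: (@der_quad _ _ _ _ _ _ K 1).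
Qed.

Lemma cder_tsum_mu k p q mu : 0 < Re mu ->
  cder (tsum k p q) mu (- pi%:C * tsum k.+2 p q mu).
Proof.
move=> mu0; have [K hK] := tsum_dmu k p q mu0.
apply: (@der_quad _ _ _ _ _ _ K (Num.min 1 (Re mu / 2))) => [|h].
  by rewrite lt_min ltr01 divr_gt0.
by rewrite le_min => /andP[h1 h2]; exact: hK.
Qed.

Lemma holo_tsum n U k p q : U `<=` [set z | 0 < Re z] -> holo n U (tsum k p q).
Proof.
move=> UR; elim: n k => // n IH k; exists (fun mu => - pi%:C * tsum k.+2 p q mu).
  by move=> z /UR; exact: cder_tsum_mu.
by apply: holoM (IH _); exact: holo_cst.
Qed.

Lemma dthetaE p q mu : 0 < Re mu -> dtheta p q mu = 2 * pi%:C * 'i * tsum 1 p q mu.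
Proof.
move=> mu0; rewrite /dtheta (_ : (fun q' => _) = (fun q' => tsum 0 p q' mu)).
  exact: cder_cderive1 (cder_tsum_q 0 p q mu0).
by apply/funext => q'; rewrite thetaE.
Qed.

Lemma holo_theta n U p q : U `<=` [set z | 0 < Re z] -> holo n U (theta p q).
Proof.
move=> UR; apply: holo_halfplane (holo_tsum n 0 p q UR) => // w w0.
by rewrite thetaE.
Qed.

Lemma holo_dtheta n U p q : U `<=` [set z | 0 < Re z] -> holo n U (dtheta p q).
Proof.
move=> UR; apply: holo_halfplane (holoM (holo_cst n U (2 * pi%:C * 'i)) (holo_tsum n 1 p q UR)) => // w w0.
by rewrite dthetaE.
Qed.

Definition reg p q : set R[i] := [set mu | 0 < Re mu /\ theta p q mu != 0].

Let regR p q : reg p q `<=` [set z | 0 < Re z].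
Proof. by move=> z []. Qed.

Let holo_thetaV n p q : holo n (reg p q) (fun mu => (theta p q mu)^-1).
Proof. by apply: holoV => [z []//|]; apply: holo_theta; exact: regR. Qed.

Lemma holo_w1 n p q : holo n (reg p q) (w1 p q).
Proof.
rewrite /w1; apply: holoM; first apply: holoM; first apply: holoM.
- exact: holo_cst.
- by apply: holo_theta; exact: regR.
- by apply: holo_theta; exact: regR.
apply: holoM; first by apply: holo_dtheta; exact: regR.
apply: holoV => [z [_ h]|]; first by rewrite mulf_neq0 ?cexp_neq0.
by apply: holoM; [exact: holo_cst|apply: holo_theta; exact: regR].
Qed.

Lemma holo_w2 n p q : holo n (reg p q) (w2 p q).
Proof.
rewrite /w2; apply: holoM; first apply: holoM; first apply: holoM.
- exact: holo_cst.
- by apply: holo_theta; exact: regR.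
- by apply: holo_theta; exact: regR.
apply: holoM; first by apply: holo_dtheta; exact: regR.
apply: holoV => [z [_ h]|]; first by rewrite mulf_neq0 ?cexp_neq0.
by apply: holoM; [exact: holo_cst|apply: holo_theta; exact: regR].
Qed.

Lemma holo_w3 n p q : holo n (reg p q) (w3 p q).
Proof.
rewrite /w3; apply: holoM; first apply: holoM; first apply: holoM.
- exact: holo_cst.
- by apply: holo_theta; exact: regR.
- by apply: holo_theta; exact: regR.
apply: holoM; first by apply: holo_dtheta; exact: regR.
exact: holo_thetaV.
Qed.

Lemma holo_Fconf n Lam p q :
  holo n [set mu | 0 < Re mu /\ dtheta p q mu != 0] (Fconf Lam p q).
Proof.
have UR : [set mu | 0 < Re mu /\ dtheta p q mu != 0] `<=` [set z | 0 < Re z] by move=> z [].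
have H : holo n [set mu | 0 < Re mu /\ dtheta p q mu != 0]
    (fun mu => theta p q mu / dtheta p q mu).
  apply: holoM; first exact: holo_theta.
  by apply: holoV => [z []//|]; exact: holo_dtheta.
by apply: holoM (holoM H H); exact: holo_cst.
Qed.

End ThetaDerivatives.

(** * Transformation laws of theta, of the w_j and of F *)

Section ThetaTransformations.
Context {R : realType}.
Implicit Types (p q mu z : R[i]).

Let pii : R[i] := pi%:C * 'i.

Lemma tsum_q1 k p q mu : 0 < Re mu ->
  tsum k p (q + 1) mu = cexp (2 * pi%:C * 'i * p) * tsum k p q mu.
Proof.
move=> mu0; apply: zsums_unique (tsumP k p (q + 1) mu0) _.
apply: eq_zsums (zsumsZ _ (tsumP k p q mu0)) => m.
by rewrite tterm_addq mulr1 mulrDr cexpD cexp_2pii_int mul1r mulrC.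
Qed.

Lemma tsum_p1 k p q mu : 0 < Re mu -> tsum k (p + 1) q mu = tsum k p q mu.
Proof.
move=> mu0; apply: zsums_unique (tsumP k (p + 1) q mu0) _.
have /zsums_shift := tsumP k p q mu0; apply: eq_zsums => m.
by rewrite /tterm /theta_term intrD mulr1z addrAC addrA.
Qed.

Lemma int_pronic (m : int) : exists l : int, m * (m - 1) = 2 * l.
Proof.
have hm := divz_eq m 2; have r0 := @modz_ge0 m 2 isT; have r2 := @ltz_pmod m 2 isT.
move: hm r0 r2; set d := (m %/ 2)%Z; case: (m %% 2)%Z => [[|[|r]]|r] // hm _ _.
  by exists (d * (m - 1)); rewrite {1}hm; ring.
by exists (m * d); rewrite {2}hm; ring.
Qed.

Definition Ashift p : R[i] := cexp (pi%:C * 'i * (p ^+ 2 + p)).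

(** The shift multiplies the m-th term by exp (-pi i (m + p)^2). As m (m - 1) is even, the part
    quadratic in m is a character, absorbed by moving q; the part in p alone is [Ashift p]. *)
Lemma tsum_shift k p q mu : 0 < Re mu ->
  tsum k p q (mu + 'i) = Ashift p * tsum k p (q - p - 1 / 2) mu.
Proof.
move=> mu0; have mui : 0 < Re (mu + 'i) by rewrite ReD /= addr0.
apply: zsums_unique (tsumP k p q mui) _.
apply: eq_zsums (zsumsZ _ (tsumP k p (q - p - 1 / 2) mu0)) => m.
have [l hl] := int_pronic m.
rewrite /tterm mulrCA; congr (_ * _).
rewrite /Ashift /theta_term.
have -> : - pi%:C * (m%:~R + p) ^+ 2 * (mu + 'i) + 2 * pi%:C * 'i * (m%:~R + p) * q =
   (pi%:C * 'i * (p ^+ 2 + p) + (- pi%:C * (m%:~R + p) ^+ 2 * mu +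
     2 * pi%:C * 'i * (m%:~R + p) * (q - p - 1 / 2))) + - (pi%:C * 'i * (m%:~R * (m%:~R - 1))).
  by field.
have hm : m%:~R * (m%:~R - 1) = 2 * l%:~R :> R[i].
  by have := congr1 (fun x : int => x%:~R : R[i]) hl; rewrite intrM intrB intrM.
rewrite hm (_ : - (pi%:C * 'i * (2 * l%:~R)) = 2 * pi%:C * 'i * (- l)%:~R);
  last by rewrite intrN; ring.
by rewrite [RHS]cexpD cexp_2pii_int mulr1 [RHS]cexpD.
Qed.

Lemma tsum_p_sub p q mu h : 0 < Re mu ->
  tsum 0 (p - h) q mu = cexp (- pi%:C * mu * h ^+ 2 - 2 * pi%:C * 'i * h * q) *
    tsum 0 p (q - 'i * mu * h) mu.
Proof.
move=> mu0; apply: zsums_unique (tsumP 0 (p - h) q mu0) _.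
apply: eq_zsums (zsumsZ _ (tsumP 0 p (q - 'i * mu * h) mu0)) => m.
rewrite /tterm !expr0 !mul1r /theta_term -cexpD; congr cexp; ring: (@mulii R).
Qed.

(* Completing the square turns the shift of the first characteristic into one of the second. *)
Lemma tsum1_inversion mu L : 0 < Re mu ->
  (forall p q, theta p q mu^-1 = L * cexp (2 * pi%:C * 'i * p * q) * theta (- q) p mu) ->
  forall p q, dtheta p q mu^-1 =
    - 'i * mu * L * cexp (2 * pi%:C * 'i * p * q) * dtheta (- q) p mu.
Proof.
move=> mu0 HL p q; have nu0 := Re_inv_gt0 mu0.
have h1 := cder_tsum_q 0 p q nu0.
pose E h : R[i] := cexp (- pi%:C * mu * h ^+ 2).
pose c : R[i] := L * cexp (2 * pi%:C * 'i * p * q).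
(* Inversion sends q' to the first characteristic, in which no derivative is available. [tsum_p_sub]
   moves the dependence on q' to the second one. *)
have F q' : tsum 0 p q' mu^-1 =
    c * (E (q' - q) * tsum 0 (- q) (p - 'i * mu * (q' - q)) mu).
  rewrite -thetaE// HL thetaE// (_ : - q' = - q - (q' - q)); last by ring.
  rewrite tsum_p_sub// /c /E; set t := tsum _ _ _ _; clearbody t.
  have e : cexp (2 * pi%:C * 'i * p * q') *
      cexp (- pi%:C * mu * (q' - q) ^+ 2 - 2 * pi%:C * 'i * (q' - q) * p) =
      cexp (2 * pi%:C * 'i * p * q) * cexp (- pi%:C * mu * (q' - q) ^+ 2).
    by rewrite -!cexpD; congr cexp; ring.
  rewrite mulrA -(mulrA L) e; ring.
have d0 : cder (fun q' => q' - q) q (1 - 0) by apply: derB; [exact: cder_id|exact: der_cst].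
(* The exponent is quadratic in q' - q, so this factor does not contribute at q' = q. *)
have dE : cder (fun q' => E (q' - q)) q 0.
  have dd : cder (fun q' => - pi%:C * mu * (q' - q) ^+ 2) q
     (- pi%:C * mu * ((1 - 0) * (q - q) + (q - q) * (1 - 0))).
    by apply: derZ; exact: (derM d0 d0).
  have := der_comp dd (cder_cexp _); by rewrite subrr !(mulr0, mul0r, addr0).
have dT : cder (fun q' => tsum 0 (- q) (p - 'i * mu * (q' - q)) mu) q
    (2 * pi%:C * 'i * tsum 1 (- q) p mu * (0 - 'i * mu * (1 - 0))).
  have := @cder_tsum_q _ 0 (- q) (p - 'i * mu * (q - q)) mu mu0.
  have dl : cder (fun q' => p - 'i * mu * (q' - q)) q (0 - 'i * mu * (1 - 0)).
    by apply: derB; [exact: der_cst|apply: derZ].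
  by move=> H; have := der_comp dl H; rewrite subrr mulr0 subr0.
have h2 := derZ c (derM dE dT).
rewrite subrr mulr0 subr0 mul0r add0r /E expr0n mulr0 cexp0 mul1r in h2.
have h3 : cder (fun q' => tsum 0 p q' mu^-1) q
   (c * (2 * pi%:C * 'i * tsum 1 (- q) p mu * (0 - 'i * mu * (1 - 0)))).
  by apply: eq_der h2 => q'; rewrite F /E.
rewrite !dthetaE// (cder_unique h1 h3) /c; ring.
Qed.

Lemma theta_shift p q mu : 0 < Re mu ->
  theta p q (mu + 'i) = Ashift p * theta p (q - p - 1 / 2) mu.
Proof.
by move=> mu0; rewrite !thetaE ?tsum_shift// ReD /= addr0.
Qed.

Lemma dtheta_shift p q mu : 0 < Re mu ->
  dtheta p q (mu + 'i) = Ashift p * dtheta p (q - p - 1 / 2) mu.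
Proof.
by move=> mu0; rewrite !dthetaE ?tsum_shift//; [ring|rewrite ReD /= addr0].
Qed.

Lemma theta_q1 p q mu : 0 < Re mu ->
  theta p (q + 1) mu = cexp (2 * pi%:C * 'i * p) * theta p q mu.
Proof. by move=> mu0; rewrite !thetaE ?tsum_q1. Qed.

Lemma dtheta_q1 p q mu : 0 < Re mu ->
  dtheta p (q + 1) mu = cexp (2 * pi%:C * 'i * p) * dtheta p q mu.
Proof. by move=> mu0; rewrite !dthetaE// tsum_q1//; ring. Qed.

Lemma theta_p1 p q mu : 0 < Re mu -> theta (p + 1) q mu = theta p q mu.
Proof. by move=> mu0; rewrite !thetaE ?tsum_p1. Qed.

Lemma dtheta_p1 p q mu : 0 < Re mu -> dtheta (p + 1) q mu = dtheta p q mu.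
Proof. by move=> mu0; rewrite !dthetaE// tsum_p1. Qed.

(** The value of [Ashift] at 1/2, the multiplier of theta2 up to sign. *)
Let ic : R[i] := cexp (pi%:C * 'i * (3 / 4)).

Let ic2 : ic * ic = - 'i.
Proof.
rewrite /ic -cexpD.
have -> : pi%:C * 'i * (3 / 4) + pi%:C * 'i * (3 / 4) = pi%:C * 'i + pi%:C * 'i / 2 :> R[i].
  by field.
by rewrite cexpD cexp_pii cexp_pii2 mulN1r.
Qed.

Let Ahalf p : Ashift (p + 1 / 2) = Ashift p * cexp (pi%:C * 'i * p) * ic.
Proof. by rewrite /Ashift /ic -!cexpD; congr cexp; field. Qed.

Let Ashift0 : Ashift 0 = 1.
Proof. by rewrite /Ashift expr0n addr0 mulr0 cexp0. Qed.

Let Ashift_neq0 p : Ashift p != 0. Proof. exact: cexp_neq0. Qed.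

Lemma theta3_shift mu : 0 < Re mu -> theta3 (mu + 'i) = theta4 mu.
Proof.
move=> mu0; rewrite /theta3 theta_shift// Ashift0 mul1r /theta4.
have := @theta_q1 0 (0 - 0 - 1 / 2) mu mu0.
have -> : 0 - 0 - 1 / 2 + 1 = 1 / 2 :> R[i] by field.
by rewrite mulr0 cexp0 (mul1r (theta _ _ _)) => ->.
Qed.

Lemma theta4_shift mu : 0 < Re mu -> theta4 (mu + 'i) = theta3 mu.
Proof.
by move=> mu0; rewrite /theta4 theta_shift// Ashift0 mul1r subr0 subrr.
Qed.

Lemma theta2_shift mu : 0 < Re mu -> theta2 (mu + 'i) = - ic * theta2 mu.
Proof.
move=> mu0; rewrite /theta2 theta_shift//.
have -> : Ashift (1 / 2) = ic.
  by rewrite -[X in Ashift X]add0r Ahalf Ashift0 mulr0 cexp0 !mul1r.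
have := @theta_q1 (1 / 2) (0 - 1 / 2 - 1 / 2) mu mu0.
have -> : 0 - 1 / 2 - 1 / 2 + 1 = 0 :> R[i] by field.
have -> : 2 * pi%:C * 'i * (1 / 2) = pi%:C * 'i :> R[i] by field.
by rewrite cexp_pii => ->; ring.
Qed.

Section Shift.
Variables (p q mu : R[i]).
Hypothesis mu0 : 0 < Re mu.
Let q1 := q + p + 1 / 2.

Let thS : theta p q1 (mu + 'i) = Ashift p * theta p q mu.
Proof.
rewrite theta_shift//; have -> : q1 - p - 1 / 2 = q by rewrite /q1; ring.
by [].
Qed.

Lemma Fconf_shift Lam : Fconf Lam p q1 (mu + 'i) = Fconf Lam p q mu.
Proof.
rewrite /Fconf thS dtheta_shift// (_ : q1 - p - 1 / 2 = q); last by rewrite /q1; ring.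
by rewrite -[_ * theta _ _ _ / _]mulf_div divff// mul1r.
Qed.

Let cp_neq0 : cexp (pi%:C * 'i * p) != 0. Proof. exact: cexp_neq0. Qed.

Lemma w1_shift : w1 p q1 (mu + 'i) = w1 p q mu.
Proof.
rewrite /w1 theta3_shift// theta4_shift// thS dtheta_shift//.
rewrite (_ : q1 + _ - _ - _ = q + 1 / 2); last by rewrite /q1; ring.
move: cp_neq0 (Ashift_neq0 p); move: (cexp (pi%:C * 'i * p)) (Ashift p) => e A e0 A0.
rewrite !invfM; set t := (theta p q mu)^-1; clearbody t; field.
by rewrite e0 A0.
Qed.

(** The additional half in the first characteristic of the numerator of w2 cancels the half in the
    second, which leaves the numerator of w3. *)
Lemma w2_shift : w2 p q1 (mu + 'i) = w3 p q mu.
Proof.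
rewrite /w2 /w3 theta2_shift// theta4_shift// thS dtheta_shift//.
rewrite (_ : q1 + _ - _ - _ = q); last by rewrite /q1; field.
rewrite Ahalf.
move: cp_neq0 (Ashift_neq0 p); move: (cexp (pi%:C * 'i * p)) (Ashift p) => e A e0 A0.
rewrite !invfM; set t := (theta p q mu)^-1; clearbody t.
have i2 := @mulii R; field: ic2 i2.
by rewrite e0 A0.
Qed.

Lemma w3_shift : w3 p q1 (mu + 'i) = w2 p q mu.
Proof.
rewrite /w2 /w3 theta2_shift// theta3_shift// thS dtheta_shift//.
(* Here the second characteristic comes out as q - 1/2, one period away from the one in w2. *)
have -> : q + 1 / 2 = (q1 - (p + 1 / 2) - 1 / 2) + 1 by rewrite /q1; field.
rewrite dtheta_q1//; set dt := dtheta _ _ _.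
have -> : cexp (2 * pi%:C * 'i * (p + 1 / 2)) = - (cexp (pi%:C * 'i * p) * cexp (pi%:C * 'i * p)).
  rewrite (_ : 2 * pi%:C * 'i * (p + 1 / 2) = pi%:C * 'i * p + pi%:C * 'i * p + pi%:C * 'i).
    by rewrite !cexpD cexp_pii mulrN1.
  by field.
rewrite Ahalf.
move: cp_neq0 (Ashift_neq0 p); move: (cexp (pi%:C * 'i * p)) (Ashift p) => e A e0 A0.
rewrite !invfM; set t := (theta p q mu)^-1; clearbody t dt.
have i2 := @mulii R; field: ic2 i2.
by rewrite e0 A0.
Qed.

End Shift.

Section Inversion.
Variables (p q mu : R[i]).
Hypothesis mu0 : 0 < Re mu.

Let mun : mu != 0 := Re_gt0_neq0 mu0.

Lemma Fconf_inversion Lam : Fconf Lam p q mu^-1 = - mu ^- 2 * Fconf Lam (- q) p mu.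
Proof.
have [L L2 HL] := theta_inversion mu0; have dL := tsum1_inversion mu0 HL.
have L0 : L != 0 by apply: contra_neq mun => h; rewrite -L2 h expr0n.
rewrite /Fconf HL dL; set e := cexp _; have e0 : e != 0 by exact: cexp_neq0.
clearbody e.
have i0 : 'i != 0 :> R[i] by rewrite -nrm_gt0 nrm_i.
set k := 2 / _; clearbody k; rewrite !invfM invrN.
have -> : 'i^-1 = - 'i :> R[i].
  by apply: (mulfI i0); rewrite divff// mulrN mulii opprK.
set t := (dtheta _ _ _)^-1; clearbody t.
have i2 := @mulii R; field: i2.
by rewrite mun L0 e0.
Qed.

Let cq_neq0 : cexp (pi%:C * 'i * q) != 0. Proof. exact: cexp_neq0. Qed.
Let cp_neq0 : cexp (pi%:C * 'i * p) != 0. Proof. exact: cexp_neq0. Qed.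

Section FixedRoot.
Variable L : R[i].
Hypothesis L2 : L ^+ 2 = mu.
Hypothesis HL : forall p q,
  theta p q mu^-1 = L * cexp (2 * pi%:C * 'i * p * q) * theta (- q) p mu.

Let L0 : L != 0. Proof. by apply: contra_neq mun => h; rewrite -L2 h expr0n. Qed.

Let t3 : theta3 mu^-1 = L * theta3 mu.
Proof. by rewrite /theta3 HL mulr0 cexp0 mulr1 oppr0. Qed.

(** The first characteristic has period 1, so a half characteristic changes sign freely. *)
Let neg_half a b : theta (- (a + 1 / 2)) b mu = theta (- a + 1 / 2) b mu.
Proof.
have -> : - a + 1 / 2 = - (a + 1 / 2) + 1 by field.
by rewrite [RHS]theta_p1.
Qed.

Let dneg_half a b : dtheta (- (a + 1 / 2)) b mu = dtheta (- a + 1 / 2) b mu.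
Proof.
have -> : - a + 1 / 2 = - (a + 1 / 2) + 1 by field.
by rewrite [RHS]dtheta_p1.
Qed.

Let t4 : theta4 mu^-1 = L * theta2 mu.
Proof.
have := neg_half 0 0; rewrite oppr0 !add0r => h.
by rewrite /theta4 HL mulr0 mul0r cexp0 mulr1 h.
Qed.

Let t2 : theta2 mu^-1 = L * theta4 mu.
Proof. by rewrite /theta2 HL mulr0 cexp0 mulr1 oppr0. Qed.

Let dL := tsum1_inversion mu0 HL.

Let iV : 'i^-1 = - 'i :> R[i].
Proof.
have i0 : 'i != 0 :> R[i] by rewrite -nrm_gt0 nrm_i.
by apply: (mulfI i0); rewrite divff// mulrN mulii opprK.
Qed.

(** Splits the inversion multipliers into independent exponentials that [field] treats as atoms. *)
Let ep (a b c d e : R[i]) : 2 * a * b = c + d + e ->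
  cexp (2 * pi%:C * 'i * a * b) = cexp (pi%:C * 'i * c) * cexp (pi%:C * 'i * d) * cexp (pi%:C * 'i * e).
Proof.
by move=> h; rewrite -!cexpD; congr cexp; rewrite -!mulrDr -h; ring.
Qed.

Lemma w1_inversion_aux : w1 p q mu^-1 = mu ^+ 2 * w3 (- q) p mu.
Proof.
rewrite /w1 /w3 t3 t4 HL dL dneg_half.
rewrite (@ep p (q + 1 / 2) (2 * p * q) p 0); last by field.
rewrite (@ep p q (2 * p * q) 0 0); last by field.
rewrite !mulr0 cexp0.
have e0 : cexp (pi%:C * 'i * (2 * p * q)) != 0 by exact: cexp_neq0.
move: cp_neq0 e0; move: (cexp _) (cexp _) => a b a0 b0.
move: (theta (- q) p mu) => th; rewrite !invfM; move: th^-1 => t.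
have i2 := @mulii R; field: L2 i2.
by rewrite a0 b0 L0.
Qed.

Lemma w2_inversion_aux : w2 p q mu^-1 = mu ^+ 2 * w2 (- q) p mu.
Proof.
rewrite /w2 t2 t4 HL dL dneg_half.
rewrite (@ep (p + 1 / 2) (q + 1 / 2) (2 * p * q) (p + q) (1 / 2)); last by field.
rewrite (@ep p q (2 * p * q) 0 0); last by field.
have -> : pi%:C * 'i * (1 / 2) = pi%:C * 'i / 2 :> R[i] by field.
rewrite cexp_pii2 complexiE !mulr0 cexp0 mulrDr cexpD mulrN cexpN.
have e0 : cexp (pi%:C * 'i * (2 * p * q)) != 0 by exact: cexp_neq0.
move: cp_neq0 cq_neq0 e0.
move: (cexp (pi%:C * 'i * p)) (cexp (pi%:C * 'i * q)) (cexp (pi%:C * 'i * (2 * p * q))) => a b c a0 b0 c0.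
move: (theta (- q) p mu) => th; rewrite !invfM !invrK; move: th^-1 => t.
have i2 := @mulii R; field: L2 i2.
by rewrite a0 c0 L0.
Qed.

Lemma w3_inversion_aux : w3 p q mu^-1 = - mu ^+ 2 * w1 (- q) p mu.
Proof.
rewrite /w3 /w1 t2 t3 HL dL.
rewrite (@ep (p + 1 / 2) q (2 * p * q) q 0); last by field.
rewrite (@ep p q (2 * p * q) 0 0); last by field.
rewrite !mulr0 cexp0 mulrN cexpN.
have e0 : cexp (pi%:C * 'i * (2 * p * q)) != 0 by exact: cexp_neq0.
move: cq_neq0 e0.
move: (cexp (pi%:C * 'i * q)) (cexp (pi%:C * 'i * (2 * p * q))) => b c b0 c0.
move: (theta (- q) p mu) => th; rewrite !invfM !invrK; move: th^-1 => t.
have i2 := @mulii R; field: L2 i2.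
by rewrite c0 L0.
Qed.

End FixedRoot.

Lemma w1_inversion : w1 p q mu^-1 = mu ^+ 2 * w3 (- q) p mu.
Proof. by have [L L2 HL] := theta_inversion mu0; exact: w1_inversion_aux L2 HL. Qed.

Lemma w2_inversion : w2 p q mu^-1 = mu ^+ 2 * w2 (- q) p mu.
Proof. by have [L L2 HL] := theta_inversion mu0; exact: w2_inversion_aux L2 HL. Qed.

Lemma w3_inversion : w3 p q mu^-1 = - mu ^+ 2 * w1 (- q) p mu.
Proof. by have [L L2 HL] := theta_inversion mu0; exact: w3_inversion_aux L2 HL. Qed.

End Inversion.

End ThetaTransformations.

(** * Real and directional derivatives *)

Section RealCalculus.
Context {R : realType}.

Lemma is_deriveP (V : normedModType R) (f : V -> R) (x v : V) (l : R) :
  is_derive x v f l <-> forall e : R, 0 < e -> exists2 d, 0 < d &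
    forall s, `|s| <= d -> `|f (x + s *: v) - f x - s * l| <= e * `|s|.
Proof.
have E (m s : R) : s != 0 -> `|m - s^-1 *: (f (s *: v + x) - f x)| * `|s| =
    `|f (x + s *: v) - f x - s * m|.
  move=> s0; rewrite -normrM distrC (addrC (s *: v)).
  by congr `|_|; rewrite -[_ *: (_ - _)]/(s^-1 * _); field.
split.
  move=> [dv <-] e e0; move: dv; rewrite /derivable => /cvg_ex[l' hl'].
  have ll : 'D_v f x = l' by apply: (cvg_lim _ hl'); exact: norm_hausdorff.
  move/cvgrPdist_le : hl' => /(_ _ e0); rewrite -ll => /nbhs_ballP[d /= d0 hd].
  exists (d / 2) => [|s sd]; first by rewrite divr_gt0.
  have [->|s0] := eqVneq s 0.
    by rewrite scale0r addr0 subrr mul0r subrr normr0 mulr0.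
  have := hd s; rewrite -ball_normE /ball_ /= sub0r normrN => /(_ _ s0) h.
  have {h} h : `|'D_v f x - s^-1 *: (f (s *: v + x) - f x)| <= e.
    by apply: h; apply: le_lt_trans sd _; lra.
  by rewrite -(ler_pM2r (_ : 0 < `|s|)) ?normr_gt0// E// in h.
move=> H.
have C : (fun s => s^-1 *: ((f \o shift x) (s *: v) - f x)) @ 0^' --> l.
  apply/cvgrPdist_le => e e0; have [d d0 hd] := H e e0.
  near=> s.
  have s0 : s != 0 by near: s; exact: nbhs_dnbhs_neq.
  have sd : `|s| <= d by apply: ltW; near: s; exact: dnbhs0_lt.
  rewrite /= -(ler_pM2r (_ : 0 < `|s|)) ?normr_gt0//.
  by rewrite E// hd.
apply: DeriveDef; first by apply/cvg_ex; exists l.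
by rewrite /derive; apply: cvg_lim C; exact: norm_hausdorff.
Unshelve. all: by end_near. Qed.

Lemma continuousP (V : normedModType R) (f : V -> R) (x : V) :
  {for x, continuous f} <-> forall e : R, 0 < e -> exists2 d, 0 < d &
    forall y, `|y - x| < d -> `|f y - f x| <= e.
Proof.
split=> [/cvgrPdist_le H e /H /nbhs_ballP[d /= d0 hd]|H].
  exists d => // y yd; rewrite distrC; apply: hd.
  by rewrite -ball_normE /ball_ /= distrC.
apply/cvgrPdist_le => e e0; have [d d0 hd] := H e e0.
apply/nbhs_ballP; exists d => //= y.
by rewrite -ball_normE /ball_ /= distrC => /hd; rewrite distrC.
Qed.

Let Re_rem (X Y l : R[i]) (s : R) : Re (X - Y - l * s%:C) = Re X - Re Y - Re l * s.
Proof. by rewrite !(ReD, ReN) ReM /=; ring. Qed.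

Let Im_rem (X Y l : R[i]) (s : R) : Im (X - Y - l * s%:C) = Im X - Im Y - Im l * s.
Proof. by rewrite !(ImD, ImN) ImM /=; ring. Qed.

Lemma rderP (f : R -> R[i]) (t : R) l :
  rder f t l <-> is_derive t 1 (fun s => Re (f s)) (Re l) /\
                 is_derive t 1 (fun s => Im (f s)) (Im l).
Proof.
have E s : nrm (s%:C : R[i]) = `|s| by exact: nrm_real.
have s1 (s : R) : s *: (1 : R) = s by rewrite /GRing.scale /= mulr1.
split=> [H|[/is_deriveP H1 /is_deriveP H2] e e0].
  split; apply/is_deriveP => e e0; have [d d0 hd] := H e e0; exists d => // s sd;
    have hs : nrm (s%:C : R[i]) <= d -> nrm (f (t + s) - f t - l * s%:C) <= e * nrm (s%:C : R[i]) := hd s;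
    move: hs; rewrite E s1 => /(_ sd); rewrite [s * _]mulrC.
    by apply: le_trans; apply: le_trans (normr_Re _); rewrite Re_rem.
  by apply: le_trans; apply: le_trans (normr_Im _); rewrite Im_rem.
have e20 : 0 < e / 2 by rewrite divr_gt0.
have [d1 d10 h1] := H1 _ e20; have [d2 d20 h2] := H2 _ e20.
exists (Num.min d1 d2) => [|s]; first by rewrite lt_min d10.
rewrite E le_min => /andP[/h1 k1 /h2 k2]; rewrite s1 in k1 k2.
rewrite -[_ - l * _]/(f (t + s) - f t - l * s%:C).
apply: le_trans (nrm_le_ReIm _) _.
rewrite Re_rem Im_rem ![_ * s]mulrC; lra.
Qed.

Lemma rder_rderive1 (f : R -> R[i]) (t : R) l : rder f t l -> rderive1 f t = l.
Proof.
move=> /rderP[[_ h1] [_ h2]]; rewrite /rderive1 !derive1E h1 h2.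
by case: l {h1 h2}.
Qed.

Lemma rder_near (f g : R -> R[i]) (t : R) l (a b : R) : t \in `]a, b[ ->
  (forall s, s \in `]a, b[ -> f s = g s) -> rder f t l -> rder g t l.
Proof.
rewrite in_itv /= => /andP[ta tb] fg.
have d0 : 0 < Num.min ((t - a) / 2) ((b - t) / 2).
  by rewrite lt_min !divr_gt0// subr_gt0.
apply: (der_near d0) => s; rewrite nrm_real le_min !ler_norml => /andP[/andP[h1 _] /andP[_ h2]].
by rewrite !fg// in_itv /= ?ta ?tb//; apply/andP; split; lra.
Qed.

Lemma rder_unique (f : R -> R[i]) (t : R) l m : rder f t l -> rder f t m -> l = m.
Proof. by move=> /rder_rderive1 <- /rder_rderive1. Qed.

End RealCalculus.

(** * Stability of [Ck_on] on an open set *)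

Section CkFunctions.
Context {R : realType} {V : normedModType R}.
Variable A : set V.
Hypothesis Aopen : open A.
Implicit Types (f g : V -> R) (k : nat).

Lemma CkS k f : Ck_on A k.+1 f -> Ck_on A k f.
Proof.
elim: k f => [|k IH] f; first by case.
move=> [fc H]; split=> // v; have [dv Hv] := H v; split=> //; exact: IH.
Qed.

Lemma Ck_derive k f v : Ck_on A k.+1 f -> Ck_on A k (fun x => 'D_v f x).
Proof. by move=> [_ /(_ v)[]]. Qed.

Lemma Ck_derivable k f v x : Ck_on A k.+1 f -> A x -> derivable f x v.
Proof. by move=> [_ /(_ v)[h _]]; exact: h. Qed.

Lemma Ck_cont k f x : Ck_on A k f -> A x -> {for x, continuous f}.
Proof. by case: k => [|k] [h _]; exact: h. Qed.

Let near_eq_on f g x : A x -> (forall y, A y -> f y = g y) -> \forall y \near x, f y = g y.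
Proof.
move=> Ax fg; have : nbhs x A by exact: open_nbhs_nbhs.
by apply: filterS => y; exact: fg.
Qed.

Let cont_eq f g x : A x -> (forall y, A y -> f y = g y) ->
  {for x, continuous f} -> {for x, continuous g}.
Proof.
move=> Ax fg; rewrite /prop_for /continuous_at (fg x Ax) => h; apply: cvg_trans h.
by apply: near_eq_cvg; apply: filterS (near_eq_on Ax fg).
Qed.

Lemma eq_Ck k f g : (forall x, A x -> f x = g x) -> Ck_on A k f -> Ck_on A k g.
Proof.
elim: k f g => [|k IH] f g fg [fc H].
  by split=> // x Ax; exact: cont_eq (fc x Ax).
split=> [x Ax|v]; first exact: cont_eq (fc x Ax).
have [dv Hv] := H v; split=> [x Ax|].
  have [->|v0] := eqVneq v 0; first exact: derivable0.
  by apply: near_eq_derivable (dv x Ax) => //; exact: near_eq_on.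
apply: IH Hv => x Ax.
have [->|v0] := eqVneq v 0; first by rewrite !derive0.
by apply: near_eq_derive => //; exact: near_eq_on.
Qed.

Lemma Ck_cst k c : Ck_on A k (fun=> c).
Proof.
elim: k c => [|k IH] c; (split=> [x _|]; first exact: cst_continuous) => // v.
split=> [x _|]; first exact: derivable_cst.
by apply: eq_Ck (IH 0) => x _; rewrite derive_cst.
Qed.

Lemma CkD k f g : Ck_on A k f -> Ck_on A k g -> Ck_on A k (fun x => f x + g x).
Proof.
elim: k f g => [|k IH] f g [fc Hf] [gc Hg].
  by split=> // x Ax; apply: continuousD; [exact: fc|exact: gc].
split=> [x Ax|v]; first by apply: continuousD; [exact: fc|exact: gc].
have [df Df] := Hf v; have [dg Dg] := Hg v; split=> [x Ax|].
  by apply: derivableD; [exact: df|exact: dg].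
by apply: eq_Ck (IH _ _ Df Dg) => x Ax; rewrite -deriveD//; [exact: df|exact: dg].
Qed.

Lemma CkM k f g : Ck_on A k f -> Ck_on A k g -> Ck_on A k (fun x => f x * g x).
Proof.
elim: k f g => [|k IH] f g Hf Hg.
  by split=> // x Ax; apply: continuousM; [exact: Ck_cont Hf Ax|exact: Ck_cont Hg Ax].
split=> [x Ax|v].
  by apply: continuousM; [exact: Ck_cont Hf Ax|exact: Ck_cont Hg Ax].
split=> [x Ax|].
  by apply: derivableM; [exact: Ck_derivable Hf Ax|exact: Ck_derivable Hg Ax].
have h1 := IH _ _ (CkS Hf) (Ck_derive v Hg).
have h2 := IH _ _ (CkS Hg) (Ck_derive v Hf).
apply: eq_Ck (CkD h1 h2) => x Ax.
by rewrite deriveM; [|exact: Ck_derivable Hf Ax|exact: Ck_derivable Hg Ax].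
Qed.

End CkFunctions.

(** * Composition with affine maps *)

Section CkComposition.
Context {R : realType} {V W : normedModType R}.

(** The two difference quotients are the same function, so no chain rule is involved. *)
Lemma derive_affine (phi : V -> W) (Lam : V -> W) (f : W -> R) (x v : V) :
  (forall x (s : R) v, phi (s *: v + x) = s *: Lam v + phi x) ->
  (derivable f (phi x) (Lam v) -> derivable (fun y => f (phi y)) x v) /\
  'D_v (fun y => f (phi y)) x = 'D_(Lam v) f (phi x).
Proof.
move=> H.
have E : (fun s : R => s^-1 *: (((fun y => f (phi y)) \o shift x) (s *: v) - f (phi x))) =
    (fun s : R => s^-1 *: ((f \o shift (phi x)) (s *: Lam v) - f (phi x))).
  by apply/funext => s /=; rewrite H.
by rewrite /derivable /derive E.
Qed.

Lemma Ck_affine (A : set V) (B : set W) (phi : V -> W) (Lam : V -> W) k (f : W -> R) :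
  (forall x (s : R) v, phi (s *: v + x) = s *: Lam v + phi x) ->
  continuous phi -> (forall x, A x -> B (phi x)) ->
  Ck_on B k f -> Ck_on A k (fun x => f (phi x)).
Proof.
move=> H phic AB; elim: k f => [|k IH] f [fc Hf].
  by split=> // x Ax; exact: (@continuous_comp _ _ _ phi f x (phic x) (fc _ (AB _ Ax))).
split=> [x Ax|v].
  by exact: (@continuous_comp _ _ _ phi f x (phic x) (fc _ (AB _ Ax))).
have [df Df] := Hf (Lam v); split=> [x Ax|].
  by have [h _] := derive_affine f x v H; apply: h; apply: df; exact: AB.
rewrite (_ : (fun x => _) = (fun x => 'D_(Lam v) f (phi x))); first exact: (IH _ Df).
by apply/funext => x; have [_ ->] := derive_affine f x v H.
Qed.

End CkComposition.

(** * Mean value theorem and uniform radii *)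

Section MeanValue.
Context {R : realType}.

Lemma MVT_sym (g dg : R -> R) (a : R) :
  (forall s : R, `|s| <= `|a| -> is_derive s 1 g (dg s)) ->
  exists2 c, `|c| <= `|a| & g a - g 0 = dg c * a.
Proof.
move=> H; have [a0|a0] := leP 0 a.
  have S s : s \in `[0, a] -> `|s| <= `|a|.
    by rewrite in_itv /= => /andP[s0 sa]; rewrite !ger0_norm.
  have [||c cb E] := @MVT_segment _ g dg _ _ a0.
  - move=> x; rewrite in_itv /= => /andP[/ltW x0 /ltW x1]; apply: H; apply: S.
    by rewrite in_itv /= x0.
  - by apply: derivable_within_continuous => x /S /H[].
  by exists c; [exact: S|rewrite E subr0].
have S s : s \in `[a, 0] -> `|s| <= `|a|.
  by rewrite in_itv /= => /andP[sa s0]; rewrite !ler0_norm ?lerN2// ltW.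
have [||c cb E] := @MVT_segment _ g dg _ _ (ltW a0).
- move=> x; rewrite in_itv /= => /andP[/ltW x0 /ltW x1]; apply: H; apply: S.
  by rewrite in_itv /= x0.
- by apply: derivable_within_continuous => x /S /H[].
exists c; first exact: S.
by apply: oppr_inj; rewrite opprB E sub0r mulrN.
Qed.

Lemma unif_delta (n : nat) (P : nat -> R -> Prop) :
  (forall i, (i < n)%N -> exists2 d : R, 0 < d & forall h, `|h| <= d -> P i h) ->
  exists2 d : R, 0 < d & forall h, `|h| <= d -> forall i, (i < n)%N -> P i h.
Proof.
elim: n => [|n IH] H; first by exists 1.
have [d d0 hd] := IH (fun i ni => H i (leqW ni)).
have [d' d'0 hd'] := H n (ltnSn n).
exists (Num.min d d') => [|h]; first by rewrite lt_min d0.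
rewrite le_min => /andP[/hd h1 /hd' h2] i.
by rewrite ltnS leq_eqVlt => /orP[/eqP ->//|]; exact: h1.
Qed.

End MeanValue.

Lemma scale_one {R : realType} (s : R) : s *: (1 : R) = s.
Proof. by rewrite /GRing.scale /= mulr1. Qed.

(** * From directional derivatives to linear approximation *)

Section C1Linearization.
Context {R : realType} {V : normedModType R}.
Variable A : set V.
Hypothesis Aopen : open A.

(** [Ck_on] speaks of one direction at a time. Continuity of the directional derivatives gives a
    joint expansion: the directions are added one by one, each by the mean value theorem. *)
Lemma C1_lin (f : V -> R) (x : V) (e : nat -> V) n : Ck_on A 1 f -> A x ->
  forall ep : R, 0 < ep -> exists2 d : R, 0 < d & forall a : nat -> R,
    (forall i, (i < n)%N -> `|a i| <= d) ->
    `|f (x + \sum_(i < n) a i *: e i) - f x - \sum_(i < n) a i * 'D_(e i) f x|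
    <= ep * \sum_(i < n) `|a i|.
Proof.
move=> Hf Ax; elim: n => [|n IH] ep ep0.
  by exists 1 => // a _; rewrite !big_ord0 addr0 subrr subr0 normr0 mulr0.
have [d d0 hd] := IH ep ep0.
have Dc : {for x, continuous (fun y => 'D_(e n) f y)} := Ck_cont (Ck_derive (e n) Hf) Ax.
have /continuousP/(_ _ ep0)[d1 d10 hd1] := Dc.
have : nbhs x A by exact: open_nbhs_nbhs.
move=> /nbhs_ballP[d2 /= d20 hd2].
pose S := \sum_(i < n.+1) `|e i|.
have S0 : 0 <= S by exact: sumr_ge0.
(* Small enough for all intermediate points to stay in A and where the derivative along the new
   direction varies by at most ep. *)
pose d3 := Num.min d (Num.min d1 d2 / (S + 1)).
have m0 : 0 < Num.min d1 d2 by rewrite lt_min d10.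
exists d3 => [|a ha]; first by rewrite lt_min d0 divr_gt0// ltr_wpDl.
have had i : (i < n)%N -> `|a i| <= d.
  by move=> ni; apply: le_trans (ha i (leqW ni)) _; rewrite /d3 ge_min lexx.
have {}hd := hd a had.
rewrite !big_ord_recr /=.
set P := \sum_(i < n) a i *: e i in hd *.
have close c : `|c| <= `|a n| -> `|x + P + c *: e n - x| < Num.min d1 d2.
  move=> ca; rewrite -(addrA x) addrAC subrr add0r.
  apply: le_lt_trans (ler_normD _ _) _.
  have h1 : `|P| <= d3 * \sum_(i < n) `|e i|.
    apply: le_trans (ler_norm_sum _ _ _) _; rewrite mulr_sumr.
    by apply: ler_sum => i _; rewrite normrZ ler_wpM2r// ha// leqW.
  have h2 : `|c *: e n| <= d3 * `|e n|.
    by rewrite normrZ ler_wpM2r//; apply: le_trans ca _; exact: ha.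
  apply: (@le_lt_trans _ _ (d3 * S)).
    by rewrite /S big_ord_recr /= mulrDr lerD.
  have h3 : d3 <= Num.min d1 d2 / (S + 1) by rewrite /d3 ge_min lexx orbT.
  apply: (@le_lt_trans _ _ (Num.min d1 d2 / (S + 1) * S)).
    by rewrite ler_wpM2r.
  by rewrite mulrAC ltr_pdivrMr ?ltr_wpDl// ltr_pM2l//; lra.
have inA c : `|c| <= `|a n| -> A (x + P + c *: e n).
  move=> /close h; apply: hd2; rewrite -ball_normE /ball_ /= distrC.
  by apply: lt_le_trans h _; rewrite ge_min lexx orbT.
have [c ca E] : exists2 c, `|c| <= `|a n| &
    f (x + P + a n *: e n) - f (x + P + 0 *: e n) = 'D_(e n) f (x + P + c *: e n) * a n.
  apply: (@MVT_sym _ (fun s => f (x + P + s *: e n)) (fun s => 'D_(e n) f (x + P + s *: e n))).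
  move=> s sa.
  have aff (y t v : R) : x + P + (t *: v + y) *: e n = t *: (v *: e n) + (x + P + y *: e n).
    by rewrite scalerDl scalerA addrCA.
  have [h1 h2] := derive_affine f s 1 aff.
  rewrite scale1r in h1 h2; apply: DeriveDef => //.
  by apply: h1; apply: (Ck_derivable (k := 0)) Hf _; exact: inA.
rewrite scale0r addr0 in E.
have h1 : `|'D_(e n) f (x + P + c *: e n) - 'D_(e n) f x| <= ep.
  by apply: hd1; apply: lt_le_trans (close c ca) _; rewrite ge_min lexx.
rewrite addrA.
rewrite (_ : _ - _ = (f (x + P) - f x - \sum_(i < n) a i * 'D_(e i) f x) +
   ('D_(e n) f (x + P + c *: e n) - 'D_(e n) f x) * a n); last first.
  by rewrite mulrBl -E; ring.
apply: le_trans (ler_normD _ _) _; rewrite mulrDr lerD// normrM ler_wpM2r//.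
Qed.

Definition cCk k (F : V -> R[i]) :=
  Ck_on A k (fun x => Re (F x)) /\ Ck_on A k (fun x => Im (F x)).

Definition cD (v : V) (F : V -> R[i]) (x : V) : R[i] :=
  'D_v (fun y => Re (F y)) x +i* 'D_v (fun y => Im (F y)) x.

Lemma cCkS k F : cCk k.+1 F -> cCk k F.
Proof. by move=> [h1 h2]; split; exact: CkS. Qed.

Lemma eq_cCk k F G : (forall x, A x -> F x = G x) -> cCk k F -> cCk k G.
Proof.
by move=> FG [h1 h2]; split; [apply: eq_Ck h1|apply: eq_Ck h2] => // x Ax; rewrite FG.
Qed.

Lemma cCk_cst k c : cCk k (fun=> c).
Proof. by split; exact: Ck_cst. Qed.

Lemma cCkD k F G : cCk k F -> cCk k G -> cCk k (fun x => F x + G x).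
Proof.
move=> [h1 h2] [k1 k2]; split.
  by apply: eq_Ck (CkD Aopen h1 k1) => // x _; rewrite ReD.
by apply: eq_Ck (CkD Aopen h2 k2) => // x _; rewrite ImD.
Qed.

Lemma cCkM k F G : cCk k F -> cCk k G -> cCk k (fun x => F x * G x).
Proof.
move=> [h1 h2] [k1 k2].
have n1 := CkM Aopen (Ck_cst Aopen k (-1)) (CkM Aopen h2 k2).
split.
  by apply: eq_Ck (CkD Aopen (CkM Aopen h1 k1) n1) => // x _; rewrite ReM mulN1r.
by apply: eq_Ck (CkD Aopen (CkM Aopen h1 k2) (CkM Aopen h2 k1)) => // x _; rewrite ImM.
Qed.

Lemma cCk_sum k n (F : 'I_n -> V -> R[i]) : (forall i, cCk k (F i)) ->
  cCk k (fun x => \sum_i F i x).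
Proof.
elim: n F => [|n IH] F H.
  by apply: eq_cCk (cCk_cst k 0) => x _; rewrite big_ord0.
apply: eq_cCk (cCkD (IH _ (fun i => H (widen_ord (leqnSn n) i))) (H ord_max)) => x _.
by rewrite big_ord_recr.
Qed.

Lemma cCk_derive k F v : cCk k.+1 F -> cCk k (cD v F).
Proof. by move=> [h1 h2]; split; exact: Ck_derive. Qed.

Lemma rder_line F (x v : V) l : rder (fun s => F (x + s *: v)) 0 l <->
  is_derive x v (fun y => Re (F y)) (Re l) /\ is_derive x v (fun y => Im (F y)) (Im l).
Proof.
have E (f : V -> R) m : is_derive (0 : R) (1 : R) (fun s => f (x + s *: v)) m <-> is_derive x v f m.
  split=> /is_deriveP H; apply/is_deriveP => e e0; have [d d0 hd] := H e e0; exists d => // s sd;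
    by have := hd s sd; rewrite ?(scale0r, addr0, add0r, scale_one)//.
have E1 := E (fun y => Re (F y)) (Re l); have E2 := E (fun y => Im (F y)) (Im l).
split=> [/rderP[h1 h2]|[h1 h2]]; first by split; [exact/E1|exact/E2].
by apply/rderP; split; [exact/E1|exact/E2].
Qed.

Lemma rder_cD F x v : cCk 1 F -> A x -> rder (fun s => F (x + s *: v)) 0 (cD v F x).
Proof.
move=> [h1 h2] Ax; apply/rder_line; split; apply: DeriveDef => //.
  exact: Ck_derivable h1 Ax.
exact: Ck_derivable h2 Ax.
Qed.

Lemma cD_rder F x v l : rder (fun s => F (x + s *: v)) 0 l -> cD v F x = l.
Proof. by move=> /rder_line[[_ h1] [_ h2]]; rewrite /cD h1 h2; case: l {h1 h2}. Qed.

Lemma cDD F G x v : cCk 1 F -> cCk 1 G -> A x ->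
  cD v (fun y => F y + G y) x = cD v F x + cD v G x.
Proof.
by move=> hF hG Ax; apply: cD_rder; apply: derD; apply: rder_cD.
Qed.

Lemma cDZ c F x v : cCk 1 F -> A x -> cD v (fun y => c * F y) x = c * cD v F x.
Proof. by move=> hF Ax; apply: cD_rder; apply: derZ; apply: rder_cD. Qed.

Lemma cD_sum n (F : 'I_n -> V -> R[i]) x v : (forall i, cCk 1 (F i)) -> A x ->
  cD v (fun y => \sum_i F i y) x = \sum_i cD v (F i) x.
Proof.
move=> H Ax; elim: n F H => [|n IH] F H.
  rewrite big_ord0; apply: cD_rder; apply: eq_der (der_cst _ 0 0) => s.
  by rewrite big_ord0.
rewrite big_ord_recr /= -IH// -cDD//; last exact: cCk_sum.
by congr cD; apply/funext => y; rewrite big_ord_recr.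
Qed.

Lemma cC1_lin (F : V -> R[i]) (x : V) (e : nat -> V) n : cCk 1 F -> A x ->
  forall ep : R, 0 < ep -> exists2 d : R, 0 < d & forall a : nat -> R,
    (forall i, (i < n)%N -> `|a i| <= d) ->
    nrm (F (x + \sum_(i < n) a i *: e i) - F x - \sum_(i < n) (a i)%:C * cD (e i) F x)
    <= ep * \sum_(i < n) `|a i|.
Proof.
move=> [h1 h2] Ax ep ep0; have e20 : 0 < ep / 2 by rewrite divr_gt0.
have [d d0 hd] := C1_lin e n h1 Ax e20; have [d' d'0 hd'] := C1_lin e n h2 Ax e20.
exists (Num.min d d') => [|a ha]; first by rewrite lt_min d0.
have m1 : Num.min d d' <= d by rewrite ge_min lexx.
have m2 : Num.min d d' <= d' by rewrite ge_min lexx orbT.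
have k1 := hd a (fun i ni => le_trans (ha i ni) m1).
have k2 := hd' a (fun i ni => le_trans (ha i ni) m2).
apply: le_trans (nrm_le_ReIm _) _.
rewrite !(ReD, ReN, ImD, ImN) Re_sum Im_sum.
have E1 : \sum_(i < n) Re ((a i)%:C * cD (e i) F x) = \sum_(i < n) a i * 'D_(e i) (fun y => Re (F y)) x.
  by apply: eq_bigr => i _; rewrite ReM /= mul0r subr0.
have E2 : \sum_(i < n) Im ((a i)%:C * cD (e i) F x) = \sum_(i < n) a i * 'D_(e i) (fun y => Im (F y)) x.
  by apply: eq_bigr => i _; rewrite ImM /= mul0r addr0.
rewrite E1 E2; lra.
Qed.

Lemma cC1_chain (F : V -> R[i]) (x : V) (e : nat -> V) n (c : nat -> R -> R) (c' : nat -> R)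
    (s0 : R) : cCk 1 F -> A x -> (forall i, (i < n)%N -> is_derive s0 1 (c i) (c' i)) ->
  rder (fun s => F (x + \sum_(i < n) (c i s - c i s0) *: e i)) s0
    (\sum_(i < n) (c' i)%:C * cD (e i) F x).
Proof.
move=> hF Ax hc.
pose C := \sum_(i < n) (`|c' i| + 1) + \sum_(i < n) nrm (cD (e i) F x).
have C0 : 0 <= C.
  by apply: addr_ge0; apply: sumr_ge0 => i _; rewrite ?nrm_ge0// addr_ge0.
apply: (der_scale C0) => ep0 ep00; pose ep := Num.min ep0 1.
have epp : 0 < ep by rewrite lt_min ep00 ltr01.
have ep1 : ep <= 1 by rewrite ge_min lexx orbT.
have epe : ep <= ep0 by rewrite ge_min lexx.
clearbody ep.
have [d d0 hd] := cC1_lin e n hF Ax epp.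
have [d1 d10 hd1] : exists2 d : R, 0 < d & forall h, `|h| <= d -> forall i, (i < n)%N ->
    `|c i (s0 + h) - c i s0 - h * c' i| <= ep * `|h|.
  apply: unif_delta => i /hc /is_deriveP /(_ _ epp)[d' d'0 hd']; exists d' => // h hh.
  by have := hd' h hh; rewrite scale_one.
pose M := \sum_(i < n) (`|c' i| + 1) + 1.
have M0 : 0 < M by rewrite ltr_wpDl// sumr_ge0// => i _; rewrite addr_ge0.
exists (Num.min d1 (d / M)) => [|h]; first by rewrite lt_min d10 divr_gt0.
rewrite nrm_real le_min => /andP[/hd1 h1 h2].
pose a i := c i (s0 + h) - c i s0.
have ai i : (i < n)%N -> `|a i| <= (`|c' i| + 1) * `|h|.
  move=> /h1 h3; rewrite /a -[_ - _](subrK (h * c' i)).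
  apply: le_trans (ler_normD _ _) _; rewrite normrM.
  have : ep * `|h| <= 1 * `|h| by rewrite ler_wpM2r.
  lra.
have had i : (i < n)%N -> `|a i| <= d.
  move=> ni; apply: le_trans (ai i ni) _.
  move: h2; rewrite ler_pdivlMr// => h2; apply: le_trans h2; rewrite mulrC ler_wpM2l//.
  rewrite /M (bigD1 (Ordinal ni)) //=; set T := \sum_(_ < _ | _) _.
  suff : 0 <= T by lra.
  by apply: sumr_ge0 => j _; rewrite addr_ge0.
have {}hd := hd a had.
rewrite [X in F (x + X) - _ - _](_ : _ = \sum_(i < n) a i *: e i)//.
rewrite [X in _ - F (x + X) - _](_ : _ = 0); last first.
  by rewrite big1// => i _; rewrite subrr scale0r.
rewrite addr0.
rewrite (_ : _ - _ = (F (x + \sum_(i < n) a i *: e i) - F x -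
   \sum_(i < n) (a i)%:C * cD (e i) F x) +
   \sum_(i < n) (a i - h * c' i)%:C * cD (e i) F x); last first.
  rewrite -[in RHS]addrA; congr (_ + _).
  rewrite mulr_suml -!sumrN -big_split /=; apply: eq_bigr => i _.
  have -> : (a i - h * c' i)%:C = (a i)%:C - h%:C * (c' i)%:C :> R[i].
    by apply: complexP; rewrite /=; ring.
  ring.
apply: le_trans (nrmD _ _) _.
have b1 : ep * \sum_(i < n) `|a i| <= ep * (\sum_(i < n) (`|c' i| + 1) * `|h|).
  by rewrite ler_wpM2l ?(ltW epp)//; apply: ler_sum => i _; exact: ai.
have b2 : nrm (\sum_(i < n) (a i - h * c' i)%:C * cD (e i) F x) <=
    ep * `|h| * \sum_(i < n) nrm (cD (e i) F x).
  apply: le_trans (nrm_sum _ _ _) _; rewrite mulr_sumr; apply: ler_sum => i _.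
  by rewrite nrmM nrm_real ler_wpM2r ?nrm_ge0// h1.
rewrite -mulr_suml in b1.
have : C * (ep * `|h|) <= C * (ep0 * `|h|) by rewrite ler_wpM2l// ler_wpM2r.
rewrite -(mulrA C) /C; lra.
Qed.

(** Linearity in the direction, read off the chain rule along a straight line. *)
Lemma cD_lin (F : V -> R[i]) (x : V) (e : nat -> V) n (a : nat -> R) : cCk 1 F -> A x ->
  cD (\sum_(i < n) a i *: e i) F x = \sum_(i < n) (a i)%:C * cD (e i) F x.
Proof.
move=> hF Ax; apply: cD_rder.
have hc i : (i < n)%N -> is_derive (0 : R) 1 (fun s => a i * s) (a i).
  move=> _; apply/is_deriveP => e0 e00; exists 1 => // h _.
  rewrite scale_one add0r mulr0 subr0 mulrC subrr normr0.
  by rewrite mulr_ge0// ltW.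
have := cC1_chain e hF Ax hc; apply: eq_der => s; congr (F (_ + _)).
rewrite scaler_sumr; apply: eq_bigr => i _.
by rewrite mulr0 subr0 mulrC scalerA.
Qed.

End C1Linearization.

(** * Continuity by explicit estimates *)

Section EpsilonContinuity.
Context {R : realType} {D : zmodType} (io : D -> R[i]).
Implicit Types (f g : D -> R[i]) (x h : D).

Lemma econt_cst c x : econt io (fun=> c) x.
Proof. by move=> e e0; exists 1 => // h _; rewrite subrr nrm0 ltW. Qed.

Lemma econtD f g x : econt io f x -> econt io g x -> econt io (fun y => f y + g y) x.
Proof.
move=> hf hg e e0; have e20 : 0 < e / 2 by rewrite divr_gt0.
have [d d0 hd] := hf _ e20; have [d' d'0 hd'] := hg _ e20.
exists (Num.min d d') => [|h]; first by rewrite lt_min d0.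
rewrite le_min => /andP[/hd h1 /hd' h2].
rewrite (_ : _ - _ = (f (x + h) - f x) + (g (x + h) - g x)); last by ring.
by apply: le_trans (nrmD _ _) _; lra.
Qed.

Lemma econtM f g x : econt io f x -> econt io g x -> econt io (fun y => f y * g y) x.
Proof.
move=> hf hg e0 e00; pose C := 1 + nrm (f x) + nrm (g x).
have C0 : 0 < C by rewrite /C; have := nrm_ge0 (f x); have := nrm_ge0 (g x); lra.
pose e := Num.min (e0 / C) 1.
have e_gt0 : 0 < e by rewrite /e lt_min divr_gt0//= ltr01.
have e1 : e <= 1 by rewrite /e ge_min lexx orbT.
have ee : e * C <= e0 by rewrite -ler_pdivlMr// ge_min lexx.
clearbody e.
have [d d0 hd] := hf _ e_gt0; have [d' d'0 hd'] := hg _ e_gt0.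
exists (Num.min d d') => [|h]; first by rewrite lt_min d0.
rewrite le_min => /andP[/hd h1 /hd' h2].
rewrite (_ : _ - _ = (f (x + h) - f x) * (g (x + h) - g x) + f x * (g (x + h) - g x)
   + (f (x + h) - f x) * g x); last by ring.
set u := f (x + h) - f x in h1 *; set v := g (x + h) - g x in h2 *.
clearbody u v.
have b1 : nrm (u * v) <= e.
  rewrite nrmM -[e]mulr1; apply: ler_pM; rewrite ?nrm_ge0//; exact: le_trans h2 e1.
have b2 : nrm (f x * v) <= nrm (f x) * e by rewrite nrmM ler_wpM2l ?nrm_ge0.
have b3 : nrm (u * g x) <= nrm (g x) * e by rewrite nrmM mulrC ler_wpM2l ?nrm_ge0.
have := nrmD (u * v + f x * v) (u * g x); have := nrmD (u * v) (f x * v).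
rewrite /C in ee; lra.
Qed.

Lemma econt_comp (f : D -> R[i]) (F : R[i] -> R[i]) x :
  econt io f x -> econt id F (f x) -> econt io (fun y => F (f y)) x.
Proof.
move=> hf hF e e0; have [d d0 hd] := hF e e0; have [d' d'0 hd'] := hf d d0.
by exists d' => // h /hd' /hd; rewrite [f x + _]addrC subrK.
Qed.

Lemma econtV f x : f x != 0 -> econt io f x -> econt io (fun y => (f y)^-1) x.
Proof.
move=> f0 hf; apply: (econt_comp (F := fun w => w^-1)) hf _.
exact: der_econt (cder_inv f0).
Qed.

End EpsilonContinuity.

(** * C^1 functions of the path parameter and constancy of signs *)

Section C1Coefficients.
Context {R : realType}.
Implicit Types (a b : R -> R[i]) (t : R).

Local Notation rc := (fun t : R => t%:C).
Let I (t : R) := t \in `]0, 1[.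

(** One continuous derivative is what the square of the operator asks of its coefficients: the outer
    operator differentiates those of the inner one once. *)
Definition C1r a := exists2 a', (forall t, I t -> rder a t (a' t)) &
  forall t, I t -> econt rc a' t.

Lemma C1r_econt a t : C1r a -> I t -> econt rc a t.
Proof. by move=> [a' h _] It; exact: der_econt (h t It). Qed.

Lemma C1r_cst c : C1r (fun=> c).
Proof. by exists (fun=> 0) => t _; [exact: der_cst|exact: econt_cst]. Qed.

Lemma C1rD a b : C1r a -> C1r b -> C1r (fun t => a t + b t).
Proof.
move=> [a' h1 h2] [b' k1 k2]; exists (fun t => a' t + b' t) => t It.
  by apply: derD; [exact: h1|exact: k1].
by apply: econtD; [exact: h2|exact: k2].
Qed.

Lemma C1rM a b : C1r a -> C1r b -> C1r (fun t => a t * b t).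
Proof.
move=> ha hb; move: (ha) (hb) => [a' h1 h2] [b' k1 k2].
exists (fun t => a' t * b t + a t * b' t) => t It.
  by apply: derM; [exact: h1|exact: k1].
apply: econtD; apply: econtM.
- exact: h2.
- exact: C1r_econt hb It.
- exact: C1r_econt ha It.
- exact: k2.
Qed.

(** Two complex derivatives of f are used: the second makes the first continuous. *)
Lemma C1r_comp a (U : set R[i]) (f : R[i] -> R[i]) :
  (forall t, I t -> U (a t)) -> C1r a -> holo 2 U f -> C1r (fun t => f (a t)).
Proof.
move=> aU ha [f' ff' [f'' ff'' _]]; move: (ha) => [a' h1 h2].
exists (fun t => f' (a t) * a' t) => t It.
  by apply: der_comp (h1 t It) _; apply: ff'; exact: aU.
apply: econtM; last exact: h2.
apply: econt_comp; first exact: C1r_econt ha It.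
by apply: der_econt; apply: ff''; exact: aU.
Qed.

Lemma C1rV a : (forall t, I t -> a t != 0) -> C1r a -> C1r (fun t => (a t)^-1).
Proof.
move=> a0 ha; apply: (@C1r_comp a [set z | z != 0] (fun z => z^-1)) => //.
have hid : holo 2 [set z : R[i] | z != 0] id.
  by exists (fun=> 1); [move=> z _; exact: cder_id|exact: holo_cst].
exact: (@holoV _ 2 _ id (fun z h => h) hid).
Qed.

Lemma C1r_sqrt r a : C1r a -> (forall t, I t -> r t ^+ 2 = a t) ->
  (forall t, I t -> r t != 0) -> (forall t, I t -> econt rc r t) -> C1r r.
Proof.
move=> [a' h1 h2] ra r0 rc_.
have nearI t : I t -> exists2 d : R, 0 < d & forall h, `|h| <= d -> I (t + h).
  rewrite /I in_itv /= => /andP[t0 t1]; exists (Num.min (t / 2) ((1 - t) / 2)) => [|h].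
    by rewrite lt_min !divr_gt0// subr_gt0.
  rewrite le_min !ler_norml in_itv /= => /andP[/andP[k1 _] /andP[_ k2]].
  by apply/andP; split; lra.
exists (fun t => a' t * (2 * r t)^-1) => t It.
  have [d d0 hd] := nearI t It.
  apply: (der_sqrt (r0 t It) (rc_ t It) _ (ra t It) (h1 t It)).
  by exists d => // h; rewrite nrm_real => /hd; exact: ra.
apply: econtM; first exact: h2.
apply: econtV; first by rewrite mulf_neq0 ?r0// pnatr_eq0.
by apply: econtM; [exact: econt_cst|exact: rc_].
Qed.

Lemma C1r_ext a b : (forall t, I t -> a t = b t) -> C1r a -> C1r b.
Proof.
by move=> ab [a' h1 h2]; exists a' => // t It; exact: rder_near It ab (h1 t It).
Qed.

Lemma continuous_econt (r : R -> R[i]) t :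
  {for t, continuous (r : R -> R[i]^o)} -> econt rc r t.
Proof.
move=> /(@cvgrPdist_le _ R[i]^o) H e e0.
have eC : 0 < e%:C :> R[i] by rewrite ltcR.
have /nbhs_ballP[d /= d0 hd] := H _ eC.
exists (d / 2) => [|h]; first by rewrite divr_gt0.
move=> hh0; have hh : `|h| <= d / 2 by rewrite -(nrm_real h).
have := hd (t + h); rewrite -ball_normE /ball_ /= opprD addrA subrr add0r normrN => /(_ _).
rewrite nrmE lecR nrmBC; apply; apply: le_lt_trans hh _; lra.
Qed.

Lemma econt_Re_continuous (r : R -> R[i]) t :
  econt rc r t -> {for t, continuous (fun s => Re (r s))}.
Proof.
move=> H; apply/continuousP => e /H[d d0 hd]; exists d => // y yd.
have yd' : nrm ((y - t)%:C : R[i]) <= d by rewrite nrm_real ltW.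
have := hd (y - t) yd'; rewrite [t + _]addrC subrK.
by apply: le_trans; apply: le_trans (normr_Re _); rewrite ReD ReN.
Qed.

Lemma econt_Im_continuous (r : R -> R[i]) t :
  econt rc r t -> {for t, continuous (fun s => Im (r s))}.
Proof.
move=> H; apply/continuousP => e /H[d d0 hd]; exists d => // y yd.
have yd' : nrm ((y - t)%:C : R[i]) <= d by rewrite nrm_real ltW.
have := hd (y - t) yd'; rewrite [t + _]addrC subrK.
by apply: le_trans; apply: le_trans (normr_Im _); rewrite ImD ImN.
Qed.

Lemma ReIm_continuous_econt (r : R -> R[i]) t :
  {for t, continuous (fun s => Re (r s))} -> {for t, continuous (fun s => Im (r s))} ->
  econt rc r t.
Proof.
move=> /continuousP H /continuousP K e e0; have e20 : 0 < e / 2 by rewrite divr_gt0.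
have [d d0 hd] := H _ e20; have [d' d'0 hd'] := K _ e20.
exists (Num.min d d' / 2) => [|h]; first by rewrite divr_gt0// lt_min d0.
have m0 : 0 < Num.min d d' by rewrite lt_min d0.
move=> hh0; have hh : `|h| <= Num.min d d' / 2 by rewrite -(nrm_real h).
have {}hh : `|t + h - t| < Num.min d d' by rewrite addrAC subrr add0r; lra.
move: hh; rewrite lt_min => /andP[/hd h1 /hd' h2].
by apply: le_trans (nrm_le_ReIm _) _; rewrite ReD ReN ImD ImN; lra.
Qed.

Lemma sign_constant (r : R -> R[i]) : (forall t, I t -> econt rc r t) ->
  (forall t, I t -> r t ^+ 2 = 1) ->
  exists2 s : R[i], s ^+ 2 = 1 & forall t, I t -> r t = s.
Proof.
move=> rc_ r2.
have I2 : I (1 / 2) by rewrite /I in_itv /=; apply/andP; split; lra.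
exists (r (1 / 2)) => [|t It]; first exact: r2.
have pm t' : I t' -> r t' = 1 \/ r t' = -1.
  by move=> /r2 /eqP; rewrite sqrf_eq1 => /orP[/eqP|/eqP]; [left|right].
have key (a b : R) : I a -> I b -> a <= b -> r a = r b.
  move=> Ia Ib ab.
  have sub c : c \in `[a, b] -> I c.
    move: Ia Ib; rewrite /I !in_itv /= => /andP[a0 a1] /andP[b0 b1] /andP[ac cb].
    by rewrite (lt_le_trans a0 ac) (le_lt_trans cb b1).
  have cw : {within `[a, b], continuous (fun s => Re (r s))}.
    apply: continuous_in_subspaceT => c; rewrite inE /= => /sub Ic.
    by apply: econt_Re_continuous; exact: rc_.
  (* The values are 1 and -1, so the real part has no zero, whereas a change of sign would produce
     one. *)
  have Z : ~ exists2 c, c \in `[a, b] & Re (r c) = 0.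
    move=> [c /sub Ic]; case: (pm c Ic) => -> /=; first by move/eqP; rewrite oner_eq0.
    by move/eqP; rewrite oppr_eq0 oner_eq0.
  case: (pm a Ia) (pm b Ib) => ra [rb|rb]; rewrite ra rb//; exfalso; apply: Z.
    by apply: (@IVT _ _ a b 0 ab cw); rewrite ra rb /= ge_min le_max lerN10 ler01 orbT.
  by apply: (@IVT _ _ a b 0 ab cw); rewrite ra rb /= ge_min le_max lerN10 ler01 orbT.
have [h|h] := leP t (1 / 2); first exact: key.
by rewrite (key (1 / 2) t)// ltW.
Qed.

Lemma rder_direction a t l (w : R) : rder a t l ->
  rder (fun s => a (t + s * w)) 0 (w%:C * l).
Proof.
move=> H; apply: (@der_scale _ _ _ _ _ _ `|w|) => // e e0.
have [d d0 hd] := H e e0; have w1 : 0 < `|w| + 1 by rewrite ltr_wpDl.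
exists (d / (`|w| + 1)) => [|h]; first by rewrite divr_gt0.
rewrite nrm_real ler_pdivlMr// => hh.
have := hd (h * w); rewrite nrm_real normrM add0r mul0r addr0 => h1.
rewrite (_ : w%:C * l * h%:C = l * (h * w)%:C); last by rewrite rmorphM /=; ring.
apply: le_trans (h1 _) _; last by rewrite ?nrm_real; lra.
by have := normr_ge0 h; lra.
Qed.

Lemma C1r_cCk (W : normedModType R) (A : set (R * W)) a : open A ->
  (forall y, A y -> I y.1) -> C1r a -> cCk A 1 (fun y => a y.1).
Proof.
move=> Ao AI ha; move: (ha) => [a' h1 h2].
have cf (f : R -> R) (y : R * W) : {for y.1, continuous f} -> {for y, continuous (fun z => f z.1)}.
  by move=> fc; apply: (@continuous_comp _ _ _ fst f y) => //; exact: cvg_fst.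
have dl y v : A y -> rder (fun s => a (y + s *: v).1) 0 (v.1%:C * a' y.1).
  by move=> /AI Iy; exact: rder_direction (h1 _ Iy).
have dE y v : A y -> cD v (fun y => a y.1) y = v.1%:C * a' y.1.
  by move=> Ay; apply: cD_rder; exact: dl.
split; split=> [y /AI Iy|v].
- by apply: (cf (fun s => Re (a s))); apply: econt_Re_continuous; exact: C1r_econt.
- split=> [y Ay|]; first by have /rder_line[[]] := dl y v Ay.
  apply: (@eq_Ck _ _ A Ao 0 (fun y => Re (v.1%:C * a' y.1))) => [x Ax|].
    by rewrite -dE.
  split=> // x /AI Ix; apply: (cf (fun s => Re (v.1%:C * a' s))).
  by apply: econt_Re_continuous; apply: econtM; [exact: econt_cst|exact: h2].
- by apply: (cf (fun s => Im (a s))); apply: econt_Im_continuous; exact: C1r_econt.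
- split=> [y Ay|]; first by have /rder_line[_ []] := dl y v Ay.
  apply: (@eq_Ck _ _ A Ao 0 (fun y => Im (v.1%:C * a' y.1))) => [x Ax|].
    by rewrite -dE.
  split=> // x /AI Ix; apply: (cf (fun s => Im (v.1%:C * a' s))).
  by apply: econt_Im_continuous; apply: econtM; [exact: econt_cst|exact: h2].
Qed.

Lemma cCk_C1r (g : R -> R[i]) : @cCk R R `]0, 1[%classic 1 g -> C1r g /\
  forall t, I t -> rder g t (rderive1 g t).
Proof.
move=> hg.
have gE : rderive1 g = @cD R R 1 g.
  by apply/funext => t; rewrite /rderive1 /cD !derive1E.
have gd t : I t -> rder g t (rderive1 g t).
  move=> It; rewrite gE; apply/rderP; have [k1 k2] := hg; split; apply: DeriveDef => //.
    exact: (Ck_derivable (k := 0) k1).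
  exact: (Ck_derivable (k := 0) k2).
split=> //; exists (rderive1 g) => // t It.
rewrite gE; apply: ReIm_continuous_econt.
  by have [[_ /(_ 1)[_ [k _]]] _] := hg; exact: k.
by have [_ [_ /(_ 1)[_ [k _]]]] := hg; exact: k.
Qed.

Lemma smooth_C1r (g : R -> R[i]) : @csmooth_on R R `]0, 1[%classic g ->
  [/\ C1r g, C1r (rderive1 g) & forall t, I t -> rder g t (rderive1 g t)].
Proof.
move=> [s1 s2]; have [h1 h2] : C1r g /\ forall t, I t -> rder g t (rderive1 g t).
  by apply: cCk_C1r; split; [exact: s1 1%N|exact: s2 1%N].
split=> //; have [] : C1r (rderive1 g) /\ forall t, I t -> rder (rderive1 g) t (rderive1 (rderive1 g) t).
  apply: cCk_C1r; rewrite (_ : rderive1 g = @cD R R 1 g).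
    by apply: cCk_derive; split; [exact: s1 2%N|exact: s2 2%N].
  by apply/funext => t; rewrite /rderive1 /cD !derive1E.
by [].
Qed.

End C1Coefficients.

(** * The invariant frame and the right translations on R^4 *)

Section Rows.
Context {R : realType}.
Implicit Types (y v : 'rV[R]_4) (f : 'rV[R]_4 -> 'rV[R]_4).

Definition row4 (a b c d : R) : 'rV[R]_4 := \row_j [:: a; b; c; d]`_j.

Lemma row4P y v : y 0 0 = v 0 0 -> y 0 1 = v 0 1 -> y 0 2 = v 0 2 -> y 0 3 = v 0 3 -> y = v.
Proof.
move=> h0 h1 h2 h3; apply/rowP => -[[|[|[|[|j]]]] hj] //.
- by rewrite (_ : Ordinal hj = 0)//; apply: val_inj.
- by rewrite (_ : Ordinal hj = 1)//; apply: val_inj.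
- by rewrite (_ : Ordinal hj = 2)//; apply: val_inj.
- by rewrite (_ : Ordinal hj = 3)//; apply: val_inj.
Qed.

Lemma row4E a b c d : ((row4 a b c d 0 0 = a) * (row4 a b c d 0 1 = b) *
  (row4 a b c d 0 2 = c) * (row4 a b c d 0 3 = d))%type.
Proof. by rewrite !mxE. Qed.

Lemma sum4 (W : zmodType) (F : 'I_4 -> W) : \sum_j F j = F 0 + F 1 + F 2 + F 3.
Proof.
rewrite !big_ord_recl big_ord0 addr0 !addrA.
by congr (_ + _ + _ + _); congr F; apply: val_inj.
Qed.

Definition linear_row f := forall (s : R) v y, f (s *: v + y) = s *: f v + f y.

Lemma linear_row0 f : linear_row f -> f 0 = 0.
Proof. by move=> H; have := H (-1) 0 0; rewrite scaler0 addr0 scaleN1r addNr. Qed.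

Lemma linear_rowZ f : linear_row f -> forall s v, f (s *: v) = s *: f v.
Proof. by move=> H s v; have := H s v 0; rewrite addr0 linear_row0// addr0. Qed.

Lemma linear_row_continuous f : linear_row f -> continuous f.
Proof.
move=> H; pose d j : 'rV[R]_4 := delta_mx 0 j.
have E : f = (fun y => y 0 0 *: f (d 0) + y 0 1 *: f (d 1) + y 0 2 *: f (d 2) + y 0 3 *: f (d 3)).
  apply/funext => y; rewrite {1}(row_sum_delta y) sum4 -!addrA.
  by rewrite H H H (linear_rowZ H).
rewrite E => y.
have T j : {for y, continuous (fun z : 'rV[R]_4 => z 0 j *: f (d j))}.
  apply: (@continuousZr_tmp R _ _ (fun z : ('rV[R]_4) => z 0 j)); exact: (@coord_continuous R 1 4 0 j y).
exact: (cvgD (cvgD (cvgD (T 0) (T 1)) (T 2)) (T 3)).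
Qed.

(** The invariant fields are restrictions of linear fields on R^4, regular also on the circles where
    the Euler coordinates degenerate. [coord_X1], [coord_X2] and [coord_dpsi] identify them with
    [X1], [X2] and [d_psi]. *)
Definition e1 y : 'rV[R]_4 := row4 (- (y 0 3 / 2)) (y 0 2 / 2) (- (y 0 1 / 2)) (y 0 0 / 2).
Definition e2 y : 'rV[R]_4 := row4 (- (y 0 2 / 2)) (- (y 0 3 / 2)) (y 0 0 / 2) (y 0 1 / 2).
Definition e3 y : 'rV[R]_4 := row4 (- (y 0 1 / 2)) (y 0 0 / 2) (y 0 3 / 2) (- (y 0 2 / 2)).

Let k := @isqrt2 R.

(** The translations of [relabel23] and [relabel31] in real coordinates, as isometries of R^4, with
    their inverses. *)
Definition h23 y : 'rV[R]_4 :=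
  row4 (k * (y 0 0 - y 0 3)) (k * (y 0 1 + y 0 2)) (k * (y 0 2 - y 0 1)) (k * (y 0 3 + y 0 0)).
Definition h23i y : 'rV[R]_4 :=
  row4 (k * (y 0 0 + y 0 3)) (k * (y 0 1 - y 0 2)) (k * (y 0 2 + y 0 1)) (k * (y 0 3 - y 0 0)).
Definition h31 y : 'rV[R]_4 :=
  row4 (k * (y 0 0 - y 0 2)) (k * (y 0 1 - y 0 3)) (k * (y 0 0 + y 0 2)) (k * (y 0 1 + y 0 3)).
Definition h31i y : 'rV[R]_4 :=
  row4 (k * (y 0 0 + y 0 2)) (k * (y 0 1 + y 0 3)) (k * (y 0 2 - y 0 0)) (k * (y 0 3 - y 0 1)).

Ltac rowtac := apply: row4P; rewrite ?(row4E, mxE); ring.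

Lemma e1_linear : linear_row e1. Proof. move=> s v y; rowtac. Qed.
Lemma e2_linear : linear_row e2. Proof. move=> s v y; rowtac. Qed.
Lemma e3_linear : linear_row e3. Proof. move=> s v y; rowtac. Qed.
Lemma h23_linear : linear_row h23. Proof. move=> s v y; rowtac. Qed.
Lemma h23i_linear : linear_row h23i. Proof. move=> s v y; rowtac. Qed.
Lemma h31_linear : linear_row h31. Proof. move=> s v y; rowtac. Qed.
Lemma h31i_linear : linear_row h31i. Proof. move=> s v y; rowtac. Qed.

Lemma h23_e1 y : h23 (e1 y) = e1 (h23 y). Proof. rowtac. Qed.
Lemma h23_e2 y : h23 (e2 y) = e3 (h23 y). Proof. rowtac. Qed.
Lemma h23_e3 y : h23 (e3 y) = - e2 (h23 y). Proof. rowtac. Qed.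
Lemma h31_e1 y : h31 (e1 y) = - e3 (h31 y). Proof. rowtac. Qed.
Lemma h31_e2 y : h31 (e2 y) = e2 (h31 y). Proof. rowtac. Qed.
Lemma h31_e3 y : h31 (e3 y) = e1 (h31 y). Proof. rowtac. Qed.

Lemma isqrt2_sqr : 2 * (k * k) = 1.
Proof. by rewrite /k /isqrt2 -invfM -expr2 sqr_sqrtr// mulfV// pnatr_eq0. Qed.

Ltac rowtac2 := apply: row4P; rewrite ?(row4E, mxE); ring: isqrt2_sqr.

Lemma h23K : cancel h23 h23i. Proof. move=> y; rowtac2. Qed.
Lemma h23iK : cancel h23i h23. Proof. move=> y; rowtac2. Qed.
Lemma h31K : cancel h31 h31i. Proof. move=> y; rowtac2. Qed.
Lemma h31iK : cancel h31i h31. Proof. move=> y; rowtac2. Qed.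

Definition nsq y : R := \sum_j y 0 j ^+ 2.

Lemma nsqE y : nsq y = y 0 0 ^+ 2 + y 0 1 ^+ 2 + y 0 2 ^+ 2 + y 0 3 ^+ 2.
Proof. by rewrite /nsq sum4. Qed.

Ltac nsqtac := rewrite !nsqE !row4E; ring: isqrt2_sqr.
Lemma nsq_h23 y : nsq (h23 y) = nsq y. Proof. nsqtac. Qed.
Lemma nsq_h23i y : nsq (h23i y) = nsq y. Proof. nsqtac. Qed.
Lemma nsq_h31 y : nsq (h31 y) = nsq y. Proof. nsqtac. Qed.
Lemma nsq_h31i y : nsq (h31i y) = nsq y. Proof. nsqtac. Qed.

Lemma nsq1_neq0 y : nsq y = 1 -> y != 0.
Proof.
apply: contra_eq_neq => ->; rewrite /nsq big1 ?(eq_sym 0) ?oner_eq0// => j _.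
by rewrite mxE expr0n.
Qed.

Definition yv (eta phi psi : R) : 'rV[R]_4 :=
  row4 (cos (eta / 2) * cos ((phi + psi) / 2)) (cos (eta / 2) * sin ((phi + psi) / 2))
       (sin (eta / 2) * cos ((phi - psi) / 2)) (sin (eta / 2) * sin ((phi - psi) / 2)).

Lemma nsq_yv eta phi psi : nsq (yv eta phi psi) = 1.
Proof.
rewrite nsqE !row4E !exprMn -mulrDr -addrA -mulrDr !cos2Dsin2 !mulr1 cos2Dsin2//.
Qed.

Lemma radial_unit y : nsq y = 1 -> radial y = (y 0 0 +i* y 0 1, y 0 2 +i* y 0 3).
Proof. by move=> h; rewrite /radial -/(nsq y) h sqrtr1 !divr1. Qed.

Lemma radial_yv eta phi psi : radial (yv eta phi psi) = euler eta phi psi.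
Proof.
rewrite radial_unit ?nsq_yv// /euler !row4E.
by congr (_, _); rewrite [cexp _](cexp_i _); apply: complexP; rewrite !(ReM, ImM) /=; ring.
Qed.

Lemma polar2 (x y : R) : exists a, x = Num.sqrt (x ^+ 2 + y ^+ 2) * cos a /\
  y = Num.sqrt (x ^+ 2 + y ^+ 2) * sin a.
Proof.
set r := Num.sqrt _.
have r2 : r ^+ 2 = x ^+ 2 + y ^+ 2 by rewrite sqr_sqrtr// addr_ge0 ?sqr_ge0.
have [r0|rn] := eqVneq r 0.
  exists 0; rewrite r0 !mul0r; have : x ^+ 2 + y ^+ 2 = 0 by rewrite -r2 r0 expr0n.
  move/eqP; rewrite paddr_eq0 ?sqr_ge0// !sqrf_eq0 => /andP[/eqP -> /eqP ->//].
have r0 : 0 < r by rewrite lt_def rn sqrtr_ge0.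
pose u := x / r.
have xu : x = r * u by rewrite /u mulrC divfK.
have u1 : -1 <= u <= 1.
  rewrite -ler_norml -(@ler_pXn2r _ 2) ?nnegrE// expr1n real_normK ?num_real//.
  by rewrite /u expr_div_n r2 ler_pdivrMr -?r2 ?exprn_gt0// mul1r r2 lerDl sqr_ge0.
have y2 : y ^+ 2 = r ^+ 2 * (1 - u ^+ 2) by rewrite mulrBr mulr1 r2 -r2 -exprMn -xu r2; ring.
have sy : `|y| = r * Num.sqrt (1 - u ^+ 2).
  by rewrite -sqrtr_sqr y2 sqrtrM ?sqr_ge0// sqrtr_sqr gtr0_norm.
have cu : cos (acos u) = u by rewrite acosK// in_itv.
have [y0|y0] := leP 0 y.
  exists (acos u); rewrite cu sin_acos// -sy ger0_norm//.
exists (- acos u); rewrite cosN sinN cu sin_acos// mulrN -sy ltr0_norm// opprK//.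
Qed.

(** The closed interval of eta covers the sphere; its two ends give the circles left out by the
    chart. *)
Lemma yv_surj y : nsq y = 1 -> exists eta phi psi, 0 <= eta <= pi /\ y = yv eta phi psi.
Proof.
rewrite nsqE => h.
have [a [a1 a2]] := polar2 (y 0 0) (y 0 1).
have [b [b1 b2]] := polar2 (y 0 2) (y 0 3).
set r := Num.sqrt (y 0 0 ^+ 2 + _) in a1 a2; set q := Num.sqrt (y 0 2 ^+ 2 + _) in b1 b2.
have r2 : r ^+ 2 = y 0 0 ^+ 2 + y 0 1 ^+ 2 by rewrite sqr_sqrtr// addr_ge0 ?sqr_ge0.
have r0 : 0 <= r := sqrtr_ge0 _.
have q2 : y 0 2 ^+ 2 + y 0 3 ^+ 2 = 1 - r ^+ 2 by rewrite r2 -h; ring.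
have r1 : -1 <= r <= 1.
  rewrite -ler_norml -(@ler_pXn2r _ 2) ?nnegrE// expr1n real_normK ?num_real//.
  by rewrite -subr_ge0 -q2 addr_ge0 ?sqr_ge0.
have p1 := r1; case/andP: p1 => _ r1'.
(* r and q are the moduli of the two complex coordinates and a, b their arguments: eta is twice the
   angle of (r, q), phi and psi are the sum and difference of the arguments. *)
exists (acos r *+ 2), (a + b), (a - b); split.
  rewrite mulrn_wge0 ?acos_ge0//=.
  have : acos r <= pi / 2.
    rewrite leNgt; apply/negP => hp; have : cos (acos r) < cos (pi / 2).
      rewrite ltr_cos// in_itv /=.
        by have p0 := pi_ge0 R; apply/andP; split; lra.
      by rewrite acos_ge0// acos_lepi.
    by rewrite acosK ?in_itv// cos_pihalf ltNge r0.
  by move: (acos r) => c hc; rewrite mulr2n; lra.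
have E1 : acos r *+ 2 / 2 = acos r by rewrite mulr2n; field.
have E2 : (a + b + (a - b)) / 2 = a by field.
have E3 : (a + b - (a - b)) / 2 = b by field.
apply: row4P; rewrite row4E E1 ?E2 ?E3 ?acosK ?in_itv// sin_acos// -q2//.
Qed.

End Rows.


(** * Vector fields on C^4-valued functions and the operator in the frame *)

Section VectorDerivative.
Context {R : realType}.
Notation V := ((R * 'rV[R]_4)%type : normedModType R).
Implicit Types (y v : V) (G : V -> 'cV[R[i]]_4).

Definition dom : set V := [set y | (y.1 \in `]0, 1[) /\ (y.2 != 0)].

Lemma dom_open : open dom.
Proof.
rewrite (_ : dom = (@fst R 'rV[R]_4) @^-1` `]0, 1[%classic `&` (fun y => y.2) @^-1` [set x | x != 0]).
  apply: openI.
    by apply: open_comp; [move=> y _; exact: cvg_fst|exact: interval_open].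
  apply: open_comp; first by move=> y _; exact: cvg_snd.
  rewrite (_ : [set x | x != 0] = ~` [set (0 : 'rV[R]_4)]); last first.
    by apply/seteqP; split => x /= /eqP.
  apply: closed_openC; apply: accessible_closed_set1; apply: hausdorff_accessible.
  exact: norm_hausdorff.
by apply/seteqP; split.
Qed.

Definition vCk k G := forall a, cCk dom k (fun y => G y a ord0).

Definition VD v G y : 'cV[R[i]]_4 := \col_a cD v (fun z => G z a ord0) y.

Lemma vCkS k G : vCk k.+1 G -> vCk k G.
Proof. by move=> H a; exact: cCkS. Qed.

Lemma eq_vCk k G H : (forall y, dom y -> G y = H y) -> vCk k G -> vCk k H.
Proof. by move=> GH hG a; apply: (eq_cCk dom_open _ (hG a)) => y /GH ->. Qed.

Lemma vCkD k G H : vCk k G -> vCk k H -> vCk k (fun y => G y + H y).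
Proof.
move=> hG hH a; apply: (eq_cCk dom_open _ (cCkD dom_open (hG a) (hH a))) => y _.
by rewrite mxE.
Qed.

Lemma vCkZ k (c : V -> R[i]) G : cCk dom k c -> vCk k G -> vCk k (fun y => c y *: G y).
Proof.
move=> hc hG a; apply: (eq_cCk dom_open _ (cCkM dom_open hc (hG a))) => y _.
by rewrite mxE.
Qed.

Lemma vCk_mx k (M : 'M[R[i]]_4) G : vCk k G -> vCk k (fun y => M *m G y).
Proof.
move=> hG a; have H j : cCk dom k (fun y => M a j * G y j 0).
  by apply: (cCkM dom_open) => //; exact: cCk_cst dom_open _ _.
apply: (eq_cCk dom_open _ (cCk_sum dom_open H)) => y _; by rewrite mxE.
Qed.

Lemma vCk_VD k v G : vCk k.+1 G -> vCk k (VD v G).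
Proof.
move=> hG a; apply: (eq_cCk dom_open _ (cCk_derive v (hG a))) => y _.
by rewrite mxE.
Qed.

Lemma VD_mx (M : 'M[R[i]]_4) v G y : vCk 1 G -> dom y ->
  VD v (fun z => M *m G z) y = M *m VD v G y.
Proof.
move=> hG yd; apply/colP => a; rewrite !mxE.
have H j : cCk dom 1 (fun y => M a j * G y j 0).
  by apply: (cCkM dom_open) => //; exact: cCk_cst dom_open _ _.
rewrite (_ : (fun z => _) = (fun z => \sum_j M a j * G z j 0)); last first.
  by apply/funext => z; rewrite mxE.
rewrite (cD_sum dom_open _ H)//; apply: eq_bigr => j _.
by rewrite (cDZ (A := dom) _ _ (hG j) yd) mxE.
Qed.

Lemma VD_lin n (c : nat -> R) (e : nat -> V) G y : vCk 1 G -> dom y ->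
  VD (\sum_(i < n) c i *: e i) G y = \sum_(i < n) (c i)%:C *: VD (e i) G y.
Proof.
move=> hG yd; apply/colP => a; rewrite !mxE summxE (cD_lin dom_open)//.
by apply: eq_bigr => i _; rewrite !mxE.
Qed.

Lemma VDN v G y : vCk 1 G -> dom y -> VD (- v) G y = - VD v G y.
Proof.
move=> hG yd; have := VD_lin 1 (fun=> -1) (fun=> v) hG yd.
by rewrite !big_ord_recl !big_ord0 !addr0 scaleN1r rmorphN scaleN1r.
Qed.

Lemma VD_affine (L L0 : V -> V) v G y :
  (forall x (s : R) v, L (s *: v + x) = s *: L0 v + L x) ->
  VD v (fun z => G (L z)) y = VD (L0 v) G (L y).
Proof.
move=> HL; apply/colP => a; rewrite !mxE /cD.
by congr (_ +i* _); [have [_ ->] := derive_affine (fun z => Re (G z a 0)) y v HL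
  |have [_ ->] := derive_affine (fun z => Im (G z a 0)) y v HL].
Qed.

Lemma vCk_affine (L L0 : V -> V) k G :
  (forall x (s : R) v, L (s *: v + x) = s *: L0 v + L x) ->
  continuous L -> (forall y, dom y -> dom (L y)) ->
  vCk k G -> vCk k (fun z => G (L z)).
Proof.
move=> HL Lc Ld hG a; have [h1 h2] := hG a.
by split; [exact: (Ck_affine HL Lc Ld h1)|exact: (Ck_affine HL Lc Ld h2)].
Qed.

Definition Y (f : 'rV[R]_4 -> 'rV[R]_4) G (y : V) := VD (0, f y.2) G y.

(** A coordinate of a linear map is the identity of R composed with an affine map, so [Ck_affine]
    reduces the claim to the identity. *)
Lemma linear_row_smooth f k j : linear_row f -> cCk dom k (fun y => (f y.2 0 j)%:C).
Proof.
move=> fl; split; last exact: Ck_cst dom_open _ _.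
have H (x : V) (s : R) (v : V) :
  f (s *: v + x).2 0 j = s *: f v.2 0 j + f x.2 0 j by rewrite /= fl !mxE.
have c : continuous (fun y : V => f y.2 0 j).
  move=> y; apply: (@continuous_comp _ _ _ (fun y : V => f y.2) (fun z : 'rV[R]_4 => z 0 j)).
    apply: (@continuous_comp _ _ _ (fun y : V => y.2) f); first exact: cvg_snd.
    exact: linear_row_continuous.
  exact: coord_continuous.
apply: (@Ck_affine R V R dom setT (fun y : V => f y.2 0 j) (fun y : V => f y.2 0 j) k id H c) => //.
have d1 (v x : R) : derivable id x v /\ 'D_v id x = v.
  split; first exact: derivable_id.
  exact: derive_id.
case: k => [|k]; first by split=> // x _; exact: cvg_id.
split=> [x _|v]; first exact: cvg_id.
split=> [x _|]; first by have [] := d1 v x.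
rewrite (_ : (fun x => _) = (fun=> v)); first exact: Ck_cst openT _ _.
by apply/funext => x; have [] := d1 v x.
Qed.

(** The basis is indexed through [inord] because the C^1 lemmas number directions by natural
    numbers. *)
Lemma row_sum (v : 'rV[R]_4) :
  ((0, v) : V) = \sum_(i < 4) v 0 (inord i) *: ((0, delta_mx 0 (inord i)) : V).
Proof.
have E1 : (\sum_(i < 4) v 0 (inord i) *: ((0, delta_mx 0 (inord i)) : V)).1 = 0.
  by rewrite (big_morph (fun z : V => z.1) (id1 := 0) (op1 := +%R))// big1// => i _ /=; rewrite scaler0.
have E2 : (\sum_(i < 4) v 0 (inord i) *: ((0, delta_mx 0 (inord i)) : V)).2 = v.
  rewrite (big_morph (fun z : V => z.2) (id1 := 0) (op1 := +%R))//= [RHS]row_sum_delta.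
  by apply: eq_bigr => i _; rewrite inord_val.
by rewrite [RHS]surjective_pairing E1 E2.
Qed.

Lemma vCk_Y k f G : linear_row f -> vCk k.+1 G -> vCk k (Y f G).
Proof.
move=> fl hG; have hG1 : vCk 1 G.
  by elim: k hG => // k IH /vCkS.
pose e i : V := (0, delta_mx 0 (inord i)).
have H a j : cCk dom k (fun y => (f y.2 0 (inord j))%:C * VD (e j) G y a 0).
  by apply: (cCkM dom_open); [exact: linear_row_smooth|exact: vCk_VD].
move=> a; apply: (eq_cCk dom_open _ (cCk_sum dom_open (fun j : 'I_4 => H a j))) => y yd.
rewrite /Y row_sum (VD_lin 4 (fun i => f y.2 0 (inord i)) e)// summxE.
by apply: eq_bigr => j _; rewrite [in RHS]mxE.
Qed.

Section Operator.
Variables (gam : 'I_4 -> 'M[R[i]]_4) (a : 'I_4 -> R -> R[i]) (b0 b1 : R -> R[i]).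

Definition Dop G (y : V) : 'cV[R[i]]_4 :=
  a 1 y.1 *: (gam 1 *m Y (@e1 R) G y) + a 2 y.1 *: (gam 2 *m Y (@e2 R) G y)
  + a 0 y.1 *: (gam 0 *m VD (1, 0) G y) + a 3 y.1 *: (gam 3 *m Y (@e3 R) G y)
  + b0 y.1 *: (gam 0 *m G y) - b1 y.1 *: (gam 1 *m gam 2 *m gam 3 *m G y).

Lemma vCk_Dop k G : (k <= 1)%N -> (forall j, C1r (a j)) -> C1r b0 -> C1r b1 ->
  vCk k.+1 G -> vCk k (Dop G).
Proof.
move=> k1 ha hb0 hb1 hG.
have hG0 := vCkS hG.
have C c : C1r c -> cCk dom k (fun y => c y.1).
  move=> hc; have h : cCk dom 1 (fun y => c y.1) by apply: C1r_cCk hc => //; [exact: dom_open|move=> y []].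
  by case: k k1 {hG hG0} => [|[|k]]// _; exact: cCkS.
rewrite /Dop; apply: vCkD; first apply: vCkD; first apply: vCkD; first apply: vCkD; first apply: vCkD.
- by apply: vCkZ (C _ (ha 1)) (vCk_mx _ (vCk_Y (@e1_linear R) hG)).
- by apply: vCkZ (C _ (ha 2)) (vCk_mx _ (vCk_Y (@e2_linear R) hG)).
- by apply: vCkZ (C _ (ha 0)) (vCk_mx _ (vCk_VD _ hG)).
- by apply: vCkZ (C _ (ha 3)) (vCk_mx _ (vCk_Y (@e3_linear R) hG)).
- by apply: vCkZ (C _ hb0) (vCk_mx _ hG0).
apply: (@eq_vCk _ (fun y => (-1) *: (b1 y.1 *: (gam 1 *m gam 2 *m gam 3 *m G y)))).
  by move=> y _; rewrite scaleN1r.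
apply: vCkZ; first exact: cCk_cst dom_open _ _.
exact: vCkZ (C _ hb1) (vCk_mx _ hG0).
Qed.

(** Locality: the intertwining identity is known on [dom] only, and the operator has to be applied
    to both of its sides. *)
Lemma eq_Dop G H y : dom y -> (forall z, dom z -> G z = H z) -> vCk 1 G -> vCk 1 H ->
  Dop G y = Dop H y.
Proof.
move=> yd GH hG hH; have E v : VD v G y = VD v H y.
  apply/colP => c; rewrite !mxE /cD.
  have n : \forall z \near y, G z = H z.
    by apply: filterS (open_nbhs_nbhs (conj dom_open yd)) => z; exact: GH.
  by congr (_ +i* _); apply: near_eq_derive => //; apply: filterS n => z ->.
by rewrite /Dop /Y !E GH.
Qed.

End Operator.

End VectorDerivative.


(** * Comparison with the Euler coordinates *)

Section EulerCoordinates.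
Context {R : realType}.
Notation V := ((R * 'rV[R]_4)%type : normedModType R).
Implicit Types (G : V -> 'cV[R[i]]_4) (t eta phi psi : R).

Lemma is_derive_affine1 (a b x : R) : is_derive x 1 (fun s => a * s + b) a.
Proof.
apply/is_deriveP => e e0; exists 1 => // h _.
rewrite scale_one; apply: (@le_trans _ _ 0); last by rewrite mulr_ge0// ltW.
by rewrite normr_le0; apply/eqP; ring.
Qed.

Lemma is_derive_cstM (c x l : R) (f : R -> R) :
  is_derive x 1 f l -> is_derive x 1 (fun s => c * f s) (c * l).
Proof. move=> h; exact: (@is_deriveZ _ _ _ f c x 1 l h). Qed.

Lemma is_derive_cos_affine (c a b x l : R) (f : R -> R) :
  (forall s, f s = c * cos (a * s + b)) -> l = - (c * a * sin (a * x + b)) ->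
  is_derive x 1 f l.
Proof.
move=> /funext -> ->; have h := @is_derive1_comp _ cos (fun s => a * s + b) x _ _ (is_derive_cos (a * x + b)) (is_derive_affine1 a b x).
have -> : - (c * a * sin (a * x + b)) = c * (- sin (a * x + b) * a).
  by rewrite mulNr mulrN mulrA mulrAC.
exact: is_derive_cstM.
Qed.

Lemma is_derive_sin_affine (c a b x l : R) (f : R -> R) :
  (forall s, f s = c * sin (a * s + b)) -> l = c * a * cos (a * x + b) ->
  is_derive x 1 f l.
Proof.
move=> /funext -> ->; have h := @is_derive1_comp _ sin (fun s => a * s + b) x _ _ (is_derive_sin (a * x + b)) (is_derive_affine1 a b x).
have -> : c * a * cos (a * x + b) = c * (cos (a * x + b) * a) by ring.
exact: is_derive_cstM.
Qed.

Lemma forall4 (P : 'I_4 -> Prop) : P 0 -> P 1 -> P 2 -> P 3 -> forall j, P j.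
Proof.
move=> h0 h1 h2 h3 [[|[|[|[|j]]]] hj] //.
- by rewrite (_ : Ordinal hj = 0)//; apply: val_inj.
- by rewrite (_ : Ordinal hj = 1)//; apply: val_inj.
- by rewrite (_ : Ordinal hj = 2)//; apply: val_inj.
- by rewrite (_ : Ordinal hj = 3)//; apply: val_inj.
Qed.

Definition yphi eta phi psi : 'rV[R]_4 :=
  let y := yv eta phi psi in row4 (- (y 0 1 / 2)) (y 0 0 / 2) (- (y 0 3 / 2)) (y 0 2 / 2).

Definition yeta eta phi psi : 'rV[R]_4 := row4
  (- (sin (eta / 2) * cos ((phi + psi) / 2) / 2)) (- (sin (eta / 2) * sin ((phi + psi) / 2) / 2))
  (cos (eta / 2) * cos ((phi - psi) / 2) / 2) (cos (eta / 2) * sin ((phi - psi) / 2) / 2).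

Lemma yv_dpsi eta phi psi j :
  is_derive psi 1 (fun s => yv eta phi s 0 j) (e3 (yv eta phi psi) 0 j).
Proof.
have E1 (s : R) : (phi + s) / 2 = 1 / 2 * s + phi / 2 by field.
have E2 (s : R) : (phi - s) / 2 = - (1 / 2) * s + phi / 2 by field.
move: j; apply: forall4.
- by apply: (@is_derive_cos_affine (cos (eta / 2)) (1 / 2) (phi / 2)) => [s|]; rewrite !row4E E1//; field.
- by apply: (@is_derive_sin_affine (cos (eta / 2)) (1 / 2) (phi / 2)) => [s|]; rewrite !row4E E1//; field.
- by apply: (@is_derive_cos_affine (sin (eta / 2)) (- (1 / 2)) (phi / 2)) => [s|]; rewrite !row4E E2//; field.
- by apply: (@is_derive_sin_affine (sin (eta / 2)) (- (1 / 2)) (phi / 2)) => [s|]; rewrite !row4E E2//; field.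
Qed.

Lemma yv_dphi eta phi psi j :
  is_derive phi 1 (fun s => yv eta s psi 0 j) (yphi eta phi psi 0 j).
Proof.
have E1 (s : R) : (s + psi) / 2 = 1 / 2 * s + psi / 2 by field.
have E2 (s : R) : (s - psi) / 2 = 1 / 2 * s + - (psi / 2) by field.
move: j; apply: forall4.
- by apply: (@is_derive_cos_affine (cos (eta / 2)) (1 / 2) (psi / 2)) => [s|]; rewrite !row4E E1//; field.
- by apply: (@is_derive_sin_affine (cos (eta / 2)) (1 / 2) (psi / 2)) => [s|]; rewrite !row4E E1//; field.
- by apply: (@is_derive_cos_affine (sin (eta / 2)) (1 / 2) (- (psi / 2))) => [s|]; rewrite !row4E E2//; field.
- by apply: (@is_derive_sin_affine (sin (eta / 2)) (1 / 2) (- (psi / 2))) => [s|]; rewrite !row4E E2//; field.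
Qed.

Lemma yv_deta eta phi psi j :
  is_derive eta 1 (fun s => yv s phi psi 0 j) (yeta eta phi psi 0 j).
Proof.
have E (s : R) : s / 2 = 1 / 2 * s + 0 by field.
move: j; apply: forall4.
- by apply: (@is_derive_cos_affine (cos ((phi + psi) / 2)) (1 / 2) 0) => [s|]; rewrite !row4E -?E; field.
- by apply: (@is_derive_cos_affine (sin ((phi + psi) / 2)) (1 / 2) 0) => [s|]; rewrite !row4E -?E; field.
- by apply: (@is_derive_sin_affine (cos ((phi - psi) / 2)) (1 / 2) 0) => [s|]; rewrite !row4E -?E; field.
- by apply: (@is_derive_sin_affine (sin ((phi - psi) / 2)) (1 / 2) 0) => [s|]; rewrite !row4E -?E; field.
Qed.

Lemma vderive1_curve G t (c : R -> 'rV[R]_4) (c' : 'rV[R]_4) s0 : vCk 1 G -> dom (t, c s0) ->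
  (forall j, is_derive s0 1 (fun s => c s 0 j) (c' 0 j)) ->
  vderive1 (fun s => G (t, c s)) s0 = VD (0, c') G (t, c s0).
Proof.
move=> hG td hc; apply/colP => a; rewrite !mxE.
pose e i : V := (0, delta_mx 0 (inord i)).
have := @cC1_chain _ _ _ dom_open _ _ e 4 (fun i s => c s 0 (inord i)) (fun i => c' 0 (inord i))
  s0 (hG a) td (fun i _ => hc (inord i)).
rewrite -(@cD_lin _ _ _ dom_open _ _ e 4 (fun i => c' 0 (inord i)) (hG a) td) -row_sum.
move=> h; apply: rder_rderive1; apply: eq_der h => s.
congr (G _ a 0); have := row_sum (c s - c s0); rewrite /e => E.
rewrite (eq_bigr (fun i : 'I_4 => (c s - c s0) 0 (inord i) *: e i)) => [|i _]; last first.
  by rewrite !mxE.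
by rewrite -E; congr (_, _) => /=; rewrite ?addr0// addrC subrK.
Qed.

Lemma vderive1_time G t (y : 'rV[R]_4) : vCk 1 G -> dom (t, y) ->
  vderive1 (fun s => G (s, y)) t = VD (1, 0) G (t, y).
Proof.
move=> hG td; apply/colP => a; rewrite !mxE.
have hc (i : nat) : (i < 1)%N -> is_derive t 1 (fun s : R => s) 1.
  by move=> _; exact: is_derive_id.
have := @cC1_chain _ _ _ dom_open _ _ (fun=> (1, 0) : V) 1 (fun _ s => s) (fun=> 1) t (hG a) td hc.
rewrite big_ord_recl big_ord0 addr0 mul1r => h; apply: rder_rderive1; apply: eq_der h => s.
rewrite big_ord_recl big_ord0 addr0; congr (G _ a 0).
by congr (_, _) => /=; rewrite ?scaler0 ?addr0// scale_one addrC subrK.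
Qed.

Definition coordG G : @coord_spinor R := fun t eta phi psi => G (t, yv eta phi psi).

Lemma dom_yv t eta phi psi : t \in `]0, 1[ -> dom (t, yv eta phi psi).
Proof. by move=> h; split => //=; apply: nsq1_neq0; exact: nsq_yv. Qed.

Lemma vpairD (u v : 'rV[R]_4) : ((0, u) : V) + ((0, v) : V) = (0, u + v).
Proof. by apply/eqP; rewrite xpair_eqE /= addr0 !eqxx. Qed.

Lemma vpairZ (a : R) (u : 'rV[R]_4) : a *: ((0, u) : V) = (0, a *: u).
Proof. by apply/eqP; rewrite xpair_eqE /= scaler0 !eqxx. Qed.

Lemma sum3 (W : zmodType) (F : nat -> W) : \sum_(i < 3) F i = F 0%N + F 1%N + F 2%N.
Proof. by rewrite !big_ord_recl big_ord0 addr0 addrA. Qed.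

Section Frame.
Variables (G : V -> 'cV[R[i]]_4) (t eta phi psi : R).
Hypotheses (hG : vCk 1 G) (It : t \in `]0, 1[) (Ie : eta \in `]0, pi[).
Let y := yv eta phi psi.
Let yd : dom (t, y) := dom_yv eta phi psi It.

Lemma coord_dpsi : d_psi (coordG G) t eta phi psi = Y (@e3 R) G (t, y).
Proof. exact: (vderive1_curve (c := yv eta phi) hG yd (yv_dpsi eta phi psi)). Qed.

Lemma coord_dphi : d_phi (coordG G) t eta phi psi = VD (0, yphi eta phi psi) G (t, y).
Proof.
exact: (vderive1_curve (c := fun s => yv eta s psi) hG yd (yv_dphi eta phi psi)).
Qed.

Lemma coord_deta : d_eta (coordG G) t eta phi psi = VD (0, yeta eta phi psi) G (t, y).
Proof.
exact: (vderive1_curve (c := fun s => yv s phi psi) hG yd (yv_deta eta phi psi)).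
Qed.

(** A relation between tangent vectors of R^4 becomes the same relation between derivatives, so the
    formulas for [X1] and [X2] reduce to vector identities. *)
Lemma VD_comb3 (a b c : R) (u v w z : 'rV[R]_4) : a *: u + b *: v + c *: w = z ->
  a%:C *: VD (0, u) G (t, y) + b%:C *: VD (0, v) G (t, y) + c%:C *: VD (0, w) G (t, y)
  = VD (0, z) G (t, y).
Proof.
move=> <-.
have H (k : nat -> R) (r : nat -> V) (a' b' c' : R) (u' v' w' : V) :
    k 0%N = a' -> k 1%N = b' -> k 2%N = c' -> r 0%N = u' -> r 1%N = v' -> r 2%N = w' ->
    VD (a' *: u' + b' *: v' + c' *: w') G (t, y) =
    a'%:C *: VD u' G (t, y) + b'%:C *: VD v' G (t, y) + c'%:C *: VD w' G (t, y).
  move=> <- <- <- <- <- <-; rewrite -(sum3 (fun i => k i *: r i)) VD_lin//.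
  exact: (sum3 (fun i => (k i)%:C *: VD (r i) G (t, y))).
have EP : (0, a *: u + b *: v + c *: w) = a *: ((0, u) : V) + b *: ((0, v) : V) + c *: ((0, w) : V).
  by rewrite !vpairZ !vpairD.
have HE := H (fun i => nth 0 [:: a; b; c] i) (fun i => nth 0 [:: (0, u); (0, v); (0, w)] i)
  a b c (0, u) (0, v) (0, w) erefl erefl erefl erefl erefl erefl.
by rewrite EP; exact: esym HE.
Qed.

(** Rewrites all trigonometric quantities in the half angles, subject to three Pythagorean
    relations, so that [field] decides the frame identities. *)
Lemma half_angles : exists c s ca sa cb sb : R,
  [/\ [/\ c != 0, s != 0, c ^+ 2 = 1 - s ^+ 2, ca ^+ 2 = 1 - sa ^+ 2 & cb ^+ 2 = 1 - sb ^+ 2],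
    [/\ cotan eta = (c ^+ 2 - s ^+ 2) / (2 * s * c), cosec eta = (2 * s * c)^-1,
    cos psi = ca * cb + sa * sb & sin psi = sa * cb - ca * sb],
    y = row4 (c * ca) (c * sa) (s * cb) (s * sb) &
    yeta eta phi psi = row4 (- (s * ca / 2)) (- (s * sa / 2)) (c * cb / 2) (c * sb / 2)].
Proof.
exists (cos (eta / 2)), (sin (eta / 2)), (cos ((phi + psi) / 2)), (sin ((phi + psi) / 2)),
  (cos ((phi - psi) / 2)), (sin ((phi - psi) / 2)).
have e2 : eta = eta / 2 + eta / 2 by field.
have sE : sin eta = 2 * sin (eta / 2) * cos (eta / 2) by rewrite {1}e2 sinD; ring.
have cE : cos eta = cos (eta / 2) ^+ 2 - sin (eta / 2) ^+ 2 by rewrite {1}e2 cosD; ring.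
have s0 : sin eta != 0 by rewrite gt_eqF// sin_gt0_pi.
have := s0; rewrite sE !mulf_eq0 !negb_or => /andP[/andP[_ sn] cn].
have pE : psi = (phi + psi) / 2 - (phi - psi) / 2 by field.
split=> //.
- by split=> //; apply/eqP; rewrite eq_sym subr_eq cos2Dsin2.
- split; rewrite /cotan /cosec ?cE ?sE// {1}pE.
    by rewrite cosB.
  by rewrite sinB; ring.
Qed.

Lemma coord_X1 : X1 (coordG G) t eta phi psi = Y (@e1 R) G (t, y).
Proof.
rewrite /X1 coord_dpsi coord_dphi coord_deta -[X in _ + X]scaleNr.
have -> : - (sin psi)%:C = (- sin psi)%:C :> R[i] by rewrite rmorphN.
apply: VD_comb3.
have [c [s [ca [sa [cb [sb [[c0 s0 c2 ca2 cb2] [-> -> -> ->] Ey ->]]]]]]] := half_angles.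
rewrite /= /e3 /yphi -/y Ey /e1.
by apply: row4P; rewrite ?(row4E, mxE) ?row4E; field: c2 ca2 cb2; rewrite c0 s0.
Qed.

Lemma coord_X2 : X2 (coordG G) t eta phi psi = Y (@e2 R) G (t, y).
Proof.
rewrite /X2 coord_dpsi coord_dphi coord_deta; apply: VD_comb3.
have [c [s [ca [sa [cb [sb [[c0 s0 c2 ca2 cb2] [-> -> -> ->] Ey ->]]]]]]] := half_angles.
rewrite /= /e3 /yphi -/y Ey /e2.
by apply: row4P; rewrite ?(row4E, mxE) ?row4E; field: c2 ca2 cb2; rewrite c0 s0.
Qed.

Lemma coord_dmu g : d_mu g (coordG G) t eta phi psi = (rderive1 g t)^-1 *: VD (1, 0) G (t, y).
Proof. by rewrite /d_mu /coordG vderive1_time. Qed.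

End Frame.

(** Distributes 1 / sqrt F over the operator and merges its two zeroth order terms in gamma^0. *)
Lemma scale_lincomb6 (W : lmodType R[i]) (f A1 A2 A0 d A3 B0 B1 C : R[i]) (v1 v2 v0 v3 u w : W) :
  f *: (A1 *: v1 + A2 *: v2 + A0 *: (d *: v0) + A3 *: v3 + B0 *: u - B1 *: w) + C *: u =
  (f * A1) *: v1 + (f * A2) *: v2 + (f * (A0 * d)) *: v0 + (f * A3) *: v3
  + (f * B0 + C) *: u - (f * B1) *: w.
Proof. by rewrite !scalerDr scalerN !scalerA mulrA scalerDl -!addrA [- _ + _]addrC. Qed.

Section Coefficients.
Variables (Lam p q : R[i]) (g rF rW : R -> R[i]).

(** Index 0 goes with the derivative in the path parameter t, hence the factor 1 / g'(t). *)
Definition coef_a (j : 'I_4) t : R[i] :=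
  if j == 0 then (rF t)^-1 * ((rW t)^-1 * (rderive1 g t)^-1)
  else (rF t)^-1 * ((if j == 1 then w1 p q (g t) else
    if j == 2 then w2 p q (g t) else w3 p q (g t)) / rW t).

Definition coef_b0 t : R[i] :=
  (rF t)^-1 * ((4 * rW t)^-1 * (cderive1 (w1 p q) (g t) / w1 p q (g t)
     + cderive1 (w2 p q) (g t) / w2 p q (g t) + cderive1 (w3 p q) (g t) / w3 p q (g t)))
  + 3 * cderive1 (Fconf Lam p q) (g t) / (4 * rF t ^+ 3 * rW t).

Definition coef_b1 t : R[i] :=
  (rF t)^-1 * (rW t / 4 * (1 / w1 p q (g t) ^+ 2 + 1 / w2 p q (g t) ^+ 2 + 1 / w3 p q (g t) ^+ 2)).

Variable gam : 'I_4 -> 'M[R[i]]_4.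

Definition DopW := Dop gam coef_a coef_b0 coef_b1.

Lemma tdirac_coord G t eta phi psi : vCk 1 G -> t \in `]0, 1[ -> eta \in `]0, pi[ ->
  tdirac gam Lam p q g rF rW (coordG G) t eta phi psi = coordG (DopW G) t eta phi psi.
Proof.
move=> hG It Ie; rewrite /tdirac /Defs.dirac; cbv zeta beta.

rewrite (coord_X1 phi psi hG It Ie) (coord_X2 phi psi hG It Ie) coord_dmu// coord_dpsi//.
by rewrite -scalemxAr scale_lincomb6.
Qed.

Lemma rderive1_near (f h : R -> R[i]) (x : R) : (\forall s \near x, f s = h s) ->
  rderive1 f x = rderive1 h x.
Proof.
move=> n; rewrite /rderive1 !derive1E.
by congr (_ +i* _); apply: near_eq_derive; apply: filterS n => s ->.
Qed.

Lemma vderive1_near (f h : R -> 'cV[R[i]]_4) (x : R) : (\forall s \near x, f s = h s) ->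
  vderive1 f x = vderive1 h x.
Proof.
by move=> n; apply/colP => a; rewrite !mxE; apply: rderive1_near; apply: filterS n => s ->.
Qed.

(** The inner operator takes the form [Dop] only for 0 < eta < pi. The derivatives in t and eta
    depend on germs in open intervals, those in phi and psi run along lines contained in the
    chart. *)
Lemma tdirac_local (u v : @coord_spinor R) :
  (forall t eta phi psi, t \in `]0, 1[ -> eta \in `]0, pi[ -> u t eta phi psi = v t eta phi psi) ->
  forall t eta phi psi, t \in `]0, 1[ -> eta \in `]0, pi[ ->
  tdirac gam Lam p q g rF rW u t eta phi psi = tdirac gam Lam p q g rF rW v t eta phi psi.
Proof.
move=> uv t eta phi psi It Ie.
have Ed : d_mu g u t eta phi psi = d_mu g v t eta phi psi.
  rewrite /d_mu; congr (_ *: _); apply: vderive1_near.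
  by apply: filterS (near_in_itvoo It) => s Is; apply: uv.
have Ee : d_eta u t eta phi psi = d_eta v t eta phi psi.
  apply: vderive1_near; apply: filterS (near_in_itvoo Ie) => s Is; exact: uv.
have Ep : d_psi u t eta phi psi = d_psi v t eta phi psi.
  by congr (vderive1 _ _); apply/funext => s; exact: uv.
have Eh : d_phi u t eta phi psi = d_phi v t eta phi psi.
  by congr (vderive1 _ _); apply/funext => s; exact: uv.
by rewrite /tdirac /Defs.dirac /X1 /X2 Ed Ee Ep Eh uv.
Qed.

Lemma tdirac2_coord G t eta phi psi :
  vCk 2 G -> (forall j, C1r (coef_a j)) -> C1r coef_b0 -> C1r coef_b1 ->
  t \in `]0, 1[ -> eta \in `]0, pi[ ->
  tdirac gam Lam p q g rF rW (tdirac gam Lam p q g rF rW (coordG G)) t eta phi psi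
  = coordG (DopW (DopW G)) t eta phi psi.
Proof.
move=> hG ha hb0 hb1 It Ie.
rewrite (@tdirac_local _ (coordG (DopW G)))//; last by move=> *; apply: tdirac_coord => //; exact: vCkS.
by apply: tdirac_coord => //; exact: vCk_Dop.
Qed.

End Coefficients.

End EulerCoordinates.


(** * Regularity of the coefficients *)

Section CoefficientRegularity.
Context {R : realType}.

(** The C^1 form of [mu_path] from which the regularity of the coefficients is derived; it is
    preserved by the shift and by the inversion of the path. *)
Definition mu_path1 (g : R -> R[i]) := [/\ C1r g, C1r (rderive1 g) &
  forall t, t \in `]0, 1[ -> 0 < Re (g t) /\ rderive1 g t != 0].

Variables (Lam p q : R[i]) (g rF rW : R -> R[i]).
Hypotheses (Lam0 : Lam != 0) (mg : mu_path1 g) (adm : admissible p q g).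
Hypotheses (sF : sqrt_branch g (Fconf Lam p q) rF)
  (sW : sqrt_branch g (fun mu => w1 p q mu * w2 p q mu * w3 p q mu) rW).

Let C1g : C1r g.
Proof. by case: mg. Qed.

Let C1dg : C1r (rderive1 g).
Proof. by case: mg. Qed.

Lemma C1r_holo (U : set R[i]) f : (forall t, t \in `]0, 1[ -> U (g t)) -> holo 3 U f ->
  C1r (fun t => f (g t)) /\ C1r (fun t => cderive1 f (g t)).
Proof.
move=> gU hf; split; first exact: C1r_comp gU C1g (holoS hf).
have [f' ff' hf'] := hf.
by apply: C1r_ext (C1r_comp gU C1g hf') => t It; rewrite (cder_cderive1 (ff' _ (gU t It))).
Qed.

Lemma Fconf_neq0 t : t \in `]0, 1[ -> Fconf Lam p q (g t) != 0.
Proof.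
move=> It; have [th0 dth0 _ _ _] := adm It; rewrite /Fconf.
move: (theta _ _ _) th0 (dtheta _ _ _) dth0 => a a0 b b0.
have p0 : (pi : R)%:C != 0 :> R[i] by rewrite fmorph_eq0 gt_eqF// pi_gt0.
by rewrite mulf_neq0// ?expf_neq0// mulf_neq0 ?invr_neq0 ?pnatr_eq0// mulf_neq0.
Qed.

Lemma rF_neq0 t : t \in `]0, 1[ -> rF t != 0.
Proof.
by move=> It; have [_ E] := sF It; have := Fconf_neq0 It; rewrite -E expf_eq0 /=.
Qed.

Lemma rW_neq0 t : t \in `]0, 1[ -> rW t != 0.
Proof.
move=> It; have [_ E] := sW It; have [_ _ a b c] := adm It.
suff : rW t ^+ 2 != 0 by rewrite expf_eq0.
rewrite E; move: (w1 _ _ _) a (w2 _ _ _) b (w3 _ _ _) c => x x0 y y0 z z0.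
by rewrite !mulf_neq0.
Qed.

Let regg t : t \in `]0, 1[ -> reg p q (g t).
Proof. by move=> It; have [] := adm It; have [_ _ /(_ t It)[? _]] := mg; split. Qed.

Lemma coef_C1r : [/\ forall j, C1r (coef_a p q g rF rW j), C1r (coef_b0 Lam p q g rF rW)
  & C1r (coef_b1 p q g rF rW)].
Proof.
have [W1 D1] := C1r_holo regg (holo_w1 3 p q).
have [W2 D2] := C1r_holo regg (holo_w2 3 p q).
have [W3 D3] := C1r_holo regg (holo_w3 3 p q).
have [CF DF] : C1r (fun t => Fconf Lam p q (g t)) /\ C1r (fun t => cderive1 (Fconf Lam p q) (g t)).
  apply: C1r_holo (holo_Fconf 3 Lam p q) => t It.
  by have [] := adm It; have [_ _ /(_ t It)[? _]] := mg; split.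
have hF : C1r rF.
  apply: (C1r_sqrt CF) => t It; [by have [_ ->] := sF It|exact: rF_neq0|].
  by apply: continuous_econt; have [] := sF It.
have hW : C1r rW.
  apply: (C1r_sqrt (C1rM (C1rM W1 W2) W3)) => t It; [by have [_ ->] := sW It|exact: rW_neq0|].
  by apply: continuous_econt; have [] := sW It.
have iF := C1rV rF_neq0 hF; have iW := C1rV rW_neq0 hW.
have i1 : C1r (fun t => (w1 p q (g t))^-1) by apply: C1rV => // t It; have [] := adm It.
have i2 : C1r (fun t => (w2 p q (g t))^-1) by apply: C1rV => // t It; have [] := adm It.
have i3 : C1r (fun t => (w3 p q (g t))^-1) by apply: C1rV => // t It; have [] := adm It.
have idg : C1r (fun t => (rderive1 g t)^-1).
  by apply: C1rV => // t It; have [_ _ /(_ t It)[]] := mg.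
have K c := @C1r_cst R c.
split.
- move=> j; rewrite /coef_a; case: (j == 0); first exact: C1rM iF (C1rM iW idg).
  case: (j == 1); first exact: C1rM iF (C1rM W1 iW).
  by case: (j == 2); [exact: C1rM iF (C1rM W2 iW)|exact: C1rM iF (C1rM W3 iW)].
- apply: C1rD.
    apply: (C1rM iF); apply: C1rM.
      apply: C1rV (C1rM (K 4) hW) => t It.
      by rewrite mulf_neq0 ?rW_neq0 ?pnatr_eq0.
    by apply: C1rD (C1rD (C1rM D1 i1) (C1rM D2 i2)) (C1rM D3 i3).
  apply: (C1rM (C1rM (K 3) DF)); apply: C1rV.
    by move=> t It; rewrite !mulf_neq0 ?rW_neq0 ?expf_neq0 ?rF_neq0 ?pnatr_eq0.
  by apply: C1rM hW; apply: (C1rM (K 4)); exact: C1rM hF (C1rM hF hF).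
- apply: (C1rM iF); apply: (C1rM (C1rM hW (K 4^-1))).
  have sq (a : R -> R[i]) : C1r a -> (forall t, t \in `]0, 1[ -> a t != 0) -> C1r (fun t => 1 / a t ^+ 2).
    move=> ha a0; have h : C1r (fun t => (a t * a t)^-1).
      by apply: C1rV (C1rM ha ha) => t It; rewrite mulf_neq0 ?a0.
    by apply: C1r_ext (C1rM (K 1) h) => t It; rewrite expr2.
  by apply: C1rD; [apply: C1rD|]; apply: sq => // t It; have [] := adm It.
Qed.

End CoefficientRegularity.

(** * The eigenvalue equation on the whole sphere *)

Section Density.
Context {R : realType}.
Notation V := ((R * 'rV[R]_4)%type : normedModType R).

Lemma zero_closure (f : R -> R) (eta : R) : 0 <= eta <= pi ->
  (forall s, s \in `]0, pi[ -> f s = 0) -> {for eta, continuous f} -> f eta = 0.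
Proof.
move=> /andP[e0 e1] f0 /continuousP fc; apply/eqP; rewrite -normr_le0.
apply/ler_addgt0Pl => e ep; rewrite addr0; have [d d0 hd] := fc _ ep.
have p0 := pi_gt0 R.
(* The point eta is moved by a fraction c towards pi / 2: this lands inside the open interval, and
   at distance less than d from eta. *)
pose c := Num.min (1 / 2) (d / (pi + 1)).
have c0 : 0 < c by rewrite lt_min !divr_gt0// addr_gt0.
have c1 : c <= 1 / 2 by rewrite ge_min lexx.
have q0 : 0 < (pi : R) + 1 by rewrite addr_gt0.
have c2' : c <= d / (pi + 1) by rewrite ge_min lexx orbT.
have c2 : c * (pi + 1) <= d by rewrite -(ler_pdivlMr _ _ q0).
clearbody c.
have x0 : 0 <= c * eta by rewrite mulr_ge0// ltW.
have x1 : c * eta <= c * pi by rewrite ler_pM2l.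
have x2 : 0 < c * pi by rewrite mulr_gt0.
have x3 : c * eta <= 1 / 2 * eta by rewrite ler_wpM2r.
have x4 : c * (pi - eta) <= 1 / 2 * (pi - eta) by rewrite ler_wpM2r// subr_ge0.
have := hd (eta + c * (pi / 2 - eta)); rewrite f0; last first.
  by rewrite in_itv /=; apply/andP; split; lra.
rewrite sub0r normrN; move=> h; apply: h.
rewrite [eta + _]addrC addrK ltr_norml; apply/andP; split; lra.
Qed.

Lemma yv_continuous (phi psi : R) : continuous (fun s => yv s phi psi).
Proof.
have E : (fun s => yv s phi psi) = (fun s => cos (s / 2) *:
   row4 (cos ((phi + psi) / 2)) (sin ((phi + psi) / 2)) 0 0 + sin (s / 2) *:
   row4 0 0 (cos ((phi - psi) / 2)) (sin ((phi - psi) / 2))).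
  by apply/funext => s; apply: row4P; rewrite ?(row4E, mxE); ring.
rewrite E => s.
have h : {for s, continuous (fun s : R => s / 2)} by exact: continuousM (@cvg_id _ _) (@cvg_cst _ _ _ _ _).
apply: cvgD; apply: cvgZr_tmp.
  by apply: (continuous_comp h); exact: continuous_cos.
by apply: (continuous_comp h); exact: continuous_sin.
Qed.

Definition Gof (g : R -> R[i]) (u : spinor R) (y : V) := u (g y.1) (radial y.2).

Lemma coordG_Gof g u : coordG (Gof g u) = in_coord g u.
Proof.
apply/funext => t; apply/funext => eta; apply/funext => phi; apply/funext => psi.
by rewrite /coordG /Gof /in_coord radial_yv.
Qed.

Lemma smooth_Gof g u k : smooth_section g u -> vCk k (Gof g u).
Proof. by move=> [_ H] a; have [h1 h2] := H a; split; [exact: h1|exact: h2]. Qed.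

(** Right translations do not preserve the Euler chart, so eigenspinors are compared through the
    equation on all of S^3. One direction restricts to the chart, the other is its closure in
    eta. *)
Lemma eigenP gam Lam p q g rF rW e u : smooth_section g u ->
  [/\ forall j, C1r (coef_a p q g rF rW j), C1r (coef_b0 Lam p q g rF rW)
    & C1r (coef_b1 p q g rF rW)] ->
  (forall t eta phi psi, t \in `]0, 1[ -> eta \in `]0, pi[ ->
     tdirac gam Lam p q g rF rW (tdirac gam Lam p q g rF rW (in_coord g u)) t eta phi psi
     = e *: in_coord g u t eta phi psi) <->
  (forall t y, t \in `]0, 1[ -> nsq y = 1 ->
     DopW Lam p q g rF rW gam (DopW Lam p q g rF rW gam (Gof g u)) (t, y) = e *: Gof g u (t, y)).
Proof.
move=> su [ha hb0 hb1]; have hG := smooth_Gof 2 su.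
rewrite -coordG_Gof; set G := Gof g u in hG *; set D := DopW _ _ _ _ _ _ _.
split=> H t; last first.
  move=> eta phi psi It Ie; rewrite tdirac2_coord// -/D.
  by apply: H => //; exact: nsq_yv.
move=> y It /yv_surj[eta [phi [psi [eta_pi ->]]]].
have DD : vCk 0 (D (D G)) by apply: vCk_Dop => //; exact: vCk_Dop.
apply/colP => a; rewrite [RHS]mxE; apply: subr0_eq.
pose F y := D (D G) y a 0 - e * G y a 0.
have FC : cCk (@dom R) 0 F.
  have K := cCk_cst (@dom_open R) 0.
  apply: (@eq_cCk _ _ _ (@dom_open R) 0 (fun y => D (D G) y a 0 + (- e) * G y a 0)) => [x _|].
    by rewrite mulNr.
  apply: (cCkD (@dom_open R) (DD a)); apply: (cCkM (@dom_open R) (K _)).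
  exact: (vCkS (vCkS hG)).
have yc : {for eta, continuous (fun s => (t, yv s phi psi) : V)}.
  exact: (cvg_pair (cvg_cst t) (@yv_continuous phi psi eta)).
have F0 s : s \in `]0, pi[ -> F (t, yv s phi psi) = 0.
  move=> Is; have := H t s phi psi It Is; rewrite tdirac2_coord// -/D.
  by move=> /(congr1 (fun x : 'cV_4 => x a 0)) E; rewrite /F [D _ _ _ _]E mxE subrr.
have yd : @dom R (t, yv eta phi psi) by exact: dom_yv.
have [[c1 _] [c2 _]] := FC.
apply: complexP.
  apply: (@zero_closure (fun s => Re (F (t, yv s phi psi))) eta eta_pi) => [s /F0 ->//|].
  exact: (@continuous_comp _ _ _ _ (fun y => Re (F y)) eta yc (c1 _ yd)).
apply: (@zero_closure (fun s => Im (F (t, yv s phi psi))) eta eta_pi) => [s /F0 ->//|].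
exact: (@continuous_comp _ _ _ _ (fun y => Im (F y)) eta yc (c2 _ yd)).
Qed.

End Density.


(** * The constant Clifford matrices *)

Section Clifford.
Context {R : realType}.
Variable gam : 'I_4 -> 'M[R[i]]_4.
Hypothesis cl : clifford gam.

Lemma cliffordN a b : a != b -> gam a *m gam b = - (gam b *m gam a).
Proof. by move=> /(proj2 cl)/eqP; rewrite addr_eq0 => /eqP. Qed.

Lemma cliffordN3 a b c : c != a -> c != b ->
  gam c *m (gam a *m gam b) = gam a *m gam b *m gam c.
Proof.
by move=> ca cb; rewrite mulmxA cliffordN// mulNmx -[in LHS]mulmxA (cliffordN cb) mulmxN opprK mulmxA.
Qed.

Let k := (@isqrt2 R)%:C : R[i].

Let k2 : k * k + k * k = 1.
Proof.
have := @isqrt2_sqr R; rewrite /k -rmorphM -rmorphD /= => h.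
by rewrite -mulr2n -mulr_natl h.
Qed.

(** The exponential of -(pi / 4) gamma^2 gamma^3, the spin lift of a quarter turn in the plane of
    gamma^2 and gamma^3. *)
Definition M23 : 'M[R[i]]_4 := k *: (1%:M - gam 2 *m gam 3).
Definition M23i : 'M[R[i]]_4 := k *: (1%:M + gam 2 *m gam 3).
Definition M31 : 'M[R[i]]_4 := - gam 0 *m (k *: (gam 1 - gam 3)).
Definition M31i : 'M[R[i]]_4 := - M31.

Lemma sqr23 a b : a != b -> gam a *m gam b *m (gam a *m gam b) = - 1%:M.
Proof.
move=> ab; rewrite -mulmxA (mulmxA (gam b)) (cliffordN (a := b)); last by rewrite eq_sym.
by rewrite mulNmx mulmxN !mulmxA (proj1 cl) -mulmxA (proj1 cl) mulmxN mulNmx mul1mx !opprK.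
Qed.

Lemma M23K : M23i *m M23 = 1%:M /\ M23 *m M23i = 1%:M.
Proof.
have E := sqr23 (isT : 2 != 3 :> 'I_4).
rewrite /M23 /M23i; set P := gam 2 *m gam 3 in E *.
split; rewrite -scalemxAl -scalemxAr scalerA.
  rewrite mulmxDl !mulmxBr !mul1mx !mulmx1 E opprK addrA subrK.
  by rewrite scalerDr -scalerDl k2 scale1r.
rewrite mulmxDr !mulmxBl !mul1mx !mulmx1 E opprK addrA subrK.
by rewrite scalerDr -scalerDl k2 scale1r.
Qed.

Lemma M23_gam : [/\ gam 1 *m M23 = M23 *m gam 1, gam 2 *m M23 = M23 *m gam 3,
  gam 3 *m M23 = - (M23 *m gam 2), gam 0 *m M23 = M23 *m gam 0 &
  gam 1 *m gam 2 *m gam 3 *m M23 = M23 *m (gam 1 *m gam 2 *m gam 3)].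
Proof.
have C c : c != 2 -> c != 3 -> gam c *m M23 = M23 *m gam c.
  move=> c2 c3; rewrite /M23 -scalemxAr -scalemxAl mulmxBr mulmxBl mulmx1 mul1mx.
  by rewrite cliffordN3.
have g2 : gam 2 *m M23 = M23 *m gam 3.
  rewrite /M23 -scalemxAr -scalemxAl mulmxBr mulmxBl mulmx1 mul1mx mulmxA (proj1 cl).
  by rewrite -(mulmxA (gam 2)) (proj1 cl) mulmxN mulNmx mul1mx mulmx1 opprK opprK addrC.
have g3 : gam 3 *m M23 = - (M23 *m gam 2).
  rewrite /M23 -scalemxAr -scalemxAl -scalerN mulmxBr mulmxBl mulmx1 mul1mx.
  rewrite (cliffordN (isT : 2 != 3 :> 'I_4)) mulmxN mulNmx mulmxA (proj1 cl).
  by rewrite -(mulmxA (gam 3)) (proj1 cl) mulNmx mulmxN mul1mx mulmx1 !opprK opprD opprK addrC.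
split=> //; try exact: C.
have E : gam 2 *m gam 3 *m M23 = M23 *m (gam 2 *m gam 3).
  rewrite -mulmxA g3 mulmxN (mulmxA (gam 2)) g2 -mulmxA -mulmxN.
  by rewrite (cliffordN (isT : 3 != 2 :> 'I_4)) opprK.
by rewrite -(mulmxA (gam 1)) -[LHS]mulmxA E (mulmxA (gam 1)) C// -mulmxA.
Qed.

(** Moved across gamma^1 - gamma^3, the matrices gamma^1 and gamma^3 are exchanged and every sign
    changes. The factor gamma^0 restores the sign of the spatial matrices only, so gamma^0 keeps the
    sign that compensates the reversal of the mu-axis. *)
Lemma M31_gam : [/\ gam 1 *m M31 = M31 *m gam 3, gam 2 *m M31 = M31 *m gam 2,
  gam 3 *m M31 = M31 *m gam 1, gam 0 *m M31 = - (M31 *m gam 0) &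
  gam 1 *m gam 2 *m gam 3 *m M31 = - (M31 *m (gam 1 *m gam 2 *m gam 3))].
Proof.
pose N := k *: (gam 1 - gam 3).
have M31E c : M31 *m gam c = - (gam 0 *m (N *m gam c)) by rewrite /M31 -/N mulNmx mulNmx mulmxA.
have ME c : c != 0 -> gam c *m M31 = gam 0 *m (gam c *m N).
  by move=> c0; rewrite /M31 -/N mulmxA mulmxN (cliffordN c0) opprK mulmxA.
have g1 : gam 1 *m M31 = M31 *m gam 3.
  rewrite ME// M31E -mulmxN /N -scalemxAr -scalemxAl -scalerN mulmxBr mulmxBl !(proj1 cl).
  by rewrite opprD opprK addrC.
have g3 : gam 3 *m M31 = M31 *m gam 1.
  rewrite ME// M31E -mulmxN /N -scalemxAr -scalemxAl -scalerN mulmxBr mulmxBl !(proj1 cl).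
  by rewrite !opprK opprD !opprK addrC.
have g2 : gam 2 *m M31 = M31 *m gam 2.
  rewrite ME// M31E -mulmxN /N -scalemxAr -scalemxAl -scalerN mulmxBr mulmxBl.
  rewrite (cliffordN (isT : 2 != 1 :> 'I_4)) (cliffordN (isT : 2 != 3 :> 'I_4)).
  by rewrite opprD.
have g0 : gam 0 *m M31 = - (M31 *m gam 0).
  rewrite M31E opprK /M31 -/N mulmxA mulmxN mulNmx -mulmxA -mulmxN; congr (_ *m _).
  rewrite /N -scalemxAr -scalemxAl -scalerN mulmxBr mulmxBl.
  rewrite (cliffordN (isT : 1 != 0 :> 'I_4)) (cliffordN (isT : 3 != 0 :> 'I_4)).
  by rewrite opprD.
split=> //.
have E : gam 2 *m gam 3 *m M31 = M31 *m (gam 2 *m gam 1).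
  by rewrite -mulmxA g3 (mulmxA (gam 2)) g2 -mulmxA.
rewrite -(mulmxA (gam 1)) -[LHS]mulmxA E (mulmxA (gam 1)) g1 -mulmxA -mulmxN; congr (_ *m _).
rewrite (cliffordN (isT : 2 != 1 :> 'I_4)) mulmxN; congr (- _).
by rewrite (cliffordN3 (isT : 3 != 1 :> 'I_4) (isT : 3 != 2 :> 'I_4)) mulmxA.
Qed.

Lemma M31_sqr : M31 *m M31 = - 1%:M.
Proof.
pose N := k *: (gam 1 - gam 3).
have N0 : N *m gam 0 = - (gam 0 *m N).
  rewrite /N -scalemxAr -scalemxAl -scalerN mulmxBr mulmxBl.
  rewrite (cliffordN (isT : 1 != 0 :> 'I_4)) (cliffordN (isT : 3 != 0 :> 'I_4)).
  by rewrite opprD.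
have NN : N *m N = - 1%:M.
  rewrite /N -scalemxAl -scalemxAr scalerA mulmxBl !mulmxBr !(proj1 cl).
  rewrite (cliffordN (isT : 1 != 3 :> 'I_4)) opprB opprK addrA addrAC addrK.
  by rewrite scalerDr -scalerDl k2 scale1r.
rewrite /M31 -/N !mulNmx mulmxN opprK -mulmxA (mulmxA N) N0 mulNmx -mulmxA NN !mulmxN.
by rewrite opprK mulmx1 (proj1 cl).
Qed.

Lemma M31K : M31i *m M31 = 1%:M /\ M31 *m M31i = 1%:M.
Proof. by rewrite /M31i mulNmx mulmxN M31_sqr opprK. Qed.

End Clifford.

(** * Intertwining of operators by a pullback *)

Section Pullback.
Context {R : realType}.
Notation V := ((R * 'rV[R]_4)%type : normedModType R).
Implicit Types (G : V -> 'cV[R[i]]_4) (M : 'M[R[i]]_4).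

Variables (kap : R -> R) (sg : R) (h : 'rV[R]_4 -> 'rV[R]_4) (hi : 'rV[R]_4 -> 'rV[R]_4).
Hypotheses (kapE : forall x s v, kap (s * v + x) = s * (sg * v) + kap x)
  (kap_c : continuous kap) (kapI : forall t, t \in `]0, 1[ -> kap t \in `]0, 1[)
  (hl : linear_row h) (hK : cancel h hi).

(** In the applications [kap] is t or 1 - t, of slope [sg], and [h] is a right translation. The map
    is affine, so constant directions go to constant directions. *)
Definition pull (y : V) : V := (kap y.1, h y.2).

Lemma pull_affine (x : V) (s : R) (v : V) :
  pull (s *: v + x) = s *: ((sg * v.1, h v.2) : V) + pull x.
Proof. by apply/eqP; rewrite xpair_eqE /= kapE hl !eqxx. Qed.

Lemma pull_continuous : continuous pull.
Proof.
move=> y.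
have c1 : {for y, continuous (fun y : V => kap y.1)}.
  apply: (@continuous_comp _ _ _ (fun y : V => y.1) kap); first exact: cvg_fst.
  exact: kap_c.
have c2 : {for y, continuous (fun y : V => h y.2)}.
  apply: (@continuous_comp _ _ _ (fun y : V => y.2) h); first exact: cvg_snd.
  exact: linear_row_continuous.
exact: (cvg_pair c1 c2).
Qed.

Lemma pull_dom y : dom y -> dom (pull y).
Proof.
move=> [y1 y2]; split => /=; first exact: kapI.
apply: contra_neq y2 => E; by rewrite -(hK y.2) E -{1}(linear_row0 hl) hK.
Qed.

Lemma vCk_pull k M G : vCk k G -> vCk k (fun y => M *m G (pull y)).
Proof.
by move=> hG; apply: vCk_mx; exact: (vCk_affine pull_affine pull_continuous pull_dom hG).
Qed.

Lemma VD_pull M v G y : vCk 1 G -> dom y ->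
  VD v (fun z => M *m G (pull z)) y = M *m VD (sg * v.1, h v.2) G (pull y).
Proof.
move=> hG yd.
have hL := vCk_affine pull_affine pull_continuous pull_dom hG.
by rewrite (VD_mx M v hL yd) (VD_affine _ _ _ pull_affine).
Qed.

Lemma Y_pull M f f' (G : V -> 'cV[R[i]]_4) y : vCk 1 G -> dom y ->
  (forall x, h (f x) = f' (h x)) ->
  Y f (fun z => M *m G (pull z)) y = M *m Y f' G (pull y).
Proof.
move=> hG yd E; have EP : (sg * 0, h (f y.2)) = (0, f' (h y.2)) :> V by rewrite mulr0 E.
exact: (etrans (VD_pull M (0, f y.2) hG yd) (congr1 (fun v => M *m VD v G (pull y)) EP)).
Qed.

Lemma Y_pullN M f f' (G : V -> 'cV[R[i]]_4) y : vCk 1 G -> dom y ->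
  (forall x, h (f x) = - f' (h x)) ->
  Y f (fun z => M *m G (pull z)) y = - (M *m Y f' G (pull y)).
Proof.
move=> hG yd E; have EP : (sg * 0, h (f y.2)) = - ((0, f' (h y.2)) : V) :> V.
  by apply/eqP; rewrite mulr0 E xpair_eqE /= oppr0 !eqxx.
apply: (etrans (VD_pull M (0, f y.2) hG yd)).
apply: (etrans (congr1 (fun v => M *m VD v G (pull y)) EP)).
by rewrite (VDN _ hG (pull_dom yd)) mulmxN.
Qed.

Variables (gam : 'I_4 -> 'M[R[i]]_4) (a a' : 'I_4 -> R -> R[i]) (b0 b0' b1 b1' : R -> R[i]).
Variables (ep : R[i]) (M : 'M[R[i]]_4).

Lemma pull_lincomb (c : R[i]) (x1 x2 x0 x3 u w : 'cV[R[i]]_4) :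
  c *: (M *m (x1 + x2 + x0 + x3 + u - w)) = c *: (M *m x1) + c *: (M *m x2) + c *: (M *m x0)
    + c *: (M *m x3) + c *: (M *m u) - c *: (M *m w).
Proof. by rewrite mulmxBr !mulmxDr scalerBr !scalerDr. Qed.

Lemma swap24 (W : zmodType) (x1 x2 x3 x4 x5 x6 : W) :
  x1 + x4 + x3 + x2 + x5 - x6 = x1 + x2 + x3 + x4 + x5 - x6.
Proof.
congr (_ + _ + _); rewrite -!addrA; congr (_ + _).
by rewrite addrC -addrA addrCA.
Qed.

Lemma swap14 (W : zmodType) (x1 x2 x3 x4 x5 x6 : W) :
  x4 + x2 + x3 + x1 + x5 - x6 = x1 + x2 + x3 + x4 + x5 - x6.
Proof. by congr (_ + _ + _); rewrite addrC -[x4 + x2 + x3]addrA (addrC x4) !addrA. Qed.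

Lemma pull_term (c al : R[i]) (ga ga' : 'M[R[i]]_4) (u : 'cV[R[i]]_4) : ga *m M = M *m ga' ->
  (ep * al) *: (ga *m (c *: M *m u)) = (ep * c) *: (M *m (al *: (ga' *m u))).
Proof.
move=> E; rewrite -scalemxAl -!scalemxAr mulmxA E -mulmxA !scalerA.
by rewrite mulrAC.
Qed.

Lemma pull_termN (c al : R[i]) (ga ga' : 'M[R[i]]_4) (u : 'cV[R[i]]_4) : ga *m M = - (M *m ga') ->
  (ep * al) *: (ga *m (c *: M *m u)) = - ((ep * c) *: (M *m (al *: (ga' *m u)))).
Proof.
rewrite -mulmxN => /pull_term ->; move: (ep * c) => k.
by rewrite mulNmx scalerN mulmxN scalerN.
Qed.

Lemma pull_termV (c al : R[i]) (ga ga' : 'M[R[i]]_4) (u : 'cV[R[i]]_4) : ga *m M = M *m ga' ->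
  (ep * al) *: (ga *m (- (c *: M *m u))) = - ((ep * c) *: (M *m (al *: (ga' *m u)))).
Proof. by move=> /pull_term <-; rewrite mulmxN scalerN. Qed.

Lemma pull_termNV (c al : R[i]) (ga ga' : 'M[R[i]]_4) (u : 'cV[R[i]]_4) : ga *m M = - (M *m ga') ->
  (ep * al) *: (ga *m (- (c *: M *m u))) = (ep * c) *: (M *m (al *: (ga' *m u))).
Proof. by move=> E; rewrite mulmxN scalerN (pull_termN _ _ _ E) opprK. Qed.

(** The scalar c allows a second application: the first one leaves the sign [ep] in front of the
    matrix. *)
Lemma Dop_pull23 (c : R[i]) G y : sg = 1 ->
  (forall x, h (e1 x) = e1 (h x)) -> (forall x, h (e2 x) = e3 (h x)) ->
  (forall x, h (e3 x) = - e2 (h x)) ->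
  [/\ gam 1 *m M = M *m gam 1, gam 2 *m M = M *m gam 3, gam 3 *m M = - (M *m gam 2),
    gam 0 *m M = M *m gam 0 &
    gam 1 *m gam 2 *m gam 3 *m M = M *m (gam 1 *m gam 2 *m gam 3)] ->
  [/\ a' 1 y.1 = ep * a 1 (kap y.1), a' 2 y.1 = ep * a 3 (kap y.1) & a' 3 y.1 = ep * a 2 (kap y.1)] ->
  [/\ a' 0 y.1 = ep * a 0 (kap y.1), b0' y.1 = ep * b0 (kap y.1) & b1' y.1 = ep * b1 (kap y.1)] ->
  vCk 1 G -> dom y ->
  Dop gam a' b0' b1' (fun z => (c *: M) *m G (pull z)) y =
    (ep * c) *: (M *m Dop gam a b0 b1 G (pull y)).
Proof.
move=> sg1 h1 h2 h3 [g1 g2 g3 g0 g4] [a1 a2 a3] [a0 hb0 hb1] hG yd.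
rewrite /Dop (Y_pull _ hG yd h1) (Y_pull _ hG yd h2) (Y_pullN _ hG yd h3).
rewrite (VD_pull _ _ hG yd) a1 a2 a3 a0 hb0 hb1.
rewrite (_ : (sg * ((1, 0) : V).1, h ((1, 0) : V).2) = (1, 0)); last first.
  by rewrite sg1 mulr1 (linear_row0 hl).
move: (Y (@e1 R) G _) (Y (@e2 R) G _) (Y (@e3 R) G _) (VD _ _ _) (G _) => u1 u2 u3 u0 u.
rewrite (pull_term _ _ _ g1) (pull_term _ _ _ g2) (pull_termNV _ _ _ g3).
rewrite (pull_term _ _ _ g0) (pull_term _ _ _ g4) (pull_term _ _ _ g0).
rewrite pull_lincomb; exact: swap24.
Qed.

(** Signs cancel in pairs: slope -1 against anticommutation with gamma^0 in the t-derivative, the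
    image -e3 of e1 against the sign of [a' 1], and anticommutation against the signs of b0 and b1
    in the zeroth order terms. *)
Lemma Dop_pull31 (c : R[i]) G y : sg = - 1 ->
  (forall x, h (e1 x) = - e3 (h x)) -> (forall x, h (e2 x) = e2 (h x)) ->
  (forall x, h (e3 x) = e1 (h x)) ->
  [/\ gam 1 *m M = M *m gam 3, gam 2 *m M = M *m gam 2, gam 3 *m M = M *m gam 1,
    gam 0 *m M = - (M *m gam 0) &
    gam 1 *m gam 2 *m gam 3 *m M = - (M *m (gam 1 *m gam 2 *m gam 3))] ->
  [/\ a' 1 y.1 = - (ep * a 3 (kap y.1)), a' 2 y.1 = ep * a 2 (kap y.1)
    & a' 3 y.1 = ep * a 1 (kap y.1)] ->
  [/\ a' 0 y.1 = ep * a 0 (kap y.1), b0' y.1 = - (ep * b0 (kap y.1))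
    & b1' y.1 = - (ep * b1 (kap y.1))] ->
  vCk 1 G -> dom y ->
  Dop gam a' b0' b1' (fun z => (c *: M) *m G (pull z)) y =
    (ep * c) *: (M *m Dop gam a b0 b1 G (pull y)).
Proof.
move=> sg1 h1 h2 h3 [g1 g2 g3 g0 g4] [a1 a2 a3] [a0 hb0 hb1] hG yd.
rewrite /Dop (Y_pullN _ hG yd h1) (Y_pull _ hG yd h2) (Y_pull _ hG yd h3).
rewrite (VD_pull _ _ hG yd) a1 a2 a3 a0 hb0 hb1.
have EN : (sg * ((1, 0) : V).1, h ((1, 0) : V).2) = - ((1, 0) : V).
  by apply/eqP; rewrite sg1 mulr1 (linear_row0 hl) xpair_eqE /= oppr0 !eqxx.
rewrite EN (VDN _ hG (pull_dom yd)).
move: (Y (@e1 R) G _) (Y (@e2 R) G _) (Y (@e3 R) G _) (VD _ _ _) (G _) => u1 u2 u3 u0 u.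
have -> : c *: M *m - u0 = - (c *: M *m u0) by rewrite mulmxN.
rewrite !scaleNr (pull_termV _ _ _ g1) (pull_term _ _ _ g2) (pull_term _ _ _ g3).
rewrite (pull_termNV _ _ _ g0) (pull_termN _ _ _ g4) (pull_termN _ _ _ g0) !opprK.
rewrite pull_lincomb; exact: swap14.
Qed.

End Pullback.


(** * Transport of eigenspinors and isospectrality *)

Section Transport.
Context {R : realType}.
Notation V := ((R * 'rV[R]_4)%type : normedModType R).

Definition pair_of (y : 'rV[R]_4) : R[i] * R[i] := (y 0 0 +i* y 0 1, y 0 2 +i* y 0 3).
Definition row_of (x : R[i] * R[i]) : 'rV[R]_4 := row4 (Re x.1) (Im x.1) (Re x.2) (Im x.2).

Lemma row_ofK : cancel row_of pair_of.
Proof. by case=> [[a b] [c d]]; rewrite /pair_of /row_of !row4E. Qed.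

Lemma pair_ofK : cancel pair_of row_of.
Proof. by move=> y; rewrite /row_of; apply: row4P; rewrite !row4E. Qed.

Lemma radialE y : radial y = pair_of ((Num.sqrt (nsq y))^-1 *: y).
Proof. by rewrite /radial -/(nsq y) /pair_of !mxE; congr (_ +i* _, _ +i* _); rewrite mulrC. Qed.

Lemma sphere3P y : sphere3 (pair_of y) <-> nsq y = 1.
Proof.
have E (a b : R) : `|a +i* b| ^+ 2 = (a ^+ 2 + b ^+ 2)%:C :> R[i].
  by rewrite nrmE -rmorphXn /= sqr_sqrtr// addr_ge0// sqr_ge0.
rewrite /sphere3 /pair_of /= !E -rmorphD /= nsqE !addrA.
by split=> [[] //|->].
Qed.

Definition transport (M : 'M[R[i]]_4) (m : R[i] -> R[i]) (h : 'rV[R]_4 -> 'rV[R]_4)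
  (u : spinor R) : spinor R := fun mu x => M *m u (m mu) (pair_of (h (row_of x))).

Lemma transportK (M Mi : 'M[R[i]]_4) m mi h hi : Mi *m M = 1%:M -> cancel mi m -> cancel hi h ->
  cancel (transport M m h) (transport Mi mi hi).
Proof.
move=> MM mK hK u; apply/funext => mu; apply/funext => x.
by rewrite /transport mulmxA MM mul1mx mK pair_ofK hK row_ofK.
Qed.

Section Direction.
Variables (g g' : R -> R[i]) (kap : R -> R) (sg : R) (h hi : 'rV[R]_4 -> 'rV[R]_4).
Variables (m : R[i] -> R[i]) (M : 'M[R[i]]_4).
Hypotheses (kapE : forall x s v, kap (s * v + x) = s * (sg * v) + kap x)
  (kap_c : continuous kap) (kapI : forall t, t \in `]0, 1[ -> kap t \in `]0, 1[)
  (kapK : involutive kap)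
  (hl : linear_row h) (hK : cancel h hi) (hn : forall y, nsq (h y) = nsq y).
Hypotheses (mg : forall t, m (g' t) = g (kap t)) (m_inj : injective m).

Lemma Gof_transport u : Gof g' (transport M m h u) = fun y => M *m Gof g u (pull kap h y).
Proof.
apply/funext => y; rewrite /Gof /transport /= mg !radialE pair_ofK hn.
by rewrite (linear_rowZ hl).
Qed.

Lemma smooth_transport u : smooth_section g u -> smooth_section g' (transport M m h u).
Proof.
move=> su; split=> [mu x H|a].
  rewrite /transport (proj1 su) ?mulmx0// => -[[s Is gs] /sphere3P]; rewrite hn => nx.
  apply: H; split; last by rewrite -(row_ofK x); apply/sphere3P.
  exists (kap s); first exact: kapI.
  by apply: m_inj; rewrite mg kapK.
have H k : cCk (@dom R) k (fun y => Gof g' (transport M m h u) y a ord0).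
  rewrite Gof_transport.
  exact: (vCk_pull kapE kap_c kapI hl hK M (smooth_Gof k su)).
by split=> k; have [] := H k.
Qed.

End Direction.

Section Bijection.
Variables (gam : 'I_4 -> 'M[R[i]]_4) (Lam p q p' q' : R[i]) (g rF rW g' rF' rW' : R -> R[i]).
Variables (kap : R -> R) (sg : R) (h hi : 'rV[R]_4 -> 'rV[R]_4).
Variables (m mi : R[i] -> R[i]) (M Mi : 'M[R[i]]_4) (ep : R[i]).
Hypotheses (kapE : forall x s v, kap (s * v + x) = s * (sg * v) + kap x)
  (kap_c : continuous kap) (kapI : forall t, t \in `]0, 1[ -> kap t \in `]0, 1[)
  (kapK : involutive kap).
Hypotheses (hl : linear_row h) (hK : cancel h hi) (hn : forall y, nsq (h y) = nsq y)
  (hil : linear_row hi) (hiK : cancel hi h) (hin : forall y, nsq (hi y) = nsq y).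
Hypotheses (mK : cancel m mi) (miK : cancel mi m) (mg : forall t, m (g' t) = g (kap t)).
Hypotheses (MiM : Mi *m M = 1%:M) (MMi : M *m Mi = 1%:M) (ep2 : ep ^+ 2 = 1).
Hypotheses (cC : [/\ forall j, C1r (coef_a p q g rF rW j), C1r (coef_b0 Lam p q g rF rW)
    & C1r (coef_b1 p q g rF rW)])
  (cC' : [/\ forall j, C1r (coef_a p' q' g' rF' rW' j), C1r (coef_b0 Lam p' q' g' rF' rW')
    & C1r (coef_b1 p' q' g' rF' rW')]).

Let D := DopW Lam p q g rF rW gam.
Let D' := DopW Lam p' q' g' rF' rW' gam.

Hypothesis Dpull : forall (c : R[i]) G (y : V), vCk 1 G -> dom y ->
  D' (fun z => (c *: M) *m G (pull kap h z)) y = (ep * c) *: (M *m D G (pull kap h y)).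

Let T := transport M m h.
Let E := eigenspinors gam Lam p q g rF rW.
Let E' := eigenspinors gam Lam p' q' g' rF' rW'.

Let mig t : mi (g t) = g' (kap t).
Proof. by rewrite -(mK (g' (kap t))) mg kapK. Qed.

(** Each application contributes the sign [ep], so the squares are intertwined without sign. *)
Lemma Dop2_pull G (y : V) : vCk 2 G -> dom y ->
  D' (D' (fun z => M *m G (pull kap h z))) y = M *m D (D G) (pull kap h y).
Proof.
move=> hG yd; have [ca cb0 cb1] := cC; have [ca' cb0' cb1'] := cC'.
have hDG : vCk 1 (D G) by exact: vCk_Dop.
have step z : dom z -> D' (fun z => M *m G (pull kap h z)) z = (ep *: M) *m D G (pull kap h z).
  move=> zd; have := Dpull 1 (vCkS hG) zd; rewrite scale1r mulr1 => ->.
  by rewrite scalemxAl.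
have h1 : vCk 1 (D' (fun z => M *m G (pull kap h z))).
  have hP := vCk_pull kapE kap_c kapI hl hK M hG.
  exact: (@vCk_Dop _ gam _ _ _ 1 _ isT ca' cb0' cb1' hP).
have h2 := vCk_pull kapE kap_c kapI hl hK (ep *: M) hDG.
apply: (etrans (eq_Dop _ _ _ _ yd step h1 h2)).
apply: (etrans (Dpull ep hDG yd)).
by rewrite -expr2 ep2 scale1r.
Qed.

Lemma eigen_transport e u : smooth_section g u -> E e u <-> E' e (T u).
Proof.
move=> su; have su' : smooth_section g' (T u).
  exact: (smooth_transport _ kapE kap_c kapI kapK hl hK hn mg (can_inj mK) su).
have GT : Gof g' (T u) = fun y => M *m Gof g u (pull kap h y).
  exact: (Gof_transport _ hl hn mg).
have hG := smooth_Gof 2 su.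
have A := eigenP gam e su cC; have B := eigenP gam e su' cC'.
rewrite -/D in A; rewrite -/D' GT in B.
split=> -[_ H]; split=> //.
  apply: (proj2 B) => t y It ny; have yd : @dom R (t, y) by split=> //; exact: nsq1_neq0.
  have nh : nsq (h y) = 1 by rewrite hn.
  have Hk := proj1 A H (kap t) (h y) (kapI It) nh.
  apply: etrans (Dop2_pull hG yd) _; apply: etrans (congr1 (mulmx M) Hk) _.
  by rewrite scalemxAr.
apply: (proj2 A) => t y It ny.
(* The converse is evaluated at the preimage (kap t, hi y) of the given point, and the matrix is
   removed by [Mi]. *)
have nh : nsq (hi y) = 1 by rewrite hin.
have yd : @dom R (kap t, hi y) by split; [exact: kapI|exact: nsq1_neq0].
have Hk := proj1 B H (kap t) (hi y) (kapI It) nh.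
have EP : pull kap h (kap t, hi y) = (t, y) by rewrite /pull /= kapK hiK.
have {}Hk := etrans (esym (Dop2_pull hG yd)) Hk; rewrite EP in Hk.
have := congr1 (mulmx Mi) Hk.
by rewrite mulmxA MiM mul1mx -scalemxAr mulmxA MiM mul1mx.
Qed.

Lemma transport_bij e : set_bij (E e) (E' e) T.
Proof.
have TK : cancel T (transport Mi mi hi) by exact: transportK.
have TiK : cancel (transport Mi mi hi) T by exact: transportK.
split.
- by move=> u Eu; apply/eigen_transport => //; case: Eu.
- by move=> u v _ _ /(congr1 (transport Mi mi hi)); rewrite !TK.
- move=> v Ev; exists (transport Mi mi hi v); last exact: TiK.
  have sv : smooth_section g (transport Mi mi hi v).
    apply: (smooth_transport _ kapE kap_c kapI kapK hil hiK hin mig (can_inj miK)).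
    by case: Ev.
  by apply/eigen_transport => //; rewrite TiK.
Qed.

Lemma transport_isospectral : isospectral E E'.
Proof.
split=> [|e]; last first.
  exists T; last exact: transport_bij.
  move=> c u v; apply/funext => mu; apply/funext => x.
  by rewrite /T /transport mulmxDr scalemxAr.
apply/seteqP; split=> e [u Eu [mu [x u0]]]; have [f1 _ f3] := transport_bij e.
  exists (T u); first exact: f1.
  exists (mi mu), (pair_of (hi (row_of x))).
  apply: contraNneq u0; rewrite /T /transport miK pair_ofK hiK row_ofK => H.
  by rewrite -[u mu x]mul1mx -MiM -mulmxA H mulmx0.
have [v Ev vu] := f3 _ Eu; exists v => //; exists (m mu), (pair_of (h (row_of x))).
by apply: contraNneq u0 => H; rewrite -vu /T /transport H mulmx0.
Qed.

End Bijection.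

End Transport.


(** * Reversal of the parameter and the transformed paths *)

Section Reversal.
Context {R : realType}.
Implicit Types (a g : R -> R[i]) (t : R).
Local Notation rc := (fun t : R => t%:C).

Lemma nrmCN (h : R) : nrm ((- h)%:C : R[i]) = nrm (h%:C : R[i]).
Proof. by rewrite !nrm_real normrN. Qed.

Lemma econt_rev a t : econt rc a (1 - t) -> econt rc (fun s => a (1 - s)) t.
Proof.
move=> H e e0; have [d d0 hd] := H e e0; exists d => // h hh.
have := hd (- h); rewrite nrmCN => /(_ hh).
by rewrite opprD addrA.
Qed.

Lemma rder_rev a t l : rder a (1 - t) l -> rder (fun s => a (1 - s)) t (- l).
Proof.
move=> H e e0; have [d d0 hd] := H e e0; exists d => // h hh.
have := hd (- h); rewrite nrmCN => /(_ hh).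
have -> : (- h)%:C = - h%:C :> R[i] by rewrite rmorphN.
by rewrite mulrN mulNr opprK opprD addrA.
Qed.

Lemma rev_I t : t \in `]0, 1[ -> 1 - t \in `]0, 1[.
Proof. by rewrite !in_itv /= => /andP[a b]; apply/andP; split; lra. Qed.

Lemma C1r_rev a : C1r a -> C1r (fun t => a (1 - t)).
Proof.
move=> [a' h1 h2]; exists (fun t => -1 * a' (1 - t)) => t It.
  by rewrite mulN1r; apply: rder_rev; apply: h1; exact: rev_I.
apply: econtM; first exact: econt_cst.
by apply: econt_rev; apply: h2; exact: rev_I.
Qed.

Lemma mu_path_C1 g : mu_path g -> mu_path1 g.
Proof. by move=> [/smooth_C1r[h1 h2 _] h3]. Qed.

Lemma rderive1_shift_path g t : mu_path g -> t \in `]0, 1[ -> rderive1 (shift_path g) t = rderive1 g t.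
Proof.
move=> [/smooth_C1r[_ _ h] _] It; apply: rder_rderive1.
by rewrite -[rderive1 g t]addr0; apply: derD (h t It) _; exact: der_cst.
Qed.

Lemma mu_path1_shift g : mu_path g -> mu_path1 (shift_path g).
Proof.
move=> mg; have [h1 h2 h3] := mu_path_C1 mg; split.
- by apply: C1rD h1 _; exact: C1r_cst.
- by apply: C1r_ext h2 => t It; rewrite rderive1_shift_path.
- move=> t It; rewrite rderive1_shift_path//; have [k1 k2] := h3 t It; split=> //.
  by rewrite /shift_path ReD /= addr0.
Qed.

Lemma g_neq0 g t : mu_path g -> t \in `]0, 1[ -> g t != 0.
Proof. by move=> [_ h] /h[k _]; exact: Re_gt0_neq0. Qed.

Lemma rderive1_inv_path g t : mu_path g -> t \in `]0, 1[ ->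
  rderive1 (inv_path g) t = rderive1 g (1 - t) / g (1 - t) ^+ 2.
Proof.
move=> mg It; have It' := rev_I It; have [_ _ h] := smooth_C1r (proj1 mg).
apply: rder_rderive1; have := @derV _ _ rc (fun s => g (1 - s)) t _ (g_neq0 mg It') (rder_rev (h _ It')).
by rewrite opprK.
Qed.

Lemma mu_path1_inv g : mu_path g -> mu_path1 (inv_path g).
Proof.
move=> mg; have [h1 h2 h3] := mu_path_C1 mg.
have n0 t : t \in `]0, 1[ -> g (1 - t) != 0 by move=> /rev_I; exact: g_neq0.
split.
- exact: C1rV n0 (C1r_rev h1).
- apply: C1r_ext (C1rM (C1r_rev h2) (C1rV _ (C1rM (C1r_rev h1) (C1r_rev h1)))).
    by move=> t It; rewrite rderive1_inv_path// expr2.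
  by move=> t It; rewrite mulf_neq0// n0.
- move=> t It; have [k1 k2] := h3 _ (rev_I It).
  split; first exact: Re_inv_gt0.
  rewrite rderive1_inv_path//; move: (g (1 - t)) (n0 t It) (rderive1 g (1 - t)) k2 => x x0 y y0.
  by rewrite mulf_neq0// invr_neq0 ?expf_neq0.
Qed.

End Reversal.

(** * Coefficients as functions of the product of the roots *)

Section CoefficientAlgebra.
Context {R : realType}.
Implicit Types (f w ep : R[i]).

(** Division by zero gives zero, so a zero of the denominator makes F vanish as well. Admissibility
    of the new characteristics can thus be read off F. *)
Lemma Fconf_neq0E (Lam p q mu : R[i]) : Fconf Lam p q mu != 0 ->
  theta p q mu != 0 /\ dtheta p q mu != 0.
Proof.
rewrite /Fconf; move: (theta _ _ _) (dtheta _ _ _) => a b h.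
by split; apply: contraNneq h => ->; rewrite ?mul0r ?invr0 ?mulr0 expr0n /= mulr0.
Qed.

Lemma cder_holo (U : set R[i]) F z : U z -> holo 1 U F -> cder F z (cderive1 F z).
Proof. by move=> Uz [F' h _]; rewrite (cder_cderive1 (h _ Uz)); exact: h. Qed.

Lemma cderive1_shift (f f1 : R[i] -> R[i]) mu l : 0 < Re mu ->
  (forall z, 0 < Re z -> f1 (z + 'i) = f z) -> cder f mu l -> cderive1 f1 (mu + 'i) = l.
Proof.
move=> mu0 H hf; apply: cder_cderive1.
apply: (@cder_halfplane _ (fun w => f (w + - 'i))).
- by rewrite ReD /= addr0.
- move=> w w0; rewrite -H ?subrK// ReD ReN /=; lra.
have h1 : cder (fun w => w + - 'i) (mu + 'i) (1 + 0) by apply: derD (cder_id _) (der_cst _ _ _).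
rewrite addr0 in h1; rewrite -[l]mulr1.
by apply: (der_comp (g := fun w => w + - 'i) (f := f) h1); rewrite addrK.
Qed.

Lemma cderive1_inv2 (f f1 : R[i] -> R[i]) (c nu l : R[i]) : 0 < Re nu ->
  (forall z, 0 < Re z -> f1 z = c * (z^-1 ^+ 2 * f z^-1)) -> cder f nu l ->
  cderive1 f1 nu^-1 = - c * (2 * nu ^+ 3 * f nu + nu ^+ 4 * l).
Proof.
move=> nu0 H hf; have n0 := Re_gt0_neq0 nu0; have m0 := Re_inv_gt0 nu0.
have i0 : nu^-1 != 0 by rewrite invr_neq0.
have hi := cder_inv i0.
have hfi : cder (fun z => f z^-1) nu^-1 (l * - (nu^-1)^-1 ^+ 2).
  by apply: (der_comp hi); rewrite invrK.
have hc := derZ c (derM (derM hi hi) hfi).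
have K := @cder_halfplane _ _ f1 _ _ m0 (fun z z0 => esym (H z z0)) hc.
rewrite (cder_cderive1 K) !invrK; ring.
Qed.

Lemma cderive1_sqr_inv (f f1 : R[i] -> R[i]) (nu l : R[i]) : 0 < Re nu ->
  (forall z, 0 < Re z -> f1 z = - (z ^+ 2 * f z^-1)) -> cder f nu l ->
  cderive1 f1 nu^-1 = l - 2 * nu^-1 * f nu.
Proof.
move=> nu0 H hf; have n0 := Re_gt0_neq0 nu0; have m0 := Re_inv_gt0 nu0.
have i0 : nu^-1 != 0 by rewrite invr_neq0.
have hi := cder_inv i0.
have hfi : cder (fun z => f z^-1) nu^-1 (l * - (nu^-1)^-1 ^+ 2).
  by apply: (der_comp hi); rewrite invrK.
have hid := cder_id (nu^-1).
have hc := derZ (-1) (derM (derM hid hid) hfi).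
have K := @cder_halfplane _ _ f1 _ _ m0 (fun z z0 => etrans (mulN1r _) (esym (H z z0))) hc.
by rewrite (cder_cderive1 K) !invrK; field.
Qed.

Lemma a_alg (f w W : R[i]) : f^-1 * (W / w) = (f * w)^-1 * W.
Proof. by rewrite invfM mulrA mulrAC. Qed.

Lemma a0_alg (f w d : R[i]) : f^-1 * (w^-1 * d) = (f * w)^-1 * d.
Proof. by rewrite invfM mulrA. Qed.

(** Since f^2 is F, the cube in the conformal term leaves a single root: the coefficient is 1 / (f
    w) times a quantity free of roots. *)
Lemma b0_alg (f w S dF : R[i]) : f != 0 -> w != 0 ->
  f^-1 * ((4 * w)^-1 * S) + 3 * dF / (4 * f ^+ 3 * w)
  = (f * w)^-1 * (S / 4 + 3 * dF / (4 * f ^+ 2)).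
Proof. by move=> f0 w0; field; rewrite f0 w0. Qed.

Lemma b1_alg (f w Q : R[i]) : f != 0 -> f^-1 * (w / 4 * Q) = (f * w) * Q / (4 * f ^+ 2).
Proof. by move=> f0; field; rewrite f0. Qed.

Lemma sign_inv ep : ep ^+ 2 = 1 -> ep^-1 = ep.
Proof.
move=> e2; have e0 : ep != 0 by apply: contra_eq_neq e2 => ->; rewrite expr0n eq_sym oner_eq0.
by apply: (mulfI e0); rewrite mulfV// -expr2.
Qed.

Section Values.
Variables (Lam p q : R[i]) (g rF rW : R -> R[i]).
Hypotheses (Lam0 : Lam != 0) (adm : admissible p q g).
Hypotheses (sF : sqrt_branch g (Fconf Lam p q) rF)
  (sW : sqrt_branch g (fun mu => w1 p q mu * w2 p q mu * w3 p q mu) rW).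

Lemma coef_b0E t : t \in `]0, 1[ -> coef_b0 Lam p q g rF rW t = (rF t * rW t)^-1 *
  ((cderive1 (w1 p q) (g t) / w1 p q (g t) + cderive1 (w2 p q) (g t) / w2 p q (g t)
    + cderive1 (w3 p q) (g t) / w3 p q (g t)) / 4
   + 3 * cderive1 (Fconf Lam p q) (g t) / (4 * Fconf Lam p q (g t))).
Proof.
move=> It; have [_ <-] := sF It.
by rewrite /coef_b0 b0_alg ?(rF_neq0 Lam0 adm sF)// (rW_neq0 adm sW).
Qed.

Lemma coef_b1E t : t \in `]0, 1[ -> coef_b1 p q g rF rW t = rF t * rW t *
  (1 / w1 p q (g t) ^+ 2 + 1 / w2 p q (g t) ^+ 2 + 1 / w3 p q (g t) ^+ 2) /
  (4 * Fconf Lam p q (g t)).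
Proof.
move=> It; have [_ <-] := sF It.
by rewrite /coef_b1 b1_alg ?(rF_neq0 Lam0 adm sF).
Qed.

Lemma r_neq0 t : t \in `]0, 1[ -> rF t * rW t != 0.
Proof. by move=> It; rewrite mulf_neq0 ?(rF_neq0 Lam0 adm sF)// (rW_neq0 adm sW). Qed.

Lemma r_econt t : t \in `]0, 1[ -> econt (fun t : R => t%:C) (fun t => rF t * rW t) t.
Proof.
by move=> It; apply: econtM; apply: continuous_econt; [have [] := sF It|have [] := sW It].
Qed.

Lemma r_sqr t : t \in `]0, 1[ -> (rF t * rW t) ^+ 2 =
  Fconf Lam p q (g t) * (w1 p q (g t) * w2 p q (g t) * w3 p q (g t)).
Proof. by move=> It; have [_ <-] := sF It; have [_ <-] := sW It; rewrite exprMn. Qed.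

Lemma cder_data t : 0 < Re (g t) -> t \in `]0, 1[ -> [/\
  cder (w1 p q) (g t) (cderive1 (w1 p q) (g t)), cder (w2 p q) (g t) (cderive1 (w2 p q) (g t)),
  cder (w3 p q) (g t) (cderive1 (w3 p q) (g t)) &
  cder (Fconf Lam p q) (g t) (cderive1 (Fconf Lam p q) (g t))].
Proof.
move=> g0 It; have [t0 d0 _ _ _] := adm It.
have rg : reg p q (g t) by split.
split; [exact: cder_holo rg (holo_w1 1 p q)|exact: cder_holo rg (holo_w2 1 p q)
  |exact: cder_holo rg (holo_w3 1 p q)|].
exact: (@cder_holo [set mu | 0 < Re mu /\ dtheta p q mu != 0] _ _ (conj g0 d0) (holo_Fconf 1 Lam p q)).
Qed.

End Values.

End CoefficientAlgebra.


(** * Relations between the coefficients of the three operators *)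

Section Relations.
Context {R : realType}.
Local Notation rc := (fun t : R => t%:C).

Lemma coef_aE (p q : R[i]) (g rF rW : R -> R[i]) t :
  [/\ coef_a p q g rF rW 0 t = (rF t * rW t)^-1 * (rderive1 g t)^-1,
    coef_a p q g rF rW 1 t = (rF t * rW t)^-1 * w1 p q (g t),
    coef_a p q g rF rW 2 t = (rF t * rW t)^-1 * w2 p q (g t) &
    coef_a p q g rF rW 3 t = (rF t * rW t)^-1 * w3 p q (g t)].
Proof. by split; [exact: a0_alg|exact: a_alg|exact: a_alg|exact: a_alg]. Qed.

Lemma sign_mul (ep x y : R[i]) : ep ^+ 2 = 1 -> (ep * x)^-1 * y = ep * (x^-1 * y).
Proof. by move=> /sign_inv E; rewrite invfM E mulrA. Qed.

Lemma inv_a_alg (ep n r W s : R[i]) : ep ^+ 2 = 1 -> n != 0 -> r != 0 ->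
  (ep * (n ^+ 2 * r))^-1 * (s * (n ^+ 2 * W)) = s * (ep * (r^-1 * W)).
Proof. by move=> e2 n0 r0; rewrite sign_mul//; field; rewrite n0 r0. Qed.

Lemma inv_a0_alg (ep n r d : R[i]) : ep ^+ 2 = 1 -> n != 0 -> r != 0 -> d != 0 ->
  (ep * (n ^+ 2 * r))^-1 * (d / n ^+ 2)^-1 = ep * (r^-1 * d^-1).
Proof. by move=> e2 n0 r0 d0; rewrite sign_mul//; field; rewrite n0 r0 d0. Qed.

(** The weight n^2 contributes 2 n to each of the three logarithmic derivatives, 6 n / 4 in total.
    The weight n^-2 of F contributes exactly the opposite, which is where the conformal factor is
    essential. *)
Lemma inv_b0_alg (ep n r W1 W2 W3 l1 l2 l3 F l : R[i]) : ep ^+ 2 = 1 -> n != 0 -> r != 0 ->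
  W1 != 0 -> W2 != 0 -> W3 != 0 -> F != 0 ->
  (ep * (n ^+ 2 * r))^-1 * ((- - 1 * (2 * n ^+ 3 * W3 + n ^+ 4 * l3) / (- 1 * (n ^+ 2 * W3))
    + - 1 * (2 * n ^+ 3 * W2 + n ^+ 4 * l2) / (1 * (n ^+ 2 * W2))
    + - 1 * (2 * n ^+ 3 * W1 + n ^+ 4 * l1) / (1 * (n ^+ 2 * W1))) / 4
    + 3 * (l - 2 * n^-1 * F) / (4 * - (n^-1 ^+ 2 * F)))
  = - (ep * (r^-1 * ((l1 / W1 + l2 / W2 + l3 / W3) / 4 + 3 * l / (4 * F)))).
Proof.
move=> e2 n0 r0 h1 h2 h3 F0; rewrite sign_mul//.
by field; rewrite n0 r0 h1 h2 h3 F0.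
Qed.

Lemma inv_b1_alg (ep n r W1 W2 W3 F : R[i]) : n != 0 ->
  W1 != 0 -> W2 != 0 -> W3 != 0 -> F != 0 ->
  ep * (n ^+ 2 * r) * (1 / (- 1 * (n ^+ 2 * W3)) ^+ 2 + 1 / (1 * (n ^+ 2 * W2)) ^+ 2
    + 1 / (1 * (n ^+ 2 * W1)) ^+ 2) / (4 * - (n^-1 ^+ 2 * F))
  = - (ep * (r * (1 / W1 ^+ 2 + 1 / W2 ^+ 2 + 1 / W3 ^+ 2) / (4 * F))).
Proof. by move=> n0 h1 h2 h3 F0; field; rewrite n0 h1 h2 h3 F0. Qed.

Lemma shift_b0_alg (ep r W1 W2 W3 l1 l2 l3 X : R[i]) : ep ^+ 2 = 1 ->
  (ep * r)^-1 * ((l1 / W1 + l3 / W3 + l2 / W2) / 4 + X) =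
  ep * (r^-1 * ((l1 / W1 + l2 / W2 + l3 / W3) / 4 + X)).
Proof. by move=> e2; rewrite (sign_mul _ _ e2) [in LHS]addrAC. Qed.

Lemma shift_b1_alg (ep r x1 x2 x3 X : R[i]) :
  ep * r * (x1 + x3 + x2) / X = ep * (r * (x1 + x2 + x3) / X).
Proof. by rewrite [in LHS]addrAC !mulrA. Qed.

Lemma coef_b0_val (Lam p q : R[i]) (g rF rW : R -> R[i]) t (r W1 W2 W3 l1 l2 l3 F l : R[i]) :
  Lam != 0 -> admissible p q g -> sqrt_branch g (Fconf Lam p q) rF ->
  sqrt_branch g (fun mu => w1 p q mu * w2 p q mu * w3 p q mu) rW -> t \in `]0, 1[ ->
  rF t * rW t = r -> w1 p q (g t) = W1 -> w2 p q (g t) = W2 -> w3 p q (g t) = W3 ->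
  Fconf Lam p q (g t) = F -> cderive1 (w1 p q) (g t) = l1 -> cderive1 (w2 p q) (g t) = l2 ->
  cderive1 (w3 p q) (g t) = l3 -> cderive1 (Fconf Lam p q) (g t) = l ->
  coef_b0 Lam p q g rF rW t = r^-1 * ((l1 / W1 + l2 / W2 + l3 / W3) / 4 + 3 * l / (4 * F)).
Proof.
move=> L0 ad bF bW It <- <- <- <- <- <- <- <- <-.
exact: (coef_b0E L0 ad bF bW It).
Qed.

Lemma coef_b1_val (Lam p q : R[i]) (g rF rW : R -> R[i]) t (r W1 W2 W3 F : R[i]) :
  Lam != 0 -> admissible p q g -> sqrt_branch g (Fconf Lam p q) rF -> t \in `]0, 1[ ->
  rF t * rW t = r -> w1 p q (g t) = W1 -> w2 p q (g t) = W2 -> w3 p q (g t) = W3 ->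
  Fconf Lam p q (g t) = F ->
  coef_b1 p q g rF rW t = r * (1 / W1 ^+ 2 + 1 / W2 ^+ 2 + 1 / W3 ^+ 2) / (4 * F).
Proof. by move=> L0 ad bF It <- <- <- <- <-; exact: (coef_b1E rW L0 ad bF It). Qed.

Variables (Lam p q : R[i]) (g rF rW : R -> R[i]).
Hypotheses (Lam0 : Lam != 0) (mg : mu_path g) (adm : admissible p q g).
Hypotheses (sF : sqrt_branch g (Fconf Lam p q) rF)
  (sW : sqrt_branch g (fun mu => w1 p q mu * w2 p q mu * w3 p q mu) rW).

Let g_gt0 t : t \in `]0, 1[ -> 0 < Re (g t).
Proof. by move=> It; have [] := (proj2 mg) t It. Qed.

Let q1 := q + p + 1 / 2.

Lemma admissible_shift : admissible p q1 (shift_path g).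
Proof.
move=> t It; have g0 := g_gt0 It; have [_ _ a b c] := adm It.
have := Fconf_neq0 Lam0 adm It; rewrite -(Fconf_shift p q g0) => /Fconf_neq0E[h1 h2].
by split=> //; rewrite /shift_path /q1 ?(w1_shift p q g0) ?(w2_shift p q g0) ?(w3_shift p q g0).
Qed.

(** The explicit factors -1 and 1 give the three w_j the common form that [cderive1_inv2]
    differentiates. *)
Lemma inv_values z : 0 < Re z ->
  [/\ w1 (- q) p z = - 1 * (z^-1 ^+ 2 * w3 p q z^-1), w2 (- q) p z = 1 * (z^-1 ^+ 2 * w2 p q z^-1),
    w3 (- q) p z = 1 * (z^-1 ^+ 2 * w1 p q z^-1) &
    Fconf Lam (- q) p z = - (z ^+ 2 * Fconf Lam p q z^-1)].
Proof.
move=> z0; have zn := Re_gt0_neq0 z0.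
rewrite w1_inversion// w2_inversion// w3_inversion// Fconf_inversion//.
move: (w1 _ _ _) (w2 _ _ _) (w3 _ _ _) (Fconf _ _ _ _) => a b c d.
by split; field; rewrite zn.
Qed.

Lemma inv_values_path t : t \in `]0, 1[ -> let n := g (1 - t) in
  [/\ w1 (- q) p (inv_path g t) = - 1 * (n ^+ 2 * w3 p q n),
    w2 (- q) p (inv_path g t) = 1 * (n ^+ 2 * w2 p q n),
    w3 (- q) p (inv_path g t) = 1 * (n ^+ 2 * w1 p q n) &
    Fconf Lam (- q) p (inv_path g t) = - (n^-1 ^+ 2 * Fconf Lam p q n)].
Proof.
move=> /rev_I /g_gt0 /Re_inv_gt0 /inv_values; rewrite /inv_path !invrK.
by [].
Qed.

Lemma admissible_inv : admissible (- q) p (inv_path g).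
Proof.
move=> t It; have It' := rev_I It; have [_ _ a b c] := adm It'.
have n0 := g_neq0 mg It'; have F0 := Fconf_neq0 Lam0 adm It'.
have [E1 E2 E3 EF] := inv_values_path It.
have [h1 h2] : theta (- q) p (inv_path g t) != 0 /\ dtheta (- q) p (inv_path g t) != 0.
  apply: (@Fconf_neq0E _ Lam); rewrite EF oppr_eq0.
  by move: (Fconf _ _ _ _) F0 => F F0; rewrite mulf_neq0// expf_neq0// invr_neq0.
split=> //; rewrite ?E1 ?E2 ?E3.
- by move: (w3 _ _ _) c => x x0; rewrite !mulf_neq0// oppr_eq0 oner_eq0.
- by move: (w2 _ _ _) b => x x0; rewrite !mulf_neq0// oner_eq0.
- by move: (w1 _ _ _) a => x x0; rewrite !mulf_neq0// oner_eq0.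
Qed.

Lemma shift_relations (rF1 rW1 : R -> R[i]) :
  sqrt_branch (shift_path g) (Fconf Lam p q1) rF1 ->
  sqrt_branch (shift_path g) (fun mu => w1 p q1 mu * w2 p q1 mu * w3 p q1 mu) rW1 ->
  let a := coef_a p q g rF rW in let a' := coef_a p q1 (shift_path g) rF1 rW1 in
  exists2 ep : R[i], ep ^+ 2 = 1 & forall t, t \in `]0, 1[ ->
  [/\ a' 1 t = ep * a 1 t, a' 2 t = ep * a 3 t & a' 3 t = ep * a 2 t] /\
  [/\ a' 0 t = ep * a 0 t,
    coef_b0 Lam p q1 (shift_path g) rF1 rW1 t = ep * coef_b0 Lam p q g rF rW t &
    coef_b1 p q1 (shift_path g) rF1 rW1 t = ep * coef_b1 p q g rF rW t].
Proof.
move=> sF1 sW1 a a'; have adm1 := admissible_shift.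
have rn t : t \in `]0, 1[ -> rF t * rW t != 0 by exact: r_neq0 Lam0 adm sF sW t.
have V t : t \in `]0, 1[ -> [/\ w1 p q1 (shift_path g t) = w1 p q (g t),
    w2 p q1 (shift_path g t) = w3 p q (g t), w3 p q1 (shift_path g t) = w2 p q (g t) &
    Fconf Lam p q1 (shift_path g t) = Fconf Lam p q (g t)].
  move=> It; have g0 := g_gt0 It.
  by split; [exact: w1_shift|exact: w2_shift|exact: w3_shift|exact: Fconf_shift].
(* The quotient of the two products of roots is continuous with square 1, hence a constant sign. *)
have [ep ep2 hep] : exists2 s : R[i], s ^+ 2 = 1 &
    forall t, t \in `]0, 1[ -> rF1 t * rW1 t / (rF t * rW t) = s.
  apply: (sign_constant (r := fun t => rF1 t * rW1 t / (rF t * rW t))) => t It.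
    have h1 := r_econt sF1 sW1 It.
    have h2 := @econtV _ _ rc (fun t => rF t * rW t) t (rn t It) (r_econt sF sW It).
    exact: (econtM h1 h2).
  have [E1 E2 E3 EF] := V t It.
  have E : (rF1 t * rW1 t) ^+ 2 = (rF t * rW t) ^+ 2.
    rewrite (r_sqr sF1 sW1 It) (r_sqr sF sW It) E1 E2 E3 EF.
    by move: (w1 _ _ _) (w2 _ _ _) (w3 _ _ _) (Fconf _ _ _ _) => x y z F; ring.
  by rewrite expr_div_n E (divff (expf_neq0 2 (rn t It))).
exists ep => // t It; have [E1 E2 E3 EF] := V t It; have g0 := g_gt0 It.
have rE : rF1 t * rW1 t = ep * (rF t * rW t) by rewrite -(hep t It) (divfK (rn t It)).
have [A0 A1 A2 A3] := coef_aE p q g rF rW t.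
have [B0 B1 B2 B3] := coef_aE p q1 (shift_path g) rF1 rW1 t.
have [d1 d2 d3 dF] := cder_data Lam adm g0 It.
have D1 : cderive1 (w1 p q1) (shift_path g t) = _ := cderive1_shift g0 (@w1_shift R p q) d1.
have D2 : cderive1 (w2 p q1) (shift_path g t) = _ := cderive1_shift g0 (@w2_shift R p q) d3.
have D3 : cderive1 (w3 p q1) (shift_path g t) = _ := cderive1_shift g0 (@w3_shift R p q) d2.
have DF : cderive1 (Fconf Lam p q1) (shift_path g t) = _ := cderive1_shift g0 (fun z z0 => @Fconf_shift R p q z z0 Lam) dF.
split; split.
- by rewrite /a' /a B1 A1 E1 rE sign_mul.
- by rewrite /a' /a B2 A3 E2 rE sign_mul.
- by rewrite /a' /a B3 A2 E3 rE sign_mul.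
- by rewrite /a' /a B0 A0 rE (rderive1_shift_path mg It) sign_mul.
- apply: (etrans (coef_b0_val Lam0 adm1 sF1 sW1 It rE E1 E2 E3 EF D1 D2 D3 DF)).
  apply: (etrans _ (esym (congr1 (fun x => ep * x) (coef_b0E Lam0 adm sF sW It)))).
  exact: shift_b0_alg.
- apply: (etrans (coef_b1_val Lam0 adm1 sF1 It rE E1 E2 E3 EF)).
  apply: (etrans _ (esym (congr1 (fun x => ep * x)
    (coef_b1_val Lam0 adm sF It erefl erefl erefl erefl erefl)))).
  exact: shift_b1_alg.
Qed.

Lemma inv_relations (rF2 rW2 : R -> R[i]) :
  sqrt_branch (inv_path g) (Fconf Lam (- q) p) rF2 ->
  sqrt_branch (inv_path g) (fun mu => w1 (- q) p mu * w2 (- q) p mu * w3 (- q) p mu) rW2 ->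
  let a := coef_a p q g rF rW in let a' := coef_a (- q) p (inv_path g) rF2 rW2 in
  exists2 ep : R[i], ep ^+ 2 = 1 & forall t, t \in `]0, 1[ ->
  [/\ a' 1 t = - (ep * a 3 (1 - t)), a' 2 t = ep * a 2 (1 - t) & a' 3 t = ep * a 1 (1 - t)] /\
  [/\ a' 0 t = ep * a 0 (1 - t),
    coef_b0 Lam (- q) p (inv_path g) rF2 rW2 t = - (ep * coef_b0 Lam p q g rF rW (1 - t)) &
    coef_b1 (- q) p (inv_path g) rF2 rW2 t = - (ep * coef_b1 p q g rF rW (1 - t))].
Proof.
move=> sF2 sW2 a a'; have adm2 := admissible_inv.
have rn t : t \in `]0, 1[ -> rF (1 - t) * rW (1 - t) != 0.
  by move=> /rev_I; exact: r_neq0 Lam0 adm sF sW _.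
have n0 t : t \in `]0, 1[ -> g (1 - t) != 0 by move=> /rev_I; exact: g_neq0 mg.
have nrn t : t \in `]0, 1[ -> g (1 - t) ^+ 2 * (rF (1 - t) * rW (1 - t)) != 0.
  by move=> It; rewrite mulf_neq0 ?rn// expf_neq0// n0.
have [ep ep2 hep] : exists2 s : R[i], s ^+ 2 = 1 & forall t, t \in `]0, 1[ ->
    rF2 t * rW2 t / (g (1 - t) ^+ 2 * (rF (1 - t) * rW (1 - t))) = s.
  apply: (sign_constant
    (r := fun t => rF2 t * rW2 t / (g (1 - t) ^+ 2 * (rF (1 - t) * rW (1 - t))))) => t It.
    have [C1g _ _] := mu_path_C1 mg.
    have cg : econt rc (fun t => g (1 - t)) t by apply: econt_rev; apply: C1r_econt C1g (rev_I It).
    have cr : econt rc (fun t => rF (1 - t) * rW (1 - t)) t.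
      have h := r_econt sF sW (rev_I It).
      exact: (@econt_rev R (fun t => rF t * rW t) t h).
    have h1 := r_econt sF2 sW2 It.
    have h2 := @econtV _ _ rc (fun t => g (1 - t) ^+ 2 * (rF (1 - t) * rW (1 - t))) t
      (nrn t It) (econtM (econtM cg cg) cr).
    exact: (econtM h1 h2).
  have [E1 E2 E3 EF] := inv_values_path It.
  (* F contributes -n^-2 and the product of the w_j contributes -n^6, hence the factor n^4 and the
     weight n^2 in the quotient above. *)
  have E : (rF2 t * rW2 t) ^+ 2 = (g (1 - t) ^+ 2) ^+ 2 * (rF (1 - t) * rW (1 - t)) ^+ 2.
    rewrite (r_sqr sF2 sW2 It) (r_sqr sF sW (rev_I It)) E1 E2 E3 EF.
    move: (g (1 - t)) (n0 t It) (w1 _ _ _) (w2 _ _ _) (w3 _ _ _) (Fconf _ _ _ _) => n n_0 x y z F.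
    by field; rewrite n_0.
  by rewrite expr_div_n E -exprMn (divff (expf_neq0 2 (nrn t It))).
exists ep => // t It; have It' := rev_I It; have nt := n0 t It; have rt := rn t It.
have [E1 E2 E3 EF] := inv_values_path It; have nu0 := g_gt0 It'.
have rE : rF2 t * rW2 t = ep * (g (1 - t) ^+ 2 * (rF (1 - t) * rW (1 - t))).
  by rewrite -(hep t It) (divfK (nrn t It)).
have [A0 A1 A2 A3] := coef_aE p q g rF rW (1 - t).
have [B0 B1 B2 B3] := coef_aE (- q) p (inv_path g) rF2 rW2 t.
have [d1 d2 d3 dF] := cder_data Lam adm nu0 It'.
have D1 := cderive1_inv2 nu0 (fun z z0 => (let: And4 H _ _ _ := inv_values z0 in H)) d3.
have D2 := cderive1_inv2 nu0 (fun z z0 => (let: And4 _ H _ _ := inv_values z0 in H)) d2.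
have D3 := cderive1_inv2 nu0 (fun z z0 => (let: And4 _ _ H _ := inv_values z0 in H)) d1.
have DF := cderive1_sqr_inv nu0 (fun z z0 => (let: And4 _ _ _ H := inv_values z0 in H)) dF.
have [_ _ h1 h2 h3] := adm It'; have F0 := Fconf_neq0 Lam0 adm It'.
have dg : rderive1 g (1 - t) != 0 by have [] := (proj2 mg) _ It'.
split; split.
- apply: (etrans B1); apply: (etrans (congr2 (fun x y => x^-1 * y) rE E1)).
  apply: (etrans (inv_a_alg _ _ ep2 nt rt)); apply: (etrans (mulN1r _)).
  exact: (esym (congr1 (fun x => - (ep * x)) A3)).
- apply: (etrans B2); apply: (etrans (congr2 (fun x y => x^-1 * y) rE E2)).
  apply: (etrans (inv_a_alg _ _ ep2 nt rt)); apply: (etrans (mul1r _)).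
  exact: (esym (congr1 (fun x => ep * x) A2)).
- apply: (etrans B3); apply: (etrans (congr2 (fun x y => x^-1 * y) rE E3)).
  apply: (etrans (inv_a_alg _ _ ep2 nt rt)); apply: (etrans (mul1r _)).
  exact: (esym (congr1 (fun x => ep * x) A1)).
- apply: (etrans B0); apply: (etrans (congr2 (fun x y => x^-1 * y^-1) rE (rderive1_inv_path mg It))).
  apply: (etrans (inv_a0_alg ep2 nt rt dg)).
  exact: (esym (congr1 (fun x => ep * x) A0)).
- apply: (etrans (coef_b0_val Lam0 adm2 sF2 sW2 It rE E1 E2 E3 EF D1 D2 D3 DF)).
  apply: (etrans _ (esym (congr1 (fun x => - (ep * x)) (coef_b0E Lam0 adm sF sW It')))).
  exact: inv_b0_alg ep2 nt rt h1 h2 h3 F0.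
- apply: (etrans (coef_b1_val Lam0 adm2 sF2 It rE E1 E2 E3 EF)).
  apply: (etrans _ (esym (congr1 (fun x => - (ep * x))
    (coef_b1_val Lam0 adm sF It' erefl erefl erefl erefl erefl)))).
  exact: inv_b1_alg nt h1 h2 h3 F0.
Qed.

Lemma shift_spinorE gam (u : spinor R) :
  shift_spinor gam u = transport (M23 gam) (fun mu => mu - 'i) (@h23 R) u.
Proof.
apply/funext => mu; apply/funext => x.
rewrite /shift_spinor /relabel23 /transport /M23 -scalemxAl; congr (_ *: (_ *m u _ _)).
case: x => [[a b] [c d]]; rewrite /pair_of /h23 /row_of !row4E /=.
by congr (_, _); apply: complexP; rewrite !(ReM, ImM, ReD, ImD) /=; ring.
Qed.

Lemma inv_spinorE gam (u : spinor R) :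
  inv_spinor gam u = transport (M31 gam) (fun mu => 1 / mu) (@h31 R) u.
Proof.
apply/funext => mu; apply/funext => x.
rewrite /inv_spinor /relabel31 /transport /M31 -[RHS]mulmxA -[in RHS]scalemxAl.
congr (_ *m (_ *: (_ *m u _ _))).
case: x => [[a b] [c d]]; rewrite /pair_of /h31 /row_of !row4E /=.
by congr (_, _); apply: complexP; rewrite !(ReM, ImM, ReD, ImD, ReN, ImN) /=; ring.
Qed.

End Relations.

(** * Isospectrality and the bijections of eigenspinors *)

Unset Implicit Arguments.

Theorem theorem7p1 (R : realType) (gam : 'I_4 -> 'M[R[i]]_4)
    (Lam p q : R[i]) (g rF0 rW0 rF1 rW1 rF2 rW2 : R -> R[i]) :
  clifford gam -> Lam != 0 -> mu_path g -> admissible p q g ->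
  let g1 := shift_path g in
  let g2 := inv_path g in
  let q1 := q + p + 1 / 2 in
  sqrt_branch g (Fconf Lam p q) rF0 ->
  sqrt_branch g (fun mu => w1 p q mu * w2 p q mu * w3 p q mu) rW0 ->
  sqrt_branch g1 (Fconf Lam p q1) rF1 ->
  sqrt_branch g1 (fun mu => w1 p q1 mu * w2 p q1 mu * w3 p q1 mu) rW1 ->
  sqrt_branch g2 (Fconf Lam (- q) p) rF2 ->
  sqrt_branch g2 (fun mu => w1 (- q) p mu * w2 (- q) p mu * w3 (- q) p mu) rW2 ->
  let E0 := eigenspinors gam Lam p q g rF0 rW0 in
  let E1 := eigenspinors gam Lam p q1 g1 rF1 rW1 in
  let E2 := eigenspinors gam Lam (- q) p g2 rF2 rW2 in
  (isospectral E0 E1 /\ isospectral E0 E2) /\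
  forall e : R[i],
    set_bij (E0 e) (E1 e) (shift_spinor gam) /\
    set_bij (E0 e) (E2 e) (inv_spinor gam).
Proof.
move=> cl Lam0 mg adm g1 g2 q1 sF0 sW0 sF1 sW1 sF2 sW2 E0 E1 E2.
have C0 := coef_C1r Lam0 (mu_path_C1 mg) adm sF0 sW0.
have C1 := coef_C1r Lam0 (mu_path1_shift mg) (admissible_shift Lam0 mg adm) sF1 sW1.
have C2 := coef_C1r Lam0 (mu_path1_inv mg) (admissible_inv Lam0 mg adm) sF2 sW2.
have [ep1 ep1s rel1] := @shift_relations R Lam p q g rF0 rW0 Lam0 mg adm sF0 sW0 rF1 rW1 sF1 sW1.
have [ep2 ep2s rel2] := @inv_relations R Lam p q g rF0 rW0 Lam0 mg adm sF0 sW0 rF2 rW2 sF2 sW2.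
(* The shifted path keeps the parameter; the inverted path runs backwards, from 1/b to 1/a. *)
pose k1 (t : R) := t; pose k2 (t : R) := 1 - t.
have k1E (x s v : R) : k1 (s * v + x) = s * (1 * v) + k1 x by rewrite mul1r.
have k2E (x s v : R) : k2 (s * v + x) = s * (-1 * v) + k2 x by rewrite /k2; ring.
have k1c : continuous k1 by move=> x; exact: cvg_id.
have k2c : continuous k2 by move=> x; apply: cvgB; [exact: cvg_cst|exact: cvg_id].
have k1I (t : R) : t \in `]0, 1[ -> k1 t \in `]0, 1[ by [].
have k2I (t : R) : t \in `]0, 1[ -> k2 t \in `]0, 1[ by exact: rev_I.
have k1K : involutive k1 by [].
have k2K : involutive k2 by move=> t; rewrite /k2; ring.
have [MiM MMi] := M23K cl.
have [NiN NNi] := M31K cl.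
have P1 (c : R[i]) G y : vCk 1 G -> dom y ->
    DopW Lam p q1 g1 rF1 rW1 gam (fun z => (c *: M23 gam) *m G (pull k1 (@h23 R) z)) y =
    (ep1 * c) *: (M23 gam *m DopW Lam p q g rF0 rW0 gam G (pull k1 (@h23 R) y)).
  move=> hG yd; have [r1 r2] := rel1 y.1 (proj1 yd); rewrite /DopW.
  apply: (Dop_pull23 (sg := 1) (hi := @h23i R)); first [exact: k1E | exact: k1c | exact: k1I | exact: h23_linear | exact: h23K
    | exact: h23_e1 | exact: h23_e2 | exact: h23_e3 | exact: (M23_gam cl) | exact: r1 | exact: r2
    | exact: hG | exact: yd | by [] ].
have P2 (c : R[i]) G y : vCk 1 G -> dom y ->
    DopW Lam (- q) p g2 rF2 rW2 gam (fun z => (c *: M31 gam) *m G (pull k2 (@h31 R) z)) y =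
    (ep2 * c) *: (M31 gam *m DopW Lam p q g rF0 rW0 gam G (pull k2 (@h31 R) y)).
  move=> hG yd; have [r1 r2] := rel2 y.1 (proj1 yd); rewrite /DopW.
  apply: (Dop_pull31 (sg := -1) (hi := @h31i R)); first [exact: k2E | exact: k2c | exact: k2I | exact: h31_linear | exact: h31K
    | exact: h31_e1 | exact: h31_e2 | exact: h31_e3 | exact: (M31_gam cl) | exact: r1 | exact: r2
    | exact: hG | exact: yd | by [] ].
pose m1 (z : R[i]) := z - 'i; pose m1i (z : R[i]) := z + 'i; pose m2 (z : R[i]) := 1 / z.
have m1K : cancel m1 m1i by move=> z; rewrite /m1 /m1i subrK.
have m1iK : cancel m1i m1 by move=> z; rewrite /m1 /m1i addrK.
have m2K : cancel m2 m2 by move=> z; rewrite /m2 !div1r invrK.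
have mg1 (t : R) : m1 (g1 t) = g (k1 t) by rewrite /m1 /g1 /shift_path addrK.
have mg2 (t : R) : m2 (g2 t) = g (k2 t) by rewrite /m2 /g2 /inv_path div1r invrK.
have T1 : shift_spinor gam = transport (M23 gam) m1 (@h23 R).
  by apply/funext => u; exact: shift_spinorE.
have T2 : inv_spinor gam = transport (M31 gam) m2 (@h31 R).
  by apply/funext => u; exact: inv_spinorE.
have B1 := transport_bij k1E k1c k1I k1K (@h23_linear R) (@h23K R) (@nsq_h23 R)
  (@h23i_linear R) (@h23iK R) (@nsq_h23i R) m1K m1iK mg1 MiM MMi ep1s C0 C1 P1.
have B2 := transport_bij k2E k2c k2I k2K (@h31_linear R) (@h31K R) (@nsq_h31 R)
  (@h31i_linear R) (@h31iK R) (@nsq_h31i R) m2K m2K mg2 NiN NNi ep2s C0 C2 P2.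
have I1 := transport_isospectral k1E k1c k1I k1K (@h23_linear R) (@h23K R) (@nsq_h23 R)
  (@h23i_linear R) (@h23iK R) (@nsq_h23i R) m1K m1iK mg1 MiM MMi ep1s C0 C1 P1.
have I2 := transport_isospectral k2E k2c k2I k2K (@h31_linear R) (@h31K R) (@nsq_h31 R)
  (@h31i_linear R) (@h31iK R) (@nsq_h31i R) m2K m2K mg2 NiN NNi ep2s C0 C2 P2.
by split=> [|e]; [split|rewrite T1 T2; split; [exact: B1|exact: B2]].
Qed.
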